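(* Let $i,j\ge0$ be integers and let $\lambda$ be a partition. The multiplicity of $\mathbb{S}^{\lambda[n]}$ in the $S_n$-module $[DR_n]_{(i,j)}\cong_{S_n}[DH_n]_{(i,j)}$ stabilizes (is constant in $n$) once $n\ge\max(|\lambda|+i+j,\ 2|\lambda|)$.
   Context: For a partition $\lambda=(\lambda_1,\dots,\lambda_l)$ and $n$ with $n-|\lambda|\ge\lambda_1$ (with $\lambda_1=0$ if $\lambda=\emptyset$), $\lambda[n]:=(n-|\lambda|,\lambda_1,\dots,\lambda_l)\vdash n$; $\mathbb{S}^{\nu}$ is the irreducible $\mathbb{C}[S_n]$-module (Specht module) indexed by $\nu\vdash n$. $S_n$ acts diagonally on $\mathbb{C}[x_1,\dots,x_n,y_1,\dots,y_n]$ by $\sigma\cdot x_k=x_{\sigma(k)}$, $\sigma\cdot y_k=y_{\sigma(k)}$. The diagonal coinvariant algebra $DR_n$ is the quotient of this polynomial ring by the ideal generated by all $S_n$-invariant polynomials with no constant term. The diagonal harmonics are $$DH_n=\Bigl\{f : \sum_{k=1}^n\Bigl(\tfrac{\partial}{\partial x_k}\Bigr)^a\Bigl(\tfrac{\partial}{\partial y_k}\Bigr)^b f=0\ \text{ for all } (a,b)\in\mathbb{N}^2\setminus\{(0,0)\}\Bigr\}.$$ Both are bigraded $S_n$-modules, and $[\,\cdot\,]_{(i,j)}$ denotes the component of degree $i$ in the $x$ variables and $j$ in the $y$ variables. *)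

(* Defs.v *)
From HB Require Import structures.
From mathcomp Require Import all_boot all_order all_fingroup all_algebra.
From mathcomp Require Import generic_quotient ring_quotient complex mpoly.
From mathcomp Require Import boolp reals.

Set Implicit Arguments.
Unset Strict Implicit.
Unset Printing Implicit Defensive.

Import GRing.Theory.
Local Open Scope ring_scope.

(* The product s * t of permutations means "first s, then t", so a left module
   in the usual convention (composition of functions) is an antihomomorphism
   for this product; this is the orientation of [linrepM], and it is the same
   for all the representations below. *)
Record linrep (gT : finGroupType) (C : fieldType) (V : lmodType C) := LinRep {
  linrep_act :> gT -> V -> V;
  linrepP : forall (g : gT) (a : C) (u v : V),
    linrep_act g (a *: u + v) = a *: linrep_act g u + linrep_act g v;
  linrep1 : forall v : V, linrep_act 1%g v = v;
  linrepM : forall (g h : gT) (v : V),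
    linrep_act (g * h)%g v = linrep_act h (linrep_act g v)
}.

Section Multiplicity.

Variables (gT : finGroupType) (C : fieldType).

Definition submodule (V : lmodType C) (rho : linrep gT V) (W : V -> Prop) :=
  [/\ W 0,
      forall (a : C) (u v : V), W u -> W v -> W (a *: u + v)
    & forall (g : gT) (u : V), W u -> W (rho g u)].

Definition irreducible_submodule (V : lmodType C) (rho : linrep gT V)
    (W : V -> Prop) :=
  [/\ submodule rho W,
      exists2 u, W u & u != 0
    & forall U : V -> Prop, submodule rho U -> (forall u, U u -> W u) ->
        (forall u, U u -> u = 0) \/ (forall u, W u -> U u)].

(* Isomorphism of the submodules W and W'; the map f is only relevant on W. *)
Definition isomorphic (V V' : lmodType C)
    (rho : linrep gT V) (W : V -> Prop)
    (rho' : linrep gT V') (W' : V' -> Prop) :=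
  exists f : V -> V',
  [/\ forall (a : C) (u v : V), W u -> W v -> f (a *: u + v) = a *: f u + f v,
      forall (g : gT) (u : V), W u -> f (rho g u) = rho' g (f u),
      forall u, W u -> W' (f u),
      forall u v, W u -> W v -> f u = f v -> u = v
    & forall v, W' v -> exists2 u, W u & f u = v].

Definition direct_sum (V : lmodType C) (W : V -> Prop) (r : nat)
    (Ws : 'I_r -> V -> Prop) :=
  (forall v, W v <-> exists2 w : 'I_r -> V, forall k, Ws k (w k)
                                           & v = \sum_(k < r) w k)
  /\ (forall w : 'I_r -> V, (forall k, Ws k (w k)) ->
        \sum_(k < r) w k = 0 -> forall k, w k = 0).

(* The irreducible module S occurs exactly m times in a decomposition of W into
   irreducible submodules; by the Krull-Schmidt theorem m does not depend on
   the decomposition. *)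
Definition has_multiplicity (U : lmodType C) (sigma : linrep gT U)
    (S : U -> Prop) (V : lmodType C) (rho : linrep gT V) (W : V -> Prop)
    (m : nat) :=
  exists r (Ws : 'I_r -> V -> Prop),
  [/\ forall k, irreducible_submodule rho (Ws k),
      direct_sum W Ws
    & #|[set k | `[< isomorphic rho (Ws k) sigma S >]]| = m].

End Multiplicity.

Definition is_partition (nu : seq nat) := sorted geq nu && all (leq 1) nu.

(* lambda[n], for n - |lambda| >= lambda_1; when n = 0 this is [:: 0]. *)
Definition padded (lam : seq nat) (n : nat) : seq nat :=
  (n - sumn lam)%N :: lam.

Section Specht.

Variables (C : fieldType) (n : nat) (nu : seq nat).

(* For nu a partition of n, the boxes of the diagram of nu are numbered from 0
   to n - 1 in reading order; a tableau is the permutation t sending the number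
   of a box to the entry of that box. *)
Definition tableau_row (t : 'S_n) (e : 'I_n) : nat :=
  reshape_index nu ((t^-1)%g e).
Definition tableau_col (t : 'S_n) (e : 'I_n) : nat :=
  reshape_offset nu ((t^-1)%g e).

(* A tabloid is given by the sets of entries of its successive rows. *)
Definition tabloid := {ffun 'I_(size nu) -> {set 'I_n}}.
Definition tabloid_of (t : 'S_n) : tabloid :=
  [ffun r : 'I_(size nu) => [set e | tableau_row t e == r]].

Definition tabloid_act (s : 'S_n) (T : tabloid) : tabloid :=
  [ffun r => s @: T r].

Definition tabloid_space := {ffun tabloid -> C^o}.

Lemma tabloid_act1 (T : tabloid) : tabloid_act 1%g T = T.
Proof.
apply/ffunP => r; rewrite ffunE -[RHS]imset_id.
by apply: eq_imset => e; rewrite perm1.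
Qed.

Lemma tabloid_actM (s t : 'S_n) (T : tabloid) :
  tabloid_act (s * t)%g T = tabloid_act t (tabloid_act s T).
Proof.
apply/ffunP => r; rewrite !ffunE -imset_comp.
by apply: eq_imset => e; rewrite permM.
Qed.

Definition tabloid_space_act (s : 'S_n) (v : tabloid_space) : tabloid_space :=
  [ffun T => v (tabloid_act (s^-1)%g T)].

Lemma tabloid_space_actP s (a : C) (u v : tabloid_space) :
  tabloid_space_act s (a *: u + v)
  = a *: tabloid_space_act s u + tabloid_space_act s v.
Proof. by apply/ffunP => T; rewrite !ffunE. Qed.

Lemma tabloid_space_act1 v : tabloid_space_act 1%g v = v.
Proof. by apply/ffunP => T; rewrite ffunE invg1 tabloid_act1. Qed.

Lemma tabloid_space_actM s t v :
  tabloid_space_act (s * t)%g v = tabloid_space_act t (tabloid_space_act s v).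
Proof. by apply/ffunP => T; rewrite !ffunE invMg tabloid_actM. Qed.

Definition tabloid_rep : linrep 'S_n tabloid_space :=
  LinRep tabloid_space_actP tabloid_space_act1 tabloid_space_actM.

Definition column_stabilizer (t : 'S_n) : {set 'S_n} :=
  [set s : 'S_n | [forall e, tableau_col t (s e) == tableau_col t e]].

(* The tableau obtained by applying s to the entries of t is t * s. *)
Definition polytabloid (t : 'S_n) : tabloid_space :=
  [ffun T => \sum_(s in column_stabilizer t)
     (-1) ^+ s * (tabloid_of (t * s)%g == T)%:R].

(* The Specht module S^nu, as a submodule of [tabloid_rep]. *)
Definition specht (v : tabloid_space) : Prop :=
  exists c : 'S_n -> C, v = \sum_(t : 'S_n) c t *: polytabloid t.

End Specht.

Section DiagonalCoinvariants.

Variables (C : fieldType) (n : nat).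

Local Notation P := {mpoly C[n + n]}.

(* x_k is the variable of index [lshift n k], y_k that of index [rshift n k]. *)
Definition diag_fun (s : 'S_n) (v : 'I_(n + n)) : 'I_(n + n) :=
  match split v with
  | inl k => lshift n (s k)
  | inr k => rshift n (s k)
  end.

Lemma diag_fun_lshift s k : diag_fun s (lshift n k) = lshift n (s k).
Proof. by rewrite /diag_fun (unsplitK (inl k)). Qed.

Lemma diag_fun_rshift s k : diag_fun s (rshift n k) = rshift n (s k).
Proof. by rewrite /diag_fun (unsplitK (inr k)). Qed.

Lemma diag_fun_inj s : injective (diag_fun s).
Proof.
apply: (can_inj (g := diag_fun (s^-1)%g)) => v.
by case: (split_ordP v) => k ->;
  rewrite ?(diag_fun_lshift, diag_fun_rshift) permK.
Qed.

Definition diag_perm (s : 'S_n) : 'S_(n + n) := perm (@diag_fun_inj s).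

Definition poly_act (s : 'S_n) (f : P) : P := msym (diag_perm s) f.

Lemma poly_actP s (a : C) (f g : P) :
  poly_act s (a *: f + g) = a *: poly_act s f + poly_act s g.
Proof. exact: linearP. Qed.

Lemma diag_perm1 : diag_perm 1%g = 1%g.
Proof.
apply/permP => v; rewrite permE perm1.
by case: (split_ordP v) => k ->;
  rewrite ?(diag_fun_lshift, diag_fun_rshift) perm1.
Qed.

Lemma diag_permM s t : diag_perm (s * t)%g = (diag_perm s * diag_perm t)%g.
Proof.
apply/permP => v; rewrite permM !permE.
by case: (split_ordP v) => k ->;
  rewrite ?(diag_fun_lshift, diag_fun_rshift) permM.
Qed.

Lemma poly_act1 f : poly_act 1%g f = f.
Proof.
apply/mpolyP => m; rewrite mcoeff_sym diag_perm1; congr (f@__).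
by apply/mnmP => v; rewrite mnmE perm1.
Qed.

Lemma poly_actM s t f : poly_act (s * t)%g f = poly_act t (poly_act s f).
Proof.
apply/mpolyP => m; rewrite !mcoeff_sym diag_permM; congr (f@__).
by apply/mnmP => v; rewrite !mnmE permM.
Qed.

Definition poly_rep : linrep 'S_n P := LinRep poly_actP poly_act1 poly_actM.

Definition bihomogeneous (i j : nat) (f : P) : Prop :=
  forall m, m \in msupp f ->
    (\sum_(k < n) m (lshift n k) = i)%N /\ (\sum_(k < n) m (rshift n k) = j)%N.

Definition invariant_no_const (h : P) : Prop :=
  (forall s : 'S_n, poly_act s h = h) /\ h@_0 = 0.

Definition in_inv_ideal (f : P) : Prop :=
  exists r (g h : 'I_r -> P),
    (forall k, invariant_no_const (h k)) /\ f = \sum_(k < r) g k * h k.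

Definition inv_ideal : {pred P} := [pred f | `[< in_inv_ideal f >]].

Lemma inv_ideal_closed : idealr_closed inv_ideal.
Proof.
split.
- by apply/asboolP; exists 0%N, (fun=> 0), (fun=> 0); split; [case | rewrite big_ord0].
- apply/asboolP => -[r [g [h [hinv /(congr1 (mcoeff 0))]]]].
  rewrite mcoeff1 eqxx /= raddf_sum /= big1 => [/eqP|k _].
    by rewrite oner_eq0.
  by rewrite rmorphM /= (proj2 (hinv k)) mulr0.
- move=> a u v /asboolP[r1 [g1 [h1 [inv1 ->]]]] /asboolP[r2 [g2 [h2 [inv2 ->]]]].
  apply/asboolP.
  exists (r1 + r2)%N,
    (fun k => match split k with inl k1 => a * g1 k1 | inr k2 => g2 k2 end),
    (fun k => match split k with inl k1 => h1 k1 | inr k2 => h2 k2 end).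
  split=> [k|]; first by case: split.
  rewrite big_split_ord mulr_sumr /=; congr (_ + _); apply: eq_bigr => k _.
    by rewrite (unsplitK (inl k)) mulrA.
  by rewrite (unsplitK (inr k)).
Qed.

HB.instance Definition _ := isIdealr.Build P inv_ideal inv_ideal_closed.

Definition DR := {ideal_quot inv_ideal}.
HB.instance Definition _ := GRing.ComNzRing.on DR.

Definition DR_proj (f : P) : DR := \pi_DR%qT f.

Lemma DR_projP (u : DR) : exists f, u = DR_proj f.
Proof. by exists (repr u); rewrite /DR_proj reprK. Qed.

Lemma DR_proj_eq (f g : P) : DR_proj f = DR_proj g <-> in_inv_ideal (f - g).
Proof.
rewrite /DR_proj; split=> [/eqP|/asboolP fg].
  by rewrite -Quotient.idealrBE => /asboolP.
by apply/eqP; rewrite -Quotient.idealrBE.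
Qed.

Fact DR_proj_zmod_morphism : zmod_morphism DR_proj.
Proof. by move=> f g; rewrite /DR_proj raddfB. Qed.
Fact DR_proj_monoid_morphism : monoid_morphism DR_proj.
Proof. by split=> [|f g]; rewrite /DR_proj ?rmorph1 ?rmorphM. Qed.
HB.instance Definition _ :=
  GRing.isZmodMorphism.Build P DR DR_proj DR_proj_zmod_morphism.
HB.instance Definition _ :=
  GRing.isMonoidMorphism.Build P DR DR_proj DR_proj_monoid_morphism.

Definition DR_scale (a : C) (u : DR) : DR := DR_proj a%:MP * u.

Fact DR_scaleA a b u : DR_scale a (DR_scale b u) = DR_scale (a * b) u.
Proof. by rewrite /DR_scale mulrA -rmorphM mpolyCM. Qed.
Fact DR_scale1 : left_id 1 DR_scale.
Proof. by move=> u; rewrite /DR_scale mpolyC1 rmorph1 mul1r. Qed.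
Fact DR_scaleDr : right_distributive DR_scale +%R.
Proof. by move=> a u v; rewrite /DR_scale mulrDr. Qed.
Fact DR_scaleDl u : {morph DR_scale^~ u : a b / a + b}.
Proof. by move=> a b; rewrite /DR_scale mpolyCD rmorphD mulrDl. Qed.
HB.instance Definition _ := GRing.Zmodule_isLmodule.Build C DR
  DR_scaleA DR_scale1 DR_scaleDr DR_scaleDl.

Fact DR_proj_scalable : scalable DR_proj.
Proof. by move=> a f; rewrite -mul_mpolyC rmorphM. Qed.
HB.instance Definition _ :=
  GRing.isScalable.Build C P DR *:%R DR_proj DR_proj_scalable.

Lemma in_inv_ideal_act s f : in_inv_ideal f -> in_inv_ideal (poly_act s f).
Proof.
move=> [r [g [h [hinv ->]]]].
exists r, (fun k => poly_act s (g k)), h; split=> //.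
rewrite /poly_act rmorph_sum /=; apply: eq_bigr => k _.
by rewrite rmorphM -[X in _ * X]/(poly_act s (h k)) (proj1 (hinv k)).
Qed.

Definition DR_act (s : 'S_n) (u : DR) : DR := DR_proj (poly_act s (repr u)).

Lemma DR_act_proj s f : DR_act s (DR_proj f) = DR_proj (poly_act s f).
Proof.
apply/DR_proj_eq; rewrite /poly_act -rmorphB; apply: in_inv_ideal_act.
by apply/DR_proj_eq; rewrite /DR_proj reprK.
Qed.

Lemma DR_actP s (a : C) (u v : DR) :
  DR_act s (a *: u + v) = a *: DR_act s u + DR_act s v.
Proof.
have [f ->] := DR_projP u; have [g ->] := DR_projP v.
by rewrite -linearP !DR_act_proj poly_actP linearP.
Qed.

Lemma DR_act1 u : DR_act 1%g u = u.
Proof. by have [f ->] := DR_projP u; rewrite DR_act_proj poly_act1. Qed.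

Lemma DR_actM s t u : DR_act (s * t)%g u = DR_act t (DR_act s u).
Proof. by have [f ->] := DR_projP u; rewrite !DR_act_proj poly_actM. Qed.

Definition DR_rep : linrep 'S_n DR := LinRep DR_actP DR_act1 DR_actM.

Definition DR_component (i j : nat) (u : DR) : Prop :=
  exists2 f, bihomogeneous i j f & u = DR_proj f.

Definition harmonic (f : P) : Prop :=
  forall a b : nat, (a, b) != (0, 0)%N ->
    \sum_(k < n) iter a (mderiv (lshift n k)) (iter b (mderiv (rshift n k)) f)
    = 0.

(* Submodule of [poly_rep]. *)
Definition DH_component (i j : nat) (f : P) : Prop :=
  harmonic f /\ bihomogeneous i j f.

End DiagonalCoinvariants.

(* Main.v *)
Require Import Defs.
From HB Require Import structures.
From mathcomp Require Import all_boot all_order all_fingroup all_algebra.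
From mathcomp Require Import mpoly boolp.
From mathcomp Require Import complex reals.

(** Let a = |lambda|, p = n - a, let B be the set of entries of the first row of
    the standard tableau of shape lambda[n], and let R, C be its row and column
    stabilizers inside Sym (~: B). In an S_n-module W call v primitive if it is
    fixed by Sym B and killed by the symmetrization over Sym (k |: B) for every k
    outside B. If T denotes the Young symmetrizer of R and C, then the multiplicity
    of the Specht module of lambda[n] in W is the dimension of the image under T of
    the primitive vectors of W. The main point is that the column antisymmetrizer
    of the whole tableau is injective on the primitive vectors that are
    sign-invariant under C, which follows from a positivity argument.

    The diagonal harmonics are the orthogonal complement of the ideal I generated
    by the invariants, so in bidegree (i, j) the primitive harmonics are the
    orthogonal complement, inside P^(Sym B), of the sum of I^(Sym B) and the spaces
    P^(Sym (k |: B)). Setting x_0 = y_0 = 0 maps the polynomials in n + 1 pairs of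
    variables onto those in n pairs, bijectively on invariants of Sym B as soon as
    p >= i + j; as invariants of the whole symmetric group lift too, this also
    holds on the subspaces just listed. Hence the dimensions do not depend on n. *)

Set Implicit Arguments.
Unset Strict Implicit.
Unset Printing Implicit Defensive.

Import Order.TTheory GRing.Theory Num.Theory.
Local Open Scope ring_scope.

(** * Finite-dimensional subspaces *)

Section Dimension.
Variable C : fieldType.
Implicit Types V U : lmodType C.

(** Being fixed by Sym B alone would admit every shape whose first row has at least p boxes; the
    killing conditions are there to exclude the longer first rows. What is left is governed by Sym
    (~: B), a group on a letters, so T is the same operator for every n. The bound n >= 2a makes the
    first row at least as long as every other row. The bound n >= a + i + j says p >= i + j: a
    monomial of degree i + j then omits some pair of variables among the p + 1 pairs indexed by the
    lengthened first row, and that pair can be moved to index 0. Restriction does not preserve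
    harmonics: from two pairs of variables to one it sends x_0 - x_1 to -x_1. So the primitive
    harmonics are not transported themselves; the multiplicity is a difference of the dimensions of
    two images under T, both of which are transported. For this the images under T of the two
    orthogonal summands must meet only in zero, and they do because the adjoints of the permutations
    in T preserve the primitive harmonics. *)

Definition subspace V (W : V -> Prop) :=
  W 0 /\ forall (a : C) (u v : V), W u -> W v -> W (a *: u + v).

Definition linear_on V U (W : V -> Prop) (g : V -> U) :=
  forall (a : C) (u v : V), W u -> W v -> g (a *: u + v) = a *: g u + g v.

(** A dimension is witnessed by a linear parametrization because the ambient modules, such as
    polynomial rings, need not be finite-dimensional. *)
Definition has_dim V (W : V -> Prop) (m : nat) :=
  exists2 f : {linear 'rV[C]_m -> V},
    injective f & forall v, W v <-> exists x, v = f x.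

Lemma linear_bundle V U (g : V -> U) :
  linear g -> exists f : {linear V -> U}, f =1 g.
Proof.
move=> lg.
pose L := GRing.isLinear.Build C V U *:%R g lg.
by exists (HB.pack_for {linear V -> U} g L).
Qed.

Lemma subspace_comb V (W : V -> Prop) (I : Type) (r : seq I) (P : pred I)
    (c : I -> C) (w : I -> V) :
  subspace W -> (forall k, P k -> W (w k)) ->
  W (\sum_(k <- r | P k) c k *: w k).
Proof.
move=> [W0 WD] Ww; elim: r => [|k r IH]; first by rewrite big_nil.
by rewrite big_cons; case: ifP => // Pk; apply: WD => //; apply: Ww.
Qed.

Lemma subspaceD V (W : V -> Prop) u v : subspace W -> W u -> W v -> W (u + v).
Proof. by move=> [_ WD] Wu Wv; rewrite -[u]scale1r; apply: WD. Qed.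

Lemma subspaceZ V (W : V -> Prop) a v : subspace W -> W v -> W (a *: v).
Proof. by move=> [W0 WD] Wv; rewrite -[_ *: _]addr0; apply: WD. Qed.

Lemma subspaceB V (W : V -> Prop) u v : subspace W -> W u -> W v -> W (u - v).
Proof.
by move=> sW Wu Wv; rewrite -scaleN1r; apply: subspaceD => //; apply: subspaceZ.
Qed.

Lemma subspace_sum V (W : V -> Prop) (I : Type) (r : seq I) (P : pred I)
    (w : I -> V) :
  subspace W -> (forall k, P k -> W (w k)) -> W (\sum_(k <- r | P k) w k).
Proof.
move=> sW Ww; rewrite (eq_bigr (fun k => 1 *: w k)) => [|k _].
  exact: subspace_comb.
by rewrite scale1r.
Qed.

Lemma linear_on0 V U (W : V -> Prop) (g : V -> U) :
  subspace W -> linear_on W g -> g 0 = 0.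
Proof.
move=> [W0 _] lg; have := lg (-1) 0 0 W0 W0.
by rewrite scaler0 addr0 scaleN1r addNr.
Qed.

Lemma linear_onB V U (W : V -> Prop) (g : V -> U) u v :
  linear_on W g -> W u -> W v -> g (v - u) = g v - g u.
Proof. by move=> lg Wu Wv; rewrite addrC -scaleN1r lg // scaleN1r addrC. Qed.

Lemma linear_on_sum V U (W : V -> Prop) (g : V -> U) (I : Type) (r : seq I)
    (P : pred I) (w : I -> V) :
  subspace W -> linear_on W g -> (forall k, P k -> W (w k)) ->
  g (\sum_(k <- r | P k) w k) = \sum_(k <- r | P k) g (w k).
Proof.
move=> sW lg Ww; elim: r => [|k r IH]; first by rewrite !big_nil (linear_on0 sW).
rewrite !big_cons; case: ifP => // Pk.
rewrite -[w k]scale1r lg ?IH ?scale1r //; first exact: Ww.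
exact: subspace_sum.
Qed.

Lemma has_dim_subspace V (W : V -> Prop) m : has_dim W m -> subspace W.
Proof.
move=> [f finj fW]; split=> [|a u v /fW[x ->] /fW[y ->]].
  by apply/fW; exists 0; rewrite linear0.
by apply/fW; exists (a *: x + y); rewrite linearP.
Qed.

Lemma has_dim_ext V (W W' : V -> Prop) m :
  (forall v, W v <-> W' v) -> has_dim W m -> has_dim W' m.
Proof. by move=> e [f fi fW]; exists f => // v; rewrite -e. Qed.

Lemma has_dim_le V (W W' : V -> Prop) m m' :
  has_dim W m -> has_dim W' m' -> (forall v, W v -> W' v) -> (m <= m')%N.
Proof.
move=> [f fi fW] [f' fi' fW'] sub.
have /choice[x fx] (k : 'I_m) : exists x, f (delta_mx 0 k) = f' x.
  by apply/fW'/sub/fW; exists (delta_mx 0 k).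
pose M := \matrix_k x k.
have fM y : f y = f' (y *m M).
  rewrite {1}[y]row_sum_delta mulmx_sum_row !linear_sum.
  by apply: eq_bigr => k _; rewrite !linearZ fx rowK.
suff /eqP <- : row_free M by apply: rank_leq_col.
rewrite -kermx_eq0; apply/eqP/row_matrixP => k; rewrite row0.
apply: fi; rewrite fM linear0 -row_mul mulmx_ker row0.
by rewrite linear0.
Qed.

Lemma has_dim_uniq V (W : V -> Prop) m m' :
  has_dim W m -> has_dim W m' -> m = m'.
Proof.
move=> h h'; apply/eqP; rewrite eqn_leq.
by rewrite (has_dim_le h h') ?(has_dim_le h' h).
Qed.

(** Among the row-free matrices whose rows parametrize vectors of [W'], one with the most rows gives
    a basis of [W']: a vector outside its row space could be stacked on top. The number of columns
    bounds the number of rows. *)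
Lemma has_dim_sub V (W W' : V -> Prop) m :
  has_dim W m -> subspace W' -> (forall v, W' v -> W v) ->
  exists m', has_dim W' m'.
Proof.
move=> [f fi fW] [W'0 W'D] sub.
pose P r := `[< exists2 A : 'M[C]_(r, m), row_free A &
                 forall k, W' (f (row k A)) >].
have P0 : exists r, P r.
  exists 0%N; apply/asboolP; exists 0; last by case.
  by rewrite /row_free mxrank0.
have Pm r : P r -> (r <= m)%N.
  by move=> /asboolP[A /eqP rA _]; have := rank_leq_col A; rewrite rA.
case: (ex_maxnP P0 Pm) => r /asboolP[A Afree AW] rmax.
have lfA : linear (fun x => f (x *m A)).
  by move=> a u v; rewrite mulmxDl -scalemxAl linearP.
have [g gE] := linear_bundle lfA.
exists r, g => [x y|v]; first by rewrite !gE => /fi; apply: row_free_inj.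
split=> [W'v|[x ->]]; last first.
  rewrite gE mulmx_sum_row linear_sum.
  rewrite (eq_bigr (fun k => x 0 k *: f (row k A))) => [|k _].
    exact: subspace_comb.
  by rewrite linearZ.
have /fW[x vx] := sub _ W'v.
suff /submxP[D Dx] : (x <= A)%MS by exists D; rewrite gE -Dx.
apply/negPn/negP => nxA.
suff /rmax : P (1 + r)%N by rewrite add1n ltnn.
apply/asboolP; exists (col_mx x A); last first.
  move=> k; case: (split_ordP k) => l ->.
    by rewrite rowKu (_ : row l x = x) -?vx //; apply/rowP => i; rewrite !mxE ord1.
  by rewrite rowKd.
rewrite /row_free -addsmxE.
have capx : (x :&: A)%MS = 0.
  apply/eqP; rewrite -mxrank_eq0; have := mxrankS (capmxSl x A).
  have := rank_leq_row x; rewrite leq_eqVlt => /orP[/eqP rx|]; last first.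
    rewrite ltnS leqn0 => rx0; have /eqP x0 : x == 0 by rewrite -mxrank_eq0.
    by rewrite x0 sub0mx in nxA.
  rewrite rx leq_eqVlt => /orP[/eqP rc|]; last by rewrite ltnS leqn0.
  case/negP: nxA; apply: submx_trans (capmxSr x A).
  by rewrite -(geq_leqif (mxrank_leqif_sup (capmxSl x A))) rx rc.
have xn0 : x != 0 by apply: contraNneq nxA => ->; apply: sub0mx.
by rewrite mxrank_disjoint_sum // rank_rV xn0 (eqP Afree).
Qed.

Lemma has_dim_image V U (W : V -> Prop) (g : V -> U) m :
  has_dim W m -> linear_on W g ->
  (forall u v, W u -> W v -> g u = g v -> u = v) ->
  has_dim (fun v => exists2 u, W u & v = g u) m.
Proof.
move=> [f fi fW] lg gi; have Wf x : W (f x) by apply/fW; exists x.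
have [h hE] : exists h : {linear _ -> _}, h =1 (fun x => g (f x)).
  by apply: linear_bundle => a u v; rewrite linearP lg.
exists h => [x y|v]; first by rewrite !hE => /gi e; apply/fi/e.
split=> [[u /fW[x ->] ->]|[x ->]]; first by exists x; rewrite hE.
by exists (f x); rewrite ?hE.
Qed.

Lemma has_dim0 V (W : V -> Prop) : has_dim W 0 <-> (forall v, W v <-> v = 0).
Proof.
split=> [[f fi fW] v|W0].
  rewrite fW; split=> [[x ->]|->]; last by exists 0; rewrite linear0.
  by rewrite (thinmx0 x) linear0.
have [f fE] : exists f : {linear 'rV[C]_0 -> V}, f =1 (fun=> 0).
  by apply: linear_bundle => a u v; rewrite scaler0 addr0.
exists f => [x y _|v]; first by rewrite [x]thinmx0 [y]thinmx0.
by rewrite W0; split=> [->|[x ->]]; [exists 0 |]; rewrite fE.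
Qed.

Lemma has_dim1 V (W : V -> Prop) w :
  w != 0 -> W w -> subspace W -> (forall v, W v -> exists a : C, v = a *: w) ->
  has_dim W 1.
Proof.
move=> w0 Ww sW Wall.
have [f fE] : exists f : {linear 'rV[C]_1 -> V}, f =1 (fun x => x 0 0 *: w).
  by apply: linear_bundle => a u v; rewrite !mxE scalerDl scalerA.
exists f => [x y|v].
  rewrite !fE => /eqP; rewrite -subr_eq0 -scalerBl scaler_eq0 (negPf w0) orbF.
  by rewrite subr_eq0 => /eqP e; apply/rowP => k; rewrite ord1.
split=> [/Wall[a ->]|[x ->]]; last by rewrite fE; apply: subspaceZ.
by exists (\row__ a); rewrite fE mxE.
Qed.

Lemma has_dim_sum V (W A B : V -> Prop) m m' :
  has_dim A m -> has_dim B m' ->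
  (forall v, W v <-> exists a b, [/\ A a, B b & v = a + b]) ->
  (forall v, A v -> B v -> v = 0) ->
  has_dim W (m + m').
Proof.
move=> hA hB WE AB0.
have sA := has_dim_subspace hA; have sB := has_dim_subspace hB.
case: hA hB => [f fi fA] [g gi gB].
have [h hE] : exists h : {linear 'rV[C]_(m + m') -> V},
    h =1 (fun x => f (lsubmx x) + g (rsubmx x)).
  apply: linear_bundle => a u v; rewrite !linearP /= scalerDr -!addrA.
  by congr (_ + _); rewrite addrCA.
exists h => [x y|v].
  rewrite !hE => e.
  have e' : f (lsubmx x - lsubmx y) = g (rsubmx y - rsubmx x).
    by rewrite !linearB /=; apply/eqP; rewrite subr_eq addrAC eq_sym subr_eq e addrC.
  have e0 : f (lsubmx x - lsubmx y) = 0.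
    apply: AB0; first by apply/fA; eexists.
    by rewrite e'; apply/gB; eexists.
  have /eqP : lsubmx x - lsubmx y = 0 by apply: fi; rewrite e0 linear0.
  have /eqP : rsubmx y - rsubmx x = 0 by apply: gi; rewrite -e' e0 linear0.
  rewrite !subr_eq0 => /eqP er /eqP el.
  by rewrite -[x]hsubmxK -[y]hsubmxK er el.
rewrite WE; split=> [[a [b [/fA[x ->] /gB[y ->] ->]]]|[x ->]].
  by exists (row_mx x y); rewrite hE row_mxKl row_mxKr.
exists (f (lsubmx x)), (g (rsubmx x)); split; last by rewrite hE.
  by apply/fA; eexists.
by apply/gB; eexists.
Qed.

Lemma has_dim_direct_sum V (W : V -> Prop) r (Ws : 'I_r -> V -> Prop)
    (d : 'I_r -> nat) :
  direct_sum W Ws -> (forall k, has_dim (Ws k) (d k)) ->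
  has_dim W (\sum_k d k).
Proof.
elim: r => [|r IH] in W Ws d *; move=> [WE W0] hd.
  rewrite big_ord0; apply/has_dim0 => v; rewrite WE.
  split=> [[w _ ->]|->]; first by rewrite big_ord0.
  by exists (fun=> 0); [case | rewrite big_ord0].
have sW k := has_dim_subspace (hd k).
pose Ws' k := Ws (lift ord0 k).
pose W' v := exists2 w : 'I_r -> V, forall k, Ws' k (w k) & v = \sum_k w k.
pose ext a (w : 'I_r -> V) k := oapp w a (unlift ord0 k).
have extW a w : Ws ord0 a -> (forall k, Ws' k (w k)) -> forall k, Ws k (ext a w k).
  by move=> Wa Ww k; rewrite /ext; case: unliftP => [l ->|->] //=; apply: Ww.
have extS a w : \sum_k ext a w k = a + \sum_k w k.
  rewrite big_ord_recl /ext unlift_none; congr (_ + _).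
  by apply: eq_bigr => k _; rewrite liftK.
have dsW' : direct_sum W' Ws'.
  split=> // w Ww w0 k.
  have := W0 (ext 0 w) (extW _ _ (proj1 (sW ord0)) Ww).
  by rewrite extS add0r => /(_ w0 (lift ord0 k)); rewrite /ext liftK.
rewrite big_ord_recl.
apply: has_dim_sum (hd ord0) (IH _ _ (fun k => d (lift ord0 k)) dsW' _) _ _ => //.
- by move=> k; apply: hd.
- move=> v; rewrite WE; split=> [[w Ww ->]|[a [b [Wa [w Ww ->] ->]]]].
    exists (w ord0), (\sum_(k < r) w (lift ord0 k)).
    rewrite big_ord_recl; split=> //.
    by exists (fun k => w (lift ord0 k)) => // k; apply: Ww.
  by exists (ext a w); [apply: extW | rewrite extS].
- move=> v Wv [w Ww vE].
  have := W0 (ext (- v) w); rewrite extS -vE addNr => /(_ _ erefl ord0).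
  rewrite /ext unlift_none /= => h; apply/eqP; rewrite -oppr_eq0; apply/eqP/h.
  by apply: extW => //; rewrite -scaleN1r; apply: subspaceZ.
Qed.

End Dimension.

(** * Hermitian forms and complete reducibility *)

Arguments linrep_act : simpl never.

Section Hermitian.
Variables (C : numClosedFieldType) (V : lmodType C).

Record hermitian (H : V -> V -> C) : Prop := Hermitian {
  herm_linear : forall a u v w, H (a *: u + v) w = a * H u w + H v w;
  herm_sym : forall u v, H v u = (H u v)^*;
  herm_ge0 : forall u, 0 <= H u u;
  herm_eq0 : forall u, H u u = 0 -> u = 0
}.

Section Form.
Variables (H : V -> V -> C) (hH : hermitian H).

Lemma herm0l w : H 0 w = 0.
Proof.
have := herm_linear hH (-1) 0 0 w.
by rewrite scaler0 addr0 mulN1r addNr.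
Qed.

Lemma hermDl u v w : H (u + v) w = H u w + H v w.
Proof. by rewrite -[u in LHS]scale1r (herm_linear hH) mul1r. Qed.

Lemma hermZl a u w : H (a *: u) w = a * H u w.
Proof. by rewrite -[_ *: _]addr0 (herm_linear hH) herm0l addr0. Qed.

Lemma hermBl u v w : H (u - v) w = H u w - H v w.
Proof. by rewrite hermDl -scaleN1r hermZl mulN1r. Qed.

Lemma herm_suml (I : Type) (r : seq I) (P : pred I) (u : I -> V) w :
  H (\sum_(k <- r | P k) u k) w = \sum_(k <- r | P k) H (u k) w.
Proof.
exact: (big_morph (fun v => H v w) (fun u v => hermDl u v w) (herm0l w)).
Qed.

Lemma herm_orthC u v : H u v = 0 -> H v u = 0.
Proof. by move=> h; rewrite (herm_sym hH) h conjC0. Qed.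

Lemma hermDr u v w : H w (u + v) = H w u + H w v.
Proof.
by rewrite (herm_sym hH) hermDl rmorphD /= -!(herm_sym hH).
Qed.

Lemma hermZr a u w : H w (a *: u) = a^* * H w u.
Proof. by rewrite (herm_sym hH) hermZl rmorphM /= -(herm_sym hH). Qed.

Lemma herm_sumr (I : Type) (r : seq I) (P : pred I) (u : I -> V) w :
  H w (\sum_(k <- r | P k) u k) = \sum_(k <- r | P k) H w (u k).
Proof.
apply: (big_morph (H w)) => [x y|]; first exact: hermDr.
exact/herm_orthC/herm0l.
Qed.

(** The Gram matrix of a basis of W is invertible, because a row vector that it kills represents a
    vector orthogonal to itself. Its inverse gives the coordinates of the projection. *)
Lemma orth_proj (W : V -> Prop) m v :
  has_dim W m -> exists2 w, W w & forall u, W u -> H (v - w) u = 0.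
Proof.
move=> [f fi fW]; pose e k : V := f (delta_mx 0 k).
have fE x : f x = \sum_k x 0 k *: e k.
  by rewrite {1}[x]row_sum_delta linear_sum; apply: eq_bigr => k _; rewrite linearZ.
pose G := \matrix_(k, l) H (e k) (e l).
have GE x l : (x *m G) 0 l = H (f x) (e l).
  by rewrite fE herm_suml mxE; apply: eq_bigr => k _; rewrite mxE hermZl.
have Gu : G \in unitmx.
  rewrite -row_free_unit -kermx_eq0; apply/eqP/row_matrixP => k; rewrite row0.
  set x := row k _; have xG : x *m G = 0 by rewrite -row_mul mulmx_ker row0.
  apply: fi; rewrite linear0; apply: (herm_eq0 hH).
  rewrite [X in H _ X]fE herm_sumr big1 // => l _.
  by rewrite hermZr -GE xG [X in _ * X]mxE mulr0.
pose b := \row_l H v (e l).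
exists (f (b *m invmx G)); first by apply/fW; eexists.
move=> _ /fW[x ->]; rewrite (fE x) herm_sumr big1 // => l _.
by rewrite hermZr hermBl -GE mulmxKV // mxE subrr mulr0.
Qed.

End Form.
End Hermitian.

Section Maschke.
Variables (gT : finGroupType) (C : numClosedFieldType) (V : lmodType C).
Variables (rho : linrep gT V) (H : V -> V -> C).
Hypotheses (hH : hermitian H)
  (Hinv : forall g u v, H (rho g u) (rho g v) = H u v).

Lemma rhoK g v : rho g (rho g^-1%g v) = v.
Proof. by rewrite -linrepM mulVg linrep1. Qed.

Lemma herm_adj g u v : H (rho g u) v = H u (rho g^-1%g v).
Proof. by rewrite -[v in LHS](rhoK g) Hinv. Qed.

Lemma submodule_subspace W : submodule rho W -> subspace W.
Proof. by case. Qed.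

Lemma direct_sum_cat (W A B : V -> Prop) r1 r2
    (As : 'I_r1 -> V -> Prop) (Bs : 'I_r2 -> V -> Prop) :
  (forall v, W v <-> exists a b, [/\ A a, B b & v = a + b]) ->
  (forall a b, A a -> B b -> a + b = 0 -> a = 0) ->
  direct_sum A As -> direct_sum B Bs ->
  direct_sum W (fun k : 'I_(r1 + r2) =>
    match split k with inl l => As l | inr l => Bs l end).
Proof.
move=> WE AB0 [AE A0] [BE B0]; split=> [v|w Ww w0].
  rewrite WE; split=> [[a [b [/AE[wa Awa ->] /BE[wb Bwb ->] ->]]]|[w Ww ->]].
    exists (fun k => match split k with inl l => wa l | inr l => wb l end).
      by move=> k; case: splitP.
    rewrite big_split_ord /=; congr (_ + _); apply: eq_bigr => l _.
      by rewrite (unsplitK (inl l)).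
    by rewrite (unsplitK (inr l)).
  exists (\sum_l w (lshift r2 l)), (\sum_l w (rshift r1 l)); split.
  - apply/AE; exists (fun l => w (lshift r2 l)) => // l.
    by have := Ww (lshift r2 l); rewrite (unsplitK (inl l)).
  - apply/BE; exists (fun l => w (rshift r1 l)) => // l.
    by have := Ww (rshift r1 l); rewrite (unsplitK (inr l)).
  - by rewrite big_split_ord.
have hA l : As l (w (lshift r2 l)).
  by have := Ww (lshift r2 l); rewrite (unsplitK (inl l)).
have hB l : Bs l (w (rshift r1 l)).
  by have := Ww (rshift r1 l); rewrite (unsplitK (inr l)).
rewrite big_split_ord /= in w0.
have a0 : \sum_l w (lshift r2 l) = 0.
  by apply: AB0 w0; [apply/AE; exists (fun l => w (lshift r2 l))
                    | apply/BE; exists (fun l => w (rshift r1 l))].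
rewrite a0 add0r in w0 => k; case: (split_ordP k) => l ->.
  exact: (A0 (fun l => w (lshift r2 l))).
exact: (B0 (fun l => w (rshift r1 l))).
Qed.

(** Strong induction on the dimension: a reducible W splits as a proper submodule and its orthogonal
    complement in W, which is stable because the form is invariant, and both have smaller
    dimension. *)
Lemma maschke (W : V -> Prop) m :
  has_dim W m -> submodule rho W ->
  exists r (Ws : 'I_r -> V -> Prop),
    (forall k, irreducible_submodule rho (Ws k)) /\ direct_sum W Ws.
Proof.
elim/ltn_ind: m W => m IH W hW sW.
have [Wz|Wnz] := pselect (forall v, W v -> v = 0).
  exists 0%N, (fun=> W); split; first by case.
  split=> [v|w _ _ []//]; split=> [/Wz ->|[w _ ->]]; rewrite ?big_ord0.
    by exists (fun=> 0); [case | rewrite big_ord0].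
  by case: sW.
have [Wirr|Wred] := pselect (irreducible_submodule rho W).
  exists 1%N, (fun=> W); split=> //; split=> [v|w _].
    split=> [Wv|[w Ww ->]]; last by rewrite big_ord1.
    by exists (fun=> v); rewrite ?big_ord1.
  by rewrite big_ord1 => w0 k; rewrite ord1.
have [U [sU UW Unz nWU]] : exists U : V -> Prop,
    [/\ submodule rho U, forall u, U u -> W u, ~ (forall u, U u -> u = 0)
      & ~ (forall u, W u -> U u)].
  apply: contrapT => nU; apply: Wred; split=> //.
    apply: contrapT => nz; apply: Wnz => v Wv.
    by apply: contrapT => /eqP v0; apply: nz; exists v.
  move=> U sU UW; apply: contrapT => /not_orP[h1 h2].
  by apply: nU; exists U.
have [d hU] := has_dim_sub hW (submodule_subspace sU) UW.
pose U' v := W v /\ forall u, U u -> H v u = 0.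
have sU' : submodule rho U'.
  case: sW => W0 WD Wg; case: sU => _ _ Ug.
  split=> [|a u v [Wu u0] [Wv v0]|g u [Wu u0]].
  - by split=> // u _; apply: herm0l.
  - split; first exact: WD.
    by move=> x Ux; rewrite (herm_linear hH) u0 // v0 // mulr0 addr0.
  - split; first exact: Wg.
    by move=> x Ux; rewrite herm_adj u0 //; apply: Ug.
have [d' hU'] := has_dim_sub hW (submodule_subspace sU') (fun v => @proj1 _ _).
have UU'0 v : U v -> U' v -> v = 0.
  by move=> Uv [_ /(_ _ Uv)]; apply: (herm_eq0 hH).
have sumUU' v : W v <-> exists a b, [/\ U a, U' b & v = a + b].
  split=> [Wv|[a [b [Ua [Wb _] ->]]]].
    have [u Uu vu] := orth_proj hH v hU.
    exists u, (v - u); split=> //; last by rewrite addrC subrK.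
    split=> //; apply: subspaceB => //; first exact: submodule_subspace sW.
    exact: UW.
  by apply: subspaceD (submodule_subspace sW) _ _ => //; apply: UW.
have dE : m = (d + d')%N.
  by apply: has_dim_uniq hW _; apply: has_dim_sum hU hU' sumUU' UU'0.
have d0 : (0 < d)%N.
  case: d hU {dE} => // /has_dim0 U0; case: Unz => u; exact: (proj1 (U0 u)).
have d'0 : (0 < d')%N.
  case: d' hU' {dE} => // /has_dim0 U0; case: nWU => v /sumUU'[a [b [Ua]]].
  by move=> /U0 -> ->; rewrite addr0.
have [|r1 [As [irrA sumA]]] := IH d _ U hU sU.
  by rewrite dE -{1}[d]addn0 ltn_add2l.
have [|r2 [Bs [irrB sumB]]] := IH d' _ U' hU' sU'.
  by rewrite dE -{1}[d']add0n ltn_add2r.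
exists (r1 + r2)%N, (fun k : 'I_(r1 + r2) =>
  match split k with inl l => As l | inr l => Bs l end).
split; last first.
  apply: direct_sum_cat sumUU' _ sumA sumB => a b Ua U'b /eqP.
  rewrite addr_eq0 => /eqP ab; apply: UU'0 => //; rewrite ab -scaleN1r.
  by apply: subspaceZ => //; apply: submodule_subspace sU'.
by move=> k; case: (split k).
Qed.

End Maschke.

(** * Primitive vectors *)

Section Restriction.
Variables (T : finType) (S : {set T}) (g : {perm T}).
Hypothesis gS : forall e, e \in S -> g e \in S.

Lemma perm_stable e : (g e \in S) = (e \in S).
Proof.
have gE : g @: S = S.
  apply/eqP; rewrite eqEcard card_imset ?leqnn ?andbT; last exact: perm_inj.
  by apply/subsetP => _ /imsetP[x xS ->]; apply: gS.
by rewrite -{1}gE (mem_imset _ _ perm_inj).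
Qed.

Lemma perm_restrict : exists2 h, perm_on S h & {in S, h =1 g}.
Proof.
exists (restr_perm S g); first exact: restr_perm_on.
move=> e eS; apply: restr_permE => //; apply/astabsP => x /=.
exact: perm_stable.
Qed.

End Restriction.

Section Primitive.
Variables (n : nat) (C : numClosedFieldType) (V : lmodType C).
Variables (rho : linrep 'S_n V).
Implicit Types (B : {set 'I_n}) (g h s : 'S_n) (v z : V).

Definition fixed_by B v := forall s, perm_on B s -> rho s v = v.

(* The sum over representatives of the cosets of the pointwise stabilizer of k
   in Sym (k |: B). *)
Definition coset_sum B k v := \sum_(y in k |: B) rho (tperm k y) v.

Definition primitive B v :=
  fixed_by B v /\ forall k, k \notin B -> coset_sum B k v = 0.

Lemma rho0 g : rho g 0 = 0.
Proof. by have := linrepP rho g (-1) 0 0; rewrite scaler0 addr0 scaleN1r addNr. Qed.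

Lemma rhoD g u v : rho g (u + v) = rho g u + rho g v.
Proof. by rewrite -[u in LHS]scale1r linrepP scale1r. Qed.

Lemma rhoZ g a v : rho g (a *: v) = a *: rho g v.
Proof. by rewrite -[_ *: _]addr0 linrepP rho0 addr0. Qed.

Lemma rho_sum g (I : Type) (r : seq I) (P : pred I) (u : I -> V) :
  rho g (\sum_(k <- r | P k) u k) = \sum_(k <- r | P k) rho g (u k).
Proof. exact: (big_morph (rho g) (rhoD g) (rho0 g)). Qed.

Lemma fixed_by_subset (B B' : {set 'I_n}) v :
  B \subset B' -> fixed_by B' v -> fixed_by B v.
Proof. by move=> sBB' fv s sB; apply: fv; apply: subset_trans sBB'. Qed.

Lemma fixed_by_subspace B : subspace (fixed_by B).
Proof.
split=> [s _|a u v fu fv s sB]; first exact: rho0.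
by rewrite linrepP fu ?fv.
Qed.

Lemma coset_sumP B k a u v :
  coset_sum B k (a *: u + v) = a *: coset_sum B k u + coset_sum B k v.
Proof.
rewrite /coset_sum scaler_sumr -big_split; apply: eq_bigr => y _.
by rewrite linrepP.
Qed.

Lemma primitive_subspace B : subspace (primitive B).
Proof.
have sf := fixed_by_subspace B.
split=> [|a u v [fu pu] [fv pv]].
  by split=> [|k _]; [case: sf | rewrite /coset_sum big1 // => y _; rewrite rho0].
split=> [|k kB]; first by case: sf => _; apply.
by rewrite coset_sumP pu // pv // scaler0 addr0.
Qed.

Lemma coset_sum_fixed B k v :
  fixed_by B v -> fixed_by (k |: B) (coset_sum B k v).
Proof.
move=> fv s sB; rewrite rho_sum.
rewrite [RHS](reindex_inj (@perm_inj _ s)) /=.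
rewrite [RHS](eq_bigl (fun y => y \in k |: B)) => [|y]; last first.
  by rewrite perm_closed.
apply: eq_bigr => y yB; rewrite -linrepM.
(* The product of the first three factors fixes k, so it lies in Sym B and is absorbed by v; the
   last factor is the coset representative attached to [s y]. *)
have -> : (tperm k y * s)%g = (tperm k y * s * tperm k (s y) * tperm k (s y))%g.
  by rewrite -mulgA tperm2 mulg1.
rewrite [LHS]linrepM fv //; apply/subsetP => e; rewrite inE => ne.
have tB x : x \in k |: B -> perm_on (k |: B) (tperm k x).
  move=> xB; apply: subset_trans (tperm_on k x) _.
  by rewrite subUset !sub1set xB setU11.
have /subsetP/(_ e) : perm_on (k |: B) (tperm k y * s * tperm k (s y))%g.
  apply: perm_onM; last by apply: tB; rewrite (perm_closed _ sB).
  by apply: perm_onM => //; apply: tB.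
rewrite !inE => /(_ ne) /orP[/eqP ek|//]; move: ne.
by rewrite ek !permM tpermL tpermR eqxx.
Qed.

(** * Positivity of signed column pairings on primitive vectors *)

Section Formula.
Variables (H : V -> V -> C) (hH : hermitian H)
  (Hinv : forall g u v, H (rho g u) (rho g v) = H u v).

Lemma herm_fixedl B s u z : perm_on B s -> fixed_by B z -> H (rho s u) z = H u z.
Proof. by move=> sB fz; rewrite (herm_adj Hinv) fz // perm_onV. Qed.

Definition escape B g : {set 'I_n} := [set e | (e \notin B) && (g e \in B)].

(** These are all the ways to reroute the escaping entries outside B, keeping g on the other entries
    outside B and fixing B pointwise. Modulo the relations of a primitive vector, g is replaced by a
    signed combination of them. *)
Definition completions B g : {set 'S_n} :=
  [set h | perm_on (~: B) h & [forall (e | e \notin B :|: escape B g), h e == g e]].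

(** The preimage of B under g has as many elements as B. In particular B has at least as many
    elements as there are escapes, which keeps the falling factorial of [primitive_formula]
    positive. *)
Lemma escape_count B g :
  #|B| = (#|[set y in B | g y \in B]| + #|escape B g|)%N.
Proof.
have <- : #|g @^-1: B| = #|B| by
  rewrite on_card_preimset //; apply/onW_bij/injF_bij/perm_inj.
rewrite -cardsUI (_ : _ :&: _ = set0) ?cards0 ?addn0; last first.
  by apply/setP => y; rewrite !inE; case: (y \in B); rewrite ?andbF.
by apply: eq_card => y; rewrite !inE; case: (y \in B); rewrite ?orbF.
Qed.

(** Without escapes g preserves the complement of B, hence is a permutation of the complement
    followed by one of B. This is the base case of the inductions on the number of escapes. *)
Lemma completions0 B g : escape B g = set0 ->
  exists2 h, completions B g = [set h] & perm_on B (h^-1 * g)%g.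
Proof.
move=> E0.
have gC e : e \in ~: B -> g e \in ~: B.
  rewrite !inE => eB; apply/negP => geB.
  by have := in_set0 e; rewrite -E0 inE eB geB.
have [h hB hg] := perm_restrict gC.
exists h; last first.
  apply/subsetP => e; rewrite inE; apply: contraR => eB.
  rewrite permM -(hg (h^-1%g e)) ?permKV //.
  by rewrite perm_closed ?perm_onV // inE.
apply/setP => k; rewrite !inE E0 setU0; apply/andP/eqP => [[kB /forall_inP kg]|->].
  apply/permP => e; have [eB|eB] := boolP (e \in B).
    by rewrite !(out_perm (S := ~: B)) // inE eB.
  by rewrite (eqP (kg _ eB)) hg // inE.
by split=> //; apply/forall_inP => e eB; rewrite hg // inE.
Qed.

Lemma escape_tperm B g f y : f \in escape B g -> y \in B -> g y \notin B ->
  escape B (tperm f y * g)%g = escape B g :\ f.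
Proof.
rewrite inE => /andP[fB gfB] yB gyB; apply/setP => e; rewrite !inE permM.
have [->|ef] := eqVneq e f; first by rewrite tpermL (negPf gyB) andbF.
case: (boolP (e \in B)) => //= eB; rewrite tpermD //; first by rewrite eq_sym.
by apply: contraNneq eB => <-.
Qed.

Lemma completions_tperm B g f y : f \in escape B g -> y \in B -> g y \notin B ->
  completions B (tperm f y * g)%g =
  [set h in completions B g | (g^-1)%g (h f) == y].
Proof.
move=> fE yB gyB; have := fE; rewrite inE => /andP[fB gfB].
apply/setP => h; rewrite !inE escape_tperm // -andbA; congr (_ && _).
have fy : f != y by apply: contraNneq fB => ->.
apply/forall_inP/andP => [hE|[/forall_inP hE /eqP hf] e].
  split; last first.
    have := hE f; rewrite in_setU in_setD1 eqxx (negPf fB) permM tpermL.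
    by move=> /(_ isT)/eqP ->; rewrite permK.
  apply/forall_inP => e; rewrite in_setU negb_or => /andP[eB eE].
  have ef : e != f by apply: contraNneq eE => ->.
  have := hE e; rewrite in_setU in_setD1 (negPf eB) (negPf eE) andbF permM.
  rewrite tpermD; [by apply|by rewrite eq_sym|by apply: contraNneq eB => <-].
rewrite in_setU in_setD1 negb_or negb_and negbK => /andP[eB].
have [-> _|ef /= eE] := eqVneq e f.
  by rewrite permM tpermL -hf permKV.
rewrite permM tpermD; [|by rewrite eq_sym|by apply: contraNneq eB => <-].
by apply: hE; rewrite in_setU negb_or eB.
Qed.

(** Induction on the number of escapes. For an escaping f, apply g to the relation
    [coset_sum B f v = 0] and pair with z. The terms where g keeps y in B all equal the pairing for
    g, since the transposition can be moved past g into Sym B and absorbed by z; in the other terms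
    the transposition removes f from the escapes. *)
Lemma primitive_formula B v z g : primitive B v -> fixed_by B z ->
  (#|B| ^_ #|escape B g|)%:R * H (rho g v) z =
  (-1) ^+ #|escape B g| * \sum_(h in completions B g) H (rho h v) z.
Proof.
move=> [fv pv] fz; move: {2}#|_| (erefl #|escape B g|) => s.
elim: s g => [|s IH] g sE.
  have [h -> hg] := completions0 (cards0_eq sE).
  rewrite sE ffactn0 expr0 !mul1r big_set1.
  by rewrite -(mulKVg h g) linrepM (herm_fixedl _ hg).
have [f fE] : exists f, f \in escape B g by apply/card_gt0P; rewrite sE.
have := fE; rewrite inE => /andP[fB gfB].
have := pv f fB => /(congr1 (fun u => H (rho g u) z)).
rewrite rho0 (herm0l hH) rho_sum (herm_suml hH).
rewrite (bigID (fun y => g y \in B)) /=.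
rewrite (eq_bigr (fun=> H (rho g v) z)) => [|y /andP[yB gyB]]; last first.
  rewrite -linrepM.
  have -> : (tperm f y * g = g * tperm (g f) (g y))%g.
    by rewrite -tpermJ conjgE mulgA mulgV mul1g.
  rewrite linrepM (@herm_fixedl B) //.
  apply: subset_trans (tperm_on _ _) _.
  by rewrite subUset !sub1set gfB gyB.
rewrite sumr_const.
have sB : (s < #|B|)%N by rewrite (escape_count B g) sE addnS ltnS leq_addl.
(* There are s + 1 escapes, so g keeps |B| - s - 1 entries of B in B, and f itself adds one. The
   result is the last factor of the falling factorial. *)
have -> : #|[pred y | y \in f |: B & g y \in B]| = (#|B| - s)%N.
  have -> : #|[pred y | y \in f |: B & g y \in B]| =
            #|f |: [set y in B | g y \in B]|.
    apply: eq_card => y; rewrite !inE; have [->|//] := eqVneq y f.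
    by rewrite gfB.
  by rewrite cardsU1 inE (negPf fB) (escape_count B g) sE addnS -addSn addnK.
move=> /eqP; rewrite addr_eq0 => /eqP hsum.
rewrite sE ffactnSr natrM -mulrA (mulr_natl (H _ _)) hsum mulrN mulr_sumr.
rewrite exprS mulN1r mulNr; congr (- _).
(* A completion h of g is classified by the entry y of B with [g y = h f]: it is then a completion
   of [tperm f y * g], which sends f to the same place as h. *)
rewrite [in RHS](partition_big (fun h => (g^-1)%g (h f))
   (fun y => (y \in f |: B) && (g y \notin B))) /=.
  rewrite mulr_sumr; apply: eq_bigr => y /andP[yfB gyB].
  have yB : y \in B.
    by move: yfB; rewrite in_setU1 => /orP[/eqP yf|//]; rewrite yf gfB in gyB.
  have cE : #|escape B (tperm f y * g)%g| = s.
    by have := cardsD1 f (escape B g); rewrite fE sE escape_tperm // => -[].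
  rewrite -linrepM -{1}cE IH // cE completions_tperm //; congr (_ * _).
  by apply: eq_bigl => h; rewrite inE.
move=> h; rewrite inE => /andP[hB /forall_inP hE].
have hfB : h f \notin B by have := perm_closed f hB; rewrite !inE fB.
rewrite permKV hfB andbT in_setU1; apply/orP; right.
apply: contraT => gB; case/negP: (hfB).
have : h (g^-1 (h f))%g == g (g^-1 (h f))%g.
  by apply: hE; rewrite !inE (negPf gB) /= permKV.
by rewrite permKV => /eqP/perm_inj e; rewrite -{1}(permKV g (h f)) e.
Qed.

(** Multiplied by the order of Sym E, the sum is the squared norm of the symmetrization of v. *)
Lemma herm_sym_ge0 (E : {set 'I_n}) v :
  0 <= \sum_(k : 'S_n | perm_on E k) H (rho k v) v.
Proof.
pose w := \sum_(k : 'S_n | perm_on E k) rho k v.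
have wE : H w w =
    (\sum_(k : 'S_n | perm_on E k) H (rho k v) v) *+ #|perm_on E|.
  rewrite {2}/w (herm_sumr hH) -sumr_const; apply: eq_bigr => l lE.
  rewrite /w (herm_suml hH) (reindex_inj (mulIg l)) /=.
  apply: eq_big => [k|k _]; last by rewrite linrepM Hinv.
  apply/idP/idP => [h|h]; last exact: perm_onM.
  by rewrite -(mulgK l k); apply: perm_onM => //; apply: perm_onV.
have := herm_ge0 hH w; rewrite wE -mulr_natl pmulr_rge0 // ltr0n.
by apply/card_gt0P; exists 1%g; apply: perm_on1.
Qed.

Variables (B : {set 'I_n}) (col : 'I_n -> nat).
Hypothesis col_inj : {in B &, injective col}.

Definition col_stab : {set 'S_n} := [set s : 'S_n | [forall e, col (s e) == col e]].

Lemma col_stabP s : reflect (forall e, col (s e) = col e) (s \in col_stab).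
Proof. by rewrite inE; apply: (iffP forallP) => h e; apply/eqP. Qed.

(** A column meets B at most once, so if f escapes to [g f] then [g (g f)] lies outside B; composing
    with the transposition of f and [g f] stays in the column group, removes one escape and flips
    the sign. Once nothing escapes, g fixes B pointwise and is its own completion. *)
Lemma straighten g : g \in col_stab ->
  exists c : 'S_n, [/\ c \in col_stab, c \in completions B g
    & (-1) ^+ c = (-1) ^+ g * (-1) ^+ #|escape B g| :> C].
Proof.
move: {2}#|_| (erefl #|escape B g|) => s.
elim: s g => [|s IH] g sE gC; have /col_stabP gcol := gC.
  exists g; split=> //; last by rewrite sE mulr1.
  have [h hE hg] := completions0 (cards0_eq sE).
  suff gh : (h^-1 * g)%g = 1%g.
    by rewrite hE inE -(mulKVg h g) gh mulg1.
  have /setP/(_ h) := hE; rewrite !inE eqxx => /andP[hB _].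
  have gB e : e \in B -> (h^-1 * g)%g e = g e.
    by move=> eB; rewrite permM (out_perm (perm_onV hB)) // inE eB.
  apply/permP => e; rewrite perm1; have [eB|eB] := boolP (e \in B); last first.
    exact: out_perm hg eB.
  have geB := perm_closed e hg; rewrite gB // eB in geB.
  by rewrite gB //; apply: col_inj.
have [f fE] : exists f, f \in escape B g by apply/card_gt0P; rewrite sE.
have := fE; rewrite inE => /andP[fB gfB].
have gx : g (g f) \notin B.
  apply/negP => ggB; case/negP: fB.
  by rewrite -(perm_inj (col_inj ggB gfB (gcol (g f)))).
have cE : #|escape B (tperm f (g f) * g)%g| = s.
  by have := cardsD1 f (escape B g); rewrite fE sE escape_tperm // => -[].
have [|c [cC cg cs]] := IH _ cE.
  apply/col_stabP => e; rewrite permM.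
  by case: tpermP => [->|->|]; rewrite ?gcol.
exists c; split=> //; first by move: cg; rewrite completions_tperm // inE => /andP[].
rewrite cs cE sE odd_permM odd_tperm.
have -> : f != g f by apply: contraNneq fB => ->.
by rewrite exprS mulN1r mulrN -mulNr addTb signrN.
Qed.

Hypothesis (v : V).
Hypothesis (pv : primitive B v)
  (sv : forall c : 'S_n, c \in col_stab -> perm_on (~: B) c ->
     rho c v = (-1) ^+ c *: v).

(** With c as in [straighten], the completions of g are the products of c with the permutations of
    E, the image under c of the escaping entries. The sign with which c acts on v cancels the sign
    of g and that of [primitive_formula], which leaves the sum of [herm_sym_ge0]. *)
Lemma primitive_col_ge0 g : g \in col_stab -> 0 <= (-1) ^+ g * H (rho g v) v.
Proof.
move=> gC; have [c [cC cg cs]] := straighten gC.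
have fv := proj1 pv.
have p0 : 0 < (#|B| ^_ #|escape B g|)%:R :> C.
  by rewrite ltr0n ffact_gt0 (escape_count B g) leq_addl.
rewrite -(pmulr_rge0 _ p0) mulrCA (primitive_formula g pv fv) mulrA -cs.
have := cg; rewrite inE => /andP[cB /forall_inP cgE].
pose E := [set e | (e \notin B) && ((c^-1)%g e \in escape B g)].
rewrite mulr_sumr (reindex_inj (mulgI c)) /=.
rewrite (eq_bigl (fun k => perm_on E k)) => [|k].
  rewrite (eq_bigr (fun k => H (rho k v) v)) => [|k _]; first exact: herm_sym_ge0.
  by rewrite linrepM sv // rhoZ (hermZl hH) mulrA -signr_addb addbb mul1r.
rewrite inE; apply/andP/idP => [[ckB /forall_inP ckg]|kE].
  apply/subsetP => e; rewrite inE => ke; rewrite inE.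
  have kB : perm_on (~: B) k by rewrite -(mulKg c k) perm_onM // perm_onV.
  have -> /= : e \notin B.
    by apply: contra ke => eB; rewrite (out_perm kB) // inE eB.
  apply: contraR ke => ne.
  have [eB|eB] := boolP (e \in B); first by rewrite (out_perm kB) // inE eB.
  have ceB : (c^-1)%g e \notin B.
    by have := perm_closed e (perm_onV cB); rewrite !inE eB => ->.
  have ce : (c^-1)%g e \notin B :|: escape B g by rewrite in_setU negb_or ceB.
  have := ckg _ ce; rewrite permM permKV => /eqP ->.
  by rewrite -(eqP (cgE _ ce)) permKV.
have EB : E \subset ~: B by apply/subsetP => e; rewrite !inE => /andP[].
split; first by apply: perm_onM => //; apply: subset_trans EB.
apply/forall_inP => e eBF; rewrite permM -(eqP (cgE _ eBF)).
rewrite (out_perm kE) // !inE permK.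
by move: eBF; rewrite !inE negb_or => /andP[_ /negPf ->]; rewrite andbF.
Qed.

(* If the column antisymmetrizer kills v then so does pairing with v, which by
   [primitive_col_ge0] is a sum of nonnegative terms, among them <v, v>. *)
Lemma primitive_col_inj :
  \sum_(g in col_stab) (-1) ^+ g *: rho g v = 0 -> v = 0.
Proof.
move=> /(congr1 (fun u => H u v)); rewrite (herm0l hH) (herm_suml hH) => h.
have C1 : 1%g \in col_stab by apply/col_stabP => e; rewrite perm1.
apply: (herm_eq0 hH); move/eqP: h; rewrite psumr_eq0 => [/allP h|g gC].
  have := h 1%g (mem_index_enum _); rewrite C1 linrep1 odd_perm1 expr0 scale1r.
  by move=> /eqP.
by rewrite (hermZl hH) primitive_col_ge0.
Qed.

End Formula.
End Primitive.

(** * Young symmetrizers and multiplicities *)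

Section Isomorphisms.
Variables (gT : finGroupType) (C : fieldType).
Variables (V V' : lmodType C) (rho : linrep gT V) (rho' : linrep gT V').

Lemma isomorphic_sym (W : V -> Prop) (W' : V' -> Prop) :
  submodule rho W -> isomorphic rho W rho' W' -> isomorphic rho' W' rho W.
Proof.
move=> [W0 WD Wg] [f [fl fg fW fi fs]].
have /choice[h hE] (v : V') : exists u, W' v -> W u /\ f u = v.
  by have [/fs[u Wu <-]|nv] := pselect (W' v); [exists u | exists 0].
have hW v : W' v -> W (h v) by move=> /hE[].
have fh v : W' v -> f (h v) = v by move=> /hE[].
have W'f u : W u -> h (f u) = u.
  by move=> Wu; apply: fi => //; [apply/hW/fW | apply/fh/fW].
exists h; split=> [a u v W'u W'v|g u W'u||u v W'u W'v huv|v Wv].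
- by rewrite -{1}(fh u) // -{1}(fh v) // -fl ?W'f //; [apply: WD| |]; apply: hW.
- by rewrite -{1}(fh u) // -fg ?W'f //; [apply: Wg|]; apply: hW.
- exact: hW.
- by rewrite -(fh u) // huv fh.
- by exists (f v); [apply: fW | apply: W'f].
Qed.

Lemma schur (W : V -> Prop) (W' : V' -> Prop) (f : V -> V') u0 :
  irreducible_submodule rho W -> irreducible_submodule rho' W' ->
  linear_on W f -> (forall g u, W u -> f (rho g u) = rho' g (f u)) ->
  (forall u, W u -> W' (f u)) -> W u0 -> f u0 != 0 ->
  isomorphic rho W rho' W'.
Proof.
move=> [sW _ minW] [sW' _ minW'] fl fg fW Wu0 fu0.
have [W0 WD Wg] := sW; have sbW : subspace W by split.
exists f; split=> // [u v Wu Wv fuv|v W'v].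
  have [||K0|KW] := minW (fun u => W u /\ f u = 0).
  - split=> [|a x y [Wx fx] [Wy fy]|g x [Wx fx]].
    + by split=> //; apply: linear_on0 sbW fl.
    + by split; [apply: WD | rewrite fl // fx fy scaler0 addr0].
    + split; first exact: Wg.
      rewrite fg // fx; have := linrepP rho' g (-1) 0 0.
      by rewrite scaler0 addr0 scaleN1r addNr.
  - by move=> u' [].
  - apply/eqP; rewrite -subr_eq0; apply/eqP/K0; split; first exact: subspaceB.
    by rewrite (linear_onB fl) // fuv subrr.
  - by case/eqP: fu0; case: (KW _ Wu0).
have [|||] := minW' (fun v => exists2 u, W u & v = f u); last first.
- by move=> /(_ _ W'v) [u Wu ->]; exists u.
- by move=> I0; case/eqP: fu0; apply: I0; exists u0.
- by move=> _ [u Wu ->]; apply: fW.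
- split=> [|a x y [u Wu ->] [w Ww ->]|g x [u Wu ->]].
  + by exists 0 => //; rewrite (linear_on0 sbW fl).
  + by exists (a *: u + w); [apply: WD | rewrite fl].
  + by exists (rho g u); [apply: Wg | rewrite fg].
Qed.

End Isomorphisms.

Section YoungOperator.
Variables (n : nat) (C : numClosedFieldType).
Variables (B : {set 'I_n}) (row col : 'I_n -> nat).

(** Only entries outside B are moved, so that [young] commutes with Sym B and does not depend on the
    length of the first row. In contrast, [col_alt] runs over the whole column group, as the
    injectivity on primitive vectors requires. *)
Definition fix_stab (f : 'I_n -> nat) : {set 'S_n} :=
  [set s : 'S_n | perm_on (~: B) s & [forall e, f (s e) == f e]].

Lemma fix_stabP f s :
  reflect (perm_on (~: B) s /\ forall e, f (s e) = f e) (s \in fix_stab f).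
Proof.
rewrite inE; apply: (iffP andP) => -[sB sf]; split=> //.
  by move=> e; apply/eqP/(forallP sf).
by apply/forallP => e; rewrite sf.
Qed.

Lemma fix_stabM f s t : s \in fix_stab f -> t \in fix_stab f -> (s * t)%g \in fix_stab f.
Proof.
move=> /fix_stabP[sB sf] /fix_stabP[tB tf]; apply/fix_stabP; split.
  exact: perm_onM.
by move=> e; rewrite permM tf sf.
Qed.

Lemma fix_stabV f s : s \in fix_stab f -> (s^-1)%g \in fix_stab f.
Proof.
move=> /fix_stabP[sB sf]; apply/fix_stabP; split; first exact: perm_onV.
by move=> e; rewrite -[RHS](congr1 f (permKV s e)) sf.
Qed.

Lemma fix_stabMr f s t : t \in fix_stab f ->
  ((s * t)%g \in fix_stab f) = (s \in fix_stab f).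
Proof.
move=> tf; apply/idP/idP => [h|h]; last exact: fix_stabM.
by rewrite -(mulgK t s) fix_stabM // fix_stabV.
Qed.

Section Action.
Variables (V : lmodType C) (rho : linrep 'S_n V).

Definition row_sum v := \sum_(r in fix_stab row) rho r v.
Definition young v := \sum_(c in fix_stab col) (-1) ^+ c *: rho c (row_sum v).
Definition col_alt v := \sum_(c in col_stab col) (-1) ^+ c *: rho c v.

Lemma linear_row_sum a u v : row_sum (a *: u + v) = a *: row_sum u + row_sum v.
Proof.
rewrite /row_sum scaler_sumr -big_split; apply: eq_bigr => r _; exact: linrepP.
Qed.

Lemma linear_young a u v : young (a *: u + v) = a *: young u + young v.
Proof.
rewrite /young [in RHS]scaler_sumr -big_split; apply: eq_bigr => c _ /=.
by rewrite linear_row_sum linrepP scalerDr !scalerA mulrC.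
Qed.

Lemma linear_col_alt a u v : col_alt (a *: u + v) = a *: col_alt u + col_alt v.
Proof.
rewrite /col_alt scaler_sumr -big_split; apply: eq_bigr => c _ /=.
by rewrite linrepP scalerDr !scalerA mulrC.
Qed.

Lemma young_closed W v : submodule rho W -> W v -> W (young v).
Proof.
move=> sW Wv; have sb := submodule_subspace sW; case: sW => _ _ Wg.
apply: subspace_comb => // c _; apply: (Wg).
by apply: subspace_sum => // r _; apply: Wg.
Qed.

Lemma rho_row_sum s v : s \in fix_stab row -> rho s (row_sum v) = row_sum v.
Proof.
move=> sR; rewrite rho_sum [RHS](reindex_inj (mulIg s)) /=.
by apply: eq_big => [r|r _]; rewrite ?fix_stabMr // linrepM.
Qed.

Lemma young_sign c v : c \in fix_stab col -> rho c (young v) = (-1) ^+ c *: young v.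
Proof.
move=> cC; rewrite rho_sum scaler_sumr [RHS](reindex_inj (mulIg c)) /=.
apply: eq_big => [s|s _]; rewrite ?fix_stabMr // rhoZ linrepM scalerA.
by rewrite -signr_addb odd_permM addbC -addbA addbb addbF.
Qed.

Lemma col_alt_sign g v : g \in col_stab col -> rho g (col_alt v) = (-1) ^+ g *: col_alt v.
Proof.
move=> /col_stabP gC; rewrite rho_sum scaler_sumr [RHS](reindex_inj (mulIg g)) /=.
apply: eq_big => [s|s _]; last first.
  rewrite rhoZ linrepM scalerA.
  by rewrite -signr_addb odd_permM addbC -addbA addbb addbF.
apply/col_stabP/col_stabP => h e; first by rewrite permM gC.
by rewrite -[RHS]h permM gC.
Qed.

Lemma col_alt_signr g v : g \in col_stab col ->
  col_alt (rho g v) = (-1) ^+ g *: col_alt v.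
Proof.
move=> /col_stabP gC; rewrite /col_alt scaler_sumr [RHS](reindex_inj (mulgI g)) /=.
apply: eq_big => [s|s _]; last first.
  by rewrite linrepM scalerA -signr_addb odd_permM addbA addbb.
apply/col_stabP/col_stabP => h e; first by rewrite permM h gC.
by rewrite -(permKV g e) -permM h gC.
Qed.

(** The full antisymmetrizer absorbs each column permutation occurring in [young] with its own sign,
    so all of them contribute the same term. Nonvanishing under [young] can thus be tested on the
    row symmetrization. *)
Lemma col_alt_young v :
  col_alt (young v) = #|fix_stab col|%:R *: col_alt (row_sum v).
Proof.
have l0 : col_alt 0 = 0.
  by have := linear_col_alt (-1) 0 0; rewrite scaler0 addr0 scaleN1r addNr.
have lD u w : col_alt (u + w) = col_alt u + col_alt w.
  by rewrite -[u in LHS]scale1r linear_col_alt scale1r.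
have lZ a w : col_alt (a *: w) = a *: col_alt w.
  by rewrite -[_ *: _]addr0 linear_col_alt l0 addr0.
rewrite /young (big_morph col_alt lD l0) scaler_nat -sumr_const.
apply: eq_bigr => c /fix_stabP[_ cC].
rewrite lZ col_alt_signr; first by rewrite scalerA -signr_addb addbb scale1r.
by apply/col_stabP.
Qed.

Lemma fixed_by_act s v : perm_on (~: B) s -> fixed_by rho B v ->
  fixed_by rho B (rho s v).
Proof.
move=> sB fv b bB; have : commute s b.
  by apply: perm_onC sB bB _; rewrite disjoints_subset.
by rewrite -linrepM => ->; rewrite linrepM fv.
Qed.

Lemma fixed_by_young v : fixed_by rho B v -> fixed_by rho B (young v).
Proof.
move=> fv; apply: subspace_comb (fixed_by_subspace rho B) _ => c.
move=> /fix_stabP[cB _]; apply: fixed_by_act => //.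
apply: subspace_sum (fixed_by_subspace rho B) _ => r /fix_stabP[rB _].
exact: fixed_by_act.
Qed.

(** Conjugation by s, which fixes B pointwise, carries the transpositions at [s^-1 k] to those at
    k. *)
Lemma primitive_act s v : perm_on (~: B) s -> primitive rho B v ->
  primitive rho B (rho s v).
Proof.
move=> sB [fv pv]; split=> [|k kB]; first exact: fixed_by_act.
have skB : (s^-1)%g k \notin B.
  by have := perm_closed k (perm_onV sB); rewrite !inE kB => ->.
rewrite -(rho0 rho s) -(pv _ skB) rho_sum /coset_sum.
rewrite (reindex_inj (@perm_inj _ s)) /=.
apply: eq_big => [y|y _].
  rewrite !in_setU1 -{1}(permKV s k) (inj_eq perm_inj); congr (_ || _).
  by have := perm_closed y sB; rewrite !inE => /negb_inj.
rewrite -!linrepM -{1}(permKV s k) -tpermJ conjgE.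
by rewrite !mulgA mulgV mul1g.
Qed.

Lemma primitive_row_sum v : primitive rho B v -> primitive rho B (row_sum v).
Proof.
move=> pv; apply: subspace_sum (primitive_subspace rho B) _ => r.
by move=> /fix_stabP[rB _]; apply: primitive_act.
Qed.

Lemma primitive_young v : primitive rho B v -> primitive rho B (young v).
Proof.
move=> pv; apply: subspace_comb (primitive_subspace rho B) _ => c.
by move=> /fix_stabP[cB _]; apply/primitive_act/primitive_row_sum.
Qed.

(* For B, row and col the first row, the row and the column numbers of the boxes
   of nu, and W irreducible, this space is a line if W is isomorphic to the
   Specht module of nu, and zero otherwise. *)
Definition young_space (W : V -> Prop) v :=
  exists2 w, W w /\ primitive rho B w & v = young w.

Lemma young_space_subspace W : submodule rho W -> subspace (young_space W).
Proof.
move=> /submodule_subspace[W0 WD]; have [p0 pD] := primitive_subspace rho B.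
split=> [|a _ _ [u [Wu pu] ->] [v [Wv pv] ->]].
  exists 0 => //; have := linear_young (-1) 0 0.
  by rewrite scaler0 addr0 scaleN1r addNr.
exists (a *: u + v); last by rewrite linear_young.
by split; [apply: WD | apply: pD].
Qed.

End Action.

Section Transport.
Variables (V V' : lmodType C) (rho : linrep 'S_n V) (rho' : linrep 'S_n V').

Lemma young_space_iso W W' d : submodule rho W ->
  isomorphic rho W rho' W' ->
  has_dim (young_space rho W) d -> has_dim (young_space rho' W') d.
Proof.
move=> sW [f [fl fg fW fi fs]] hd; have sb := submodule_subspace sW.
have Wg g u : W u -> W (rho g u) by case: sW => _ _; apply.
have fsum (I : Type) (r : seq I) (P : pred I) (w : I -> V) :
    (forall k, P k -> W (w k)) ->
    f (\sum_(k <- r | P k) w k) = \sum_(k <- r | P k) f (w k).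
  exact: linear_on_sum.
have f0 : f 0 = 0 := linear_on0 sb fl.
have fZ a u : W u -> f (a *: u) = a *: f u.
  by move=> Wu; rewrite -[a *: u]addr0 fl ?f0 ?addr0 //; case: sW.
have fyoung u : W u -> f (young rho u) = young rho' (f u).
  move=> Wu; have Wr : W (row_sum rho u).
    by apply: subspace_sum => // r _; apply: Wg.
  rewrite fsum => [|c _]; last by apply: subspaceZ => //; apply: Wg.
  apply: eq_bigr => c _; rewrite fZ ?fg //; last exact: Wg.
  by rewrite fsum => [|r _]; [under eq_bigr do rewrite fg //|exact: Wg].
have fcoset k u : W u -> f (coset_sum rho B k u) = coset_sum rho' B k (f u).
  move=> Wu; rewrite fsum => [|y _]; last exact: Wg.
  by apply: eq_bigr => y _; rewrite fg.
have Wcoset k u : W u -> W (coset_sum rho B k u).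
  by move=> Wu; apply: subspace_sum => // y _; apply: Wg.
have yW v : young_space rho W v -> W v.
  by move=> [w [Ww _] ->]; apply: young_closed.
have fly : linear_on (young_space rho W) f.
  by move=> a u v /yW Wu /yW Wv; apply: fl.
apply: has_dim_ext (has_dim_image hd fly _) => [v|u v /yW Wu /yW Wv]; last exact: fi.
split=> [[_ [w [Ww [fw pw]] ->] ->]|[w' [/fs[w Ww <-] [fw' pw']] ->]].
  exists (f w); last by rewrite fyoung.
  split; first exact: fW.
  split=> [s sB|k kB]; first by rewrite -fg // fw.
  by rewrite -fcoset // pw.
exists (young rho w); last by rewrite fyoung.
exists w => //; split=> //; split=> [s sB|k kB].
  by apply: fi => //; [apply: Wg | rewrite fg // fw'].
by apply: fi; rewrite ?f0 ?fcoset ?pw' //; [apply: Wcoset | case: sW].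
Qed.

End Transport.

(** The conditions of primitivity are linear equations with values in W, so by uniqueness of
    components every component of a primitive vector satisfies them. *)
Lemma young_space_direct_sum (V : lmodType C) (rho : linrep 'S_n V)
    (W : V -> Prop) r (Ws : 'I_r -> V -> Prop) :
  (forall k, submodule rho (Ws k)) -> direct_sum W Ws ->
  direct_sum (young_space rho W) (fun k => young_space rho (Ws k)).
Proof.
move=> sWs [WE W0]; have sb k := submodule_subspace (sWs k).
have young0 : young rho 0 = 0.
  by have := linear_young rho (-1) 0 0; rewrite scaler0 addr0 scaleN1r addNr.
have youngD u v : young rho (u + v) = young rho u + young rho v.
  by rewrite -[u in LHS]scale1r linear_young scale1r.
split=> [v|w Ww w0]; last first.
  by apply: W0 => // k; case: (Ww k) => u [Wu _] ->; apply: young_closed.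
split=> [[u [/WE[w Ww ->] [fu pu]] ->]|[w yw ->]].
  exists (fun k => young rho (w k)); last exact: (big_morph _ youngD young0).
  move=> k; exists (w k) => //; split=> //; split=> [s sB|l lB].
    apply/eqP; rewrite -subr_eq0; apply/eqP.
    apply: (W0 (fun k => rho s (w k) - w k)) => [j|].
      by apply: subspaceB => //; case: (sWs j) => _ _; apply.
    by rewrite sumrB -rho_sum fu // subrr.
  apply: (W0 (fun k => coset_sum rho B l (w k))) => [j|].
    by apply: subspace_sum => // y _; case: (sWs j) => _ _; apply.
  rewrite -[RHS](pu l lB) /coset_sum exchange_big /=.
  by apply: eq_bigr => y _; rewrite rho_sum.
have /choice[x xE] k : exists u, [/\ Ws k u, primitive rho B u & w k = young rho u].
  by have [u [Wu pu] ->] := yw k; exists u.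
exists (\sum_k x k).
  split; first by apply/WE; exists x => // k; case: (xE k).
  by apply: subspace_sum (primitive_subspace rho B) _ => k _; case: (xE k).
rewrite (big_morph _ youngD young0); apply: eq_bigr => k _.
by case: (xE k).
Qed.

End YoungOperator.

(** * Specht modules *)

Section SpechtModule.
Variables (C : numClosedFieldType) (n : nat) (nu : seq nat).
Hypothesis nu_n : sumn nu = n.

Local Notation M := (tabloid_space C n nu).
Local Notation rep := (tabloid_rep C n nu).
Local Notation row := (tableau_row nu (1 : 'S_n)).
Local Notation col := (tableau_col nu (1 : 'S_n)).
Local Notation tab := (@tabloid_of n nu).

Let B : {set 'I_n} := [set e | row e == 0%N].

Definition tabloid_delta (T : tabloid n nu) : M := [ffun T' => (T == T')%:R].

Definition tabloid_form (u v : M) : C := \sum_T u T * (v T)^*.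

Lemma tabloid_form_hermitian : hermitian tabloid_form.
Proof.
split=> [a u v w|u v|u|u].
- rewrite /tabloid_form mulr_sumr -big_split; apply: eq_bigr => T _ /=.
  by rewrite !ffunE mulrDl mulrA.
- rewrite /tabloid_form rmorph_sum; apply: eq_bigr => T _ /=.
  by rewrite rmorphM /= conjCK mulrC.
- by apply: sumr_ge0 => T _; apply: mul_conjC_ge0.
- move=> /eqP; rewrite psumr_eq0 => [/allP h|T _]; last exact: mul_conjC_ge0.
  apply/ffunP => T; rewrite ffunE; apply/eqP.
  by have := h T (mem_index_enum _); rewrite /= mul_conjC_eq0.
Qed.

Lemma tabloid_actK (s : 'S_n) : cancel (@tabloid_act n nu s) (tabloid_act s^-1%g).
Proof. by move=> T; rewrite -tabloid_actM mulgV tabloid_act1. Qed.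

Lemma tabloid_form_inv g (u v : M) : tabloid_form (rep g u) (rep g v) = tabloid_form u v.
Proof.
rewrite /tabloid_form (reindex_inj (can_inj (tabloid_actK g))).
by apply: eq_bigr => T _; rewrite !ffunE tabloid_actK.
Qed.

Lemma rep_delta g T : rep g (tabloid_delta T) = tabloid_delta (tabloid_act g T).
Proof.
apply/ffunP => T'; rewrite !ffunE; congr (_%:R).
by rewrite -[in RHS](inj_eq (can_inj (tabloid_actK g^-1))) tabloid_actK.
Qed.

Lemma form_delta u T : tabloid_form u (tabloid_delta T) = u T.
Proof.
rewrite /tabloid_form (bigD1 T) //= big1 => [|T' ne].
  by rewrite ffunE eqxx conjC1 mulr1 addr0.
by rewrite ffunE eq_sym (negPf ne) conjC0 mulr0.
Qed.

Lemma tableau_row_mul (t : 'S_n) e : tableau_row nu t e = row ((t^-1)%g e).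
Proof. by rewrite /tableau_row invg1 perm1. Qed.

Lemma tableau_col_mul (t : 'S_n) e : tableau_col nu t e = col ((t^-1)%g e).
Proof. by rewrite /tableau_col invg1 perm1. Qed.

Lemma rowE e : row e = reshape_index nu e.
Proof. by rewrite /tableau_row invg1 perm1. Qed.

Lemma colE e : col e = reshape_offset nu e.
Proof. by rewrite /tableau_col invg1 perm1. Qed.

Lemma tab_act (s t : 'S_n) : tabloid_act s (tab t) = tab (t * s)%g.
Proof.
apply/ffunP => r; rewrite !ffunE; apply/setP => e; rewrite inE.
rewrite -{1}(permKV s e) (mem_imset _ _ perm_inj) inE.
by rewrite /tableau_row invMg permM.
Qed.

Lemma ltn_row e : (row e < size nu)%N.
Proof. by rewrite rowE reshape_indexP // nu_n. Qed.

Lemma ltn_col e : (col e < nth 0 nu (row e))%N.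
Proof. by rewrite colE rowE reshape_offsetP // nu_n. Qed.

Lemma row_col_inj e e' : row e = row e' -> col e = col e' -> e = e'.
Proof.
rewrite !rowE !colE => hr hc; apply: val_inj => /=.
by rewrite -(reshape_indexK nu e) hr hc reshape_indexK.
Qed.

Lemma box r c : (r < size nu)%N -> (c < nth 0 nu r)%N ->
  exists e, row e = r /\ col e = c.
Proof.
move=> hr hc; have hn : (flatten_index nu r c < n)%N.
  by rewrite -nu_n flatten_indexP.
exists (Ordinal hn); rewrite rowE colE /=.
by rewrite flatten_indexKl // flatten_indexKr.
Qed.

Lemma tab_eqP (g h : 'S_n) : tab g = tab h <-> forall e, row ((g^-1)%g e) = row ((h^-1)%g e).
Proof.
split=> [gh e|gh].
  have /ffunP/(_ (Ordinal (ltn_row ((g^-1)%g e)))) := gh.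
  rewrite !ffunE => /setP/(_ e); rewrite !inE /= !(tableau_row_mul g) !(tableau_row_mul h) eqxx.
  by move=> /esym/eqP ->.
apply/ffunP => r; rewrite !ffunE; apply/setP => e.
by rewrite !inE !(tableau_row_mul g) !(tableau_row_mul h) gh.
Qed.

Local Notation kappa := (col_alt col rep).
Let et : M := polytabloid C nu 1.

Lemma polytabloid1 : et = kappa (tabloid_delta (tab 1)).
Proof.
apply/ffunP => T; rewrite ffunE sum_ffunE; apply: eq_bigr => s _.
by rewrite ffunE rep_delta tab_act ffunE.
Qed.

Lemma polytabloid_act t : polytabloid C nu t = rep t et.
Proof.
rewrite polytabloid1 /col_alt rho_sum; apply/ffunP => T; rewrite ffunE sum_ffunE.
rewrite [RHS](reindex_inj (conjg_inj t^-1%g)).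
apply: eq_big => [s|s _]; last first.
  rewrite odd_permJ rhoZ -linrepM rep_delta tab_act mul1g !ffunE.
  by rewrite conjgE invgK -!mulgA mulVg mulg1.
rewrite !inE; apply/forallP/forallP => h e.
  by have := h (t e); rewrite conjgE invgK !permM !(tableau_col_mul t) permK.
by have := h ((t^-1)%g e); rewrite conjgE invgK !permM !(tableau_col_mul t) permKV.
Qed.

(** The transposition of e and e' fixes the tabloid of g, yet being in the column group it changes
    the sign under [kappa]. *)
Lemma kappa_delta_zero (g : 'S_n) e e' : e != e' -> row ((g^-1)%g e) = row ((g^-1)%g e') ->
  col e = col e' -> kappa (tabloid_delta (tab g)) = 0.
Proof.
move=> ne er ec; have tC : tperm e e' \in col_stab col.
  by apply/col_stabP => x; case: tpermP => [->|->|].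
have := col_alt_signr rep (tabloid_delta (tab g)) tC.
rewrite odd_tperm ne expr1 scaleN1r rep_delta tab_act.
have -> : tab (g * tperm e e')%g = tab g.
  apply/tab_eqP => x; rewrite invMg tpermV permM.
  by case: tpermP => [->|->|].
move=> /eqP; rewrite -addr_eq0 -mulr2n -scaler_nat scaler_eq0 pnatr_eq0 /=.
by move=> /eqP.
Qed.

(* Counting the entries in the first c columns, row by row: a tabloid no row of
   which meets a column of the standard tableau twice has at most as many of
   them in each row as the standard tableau, hence exactly as many. *)
Lemma kappa_delta_straight (g : 'S_n) :
  (forall e e', row ((g^-1)%g e) = row ((g^-1)%g e') -> col e = col e' -> e = e') ->
  exists2 s, s \in col_stab col & tab g = tab s.
Proof.
move=> ginj; pose A (f : 'I_n -> 'I_n) r c := [set e | (row (f e) == r) && (col e < c)%N].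
pose A1 := A id; pose A2 := A (g^-1)%g.
have cardrow r : #|[set e | row ((g^-1)%g e) == r]| = #|[set e | row e == r]|.
  have -> : [set e | row ((g^-1)%g e) == r] = (g^-1)%g @^-1: [set e | row e == r].
    by apply/setP => e; rewrite !inE.
  by rewrite on_card_preimset //; apply/onW_bij/injF_bij/perm_inj.
have le21 r c : (r < size nu)%N -> (#|A2 r c| <= #|A1 r c|)%N.
  move=> hr; have [hc|hc] := leqP c (nth 0%N nu r); last first.
    have -> : #|A1 r c| = #|[set e | row e == r]|.
      apply: eq_card => e; rewrite !inE; case: eqP => //= er.
      by apply: ltn_trans hc; rewrite -er ltn_col.
    rewrite -cardrow; apply/subset_leq_card/subsetP => e.
    by rewrite !inE => /andP[].
  apply: (@leq_trans c).
    case: c hc => [|c] hc.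
      by rewrite leqn0 cards_eq0; apply/eqP/setP => e; rewrite !inE ltn0 andbF.
    rewrite -[X in (_ <= X)%N]card_ord.
    rewrite -(@card_in_imset _ _ (fun e => inord (col e) : 'I_c.+1)) ?max_card //.
    move=> e e'; rewrite !inE => /andP[/eqP r1 c1] /andP[/eqP r2 c2].
    move=> /(congr1 val); rewrite /= !inordK // => ec.
    by apply: ginj => //; rewrite r1 r2.
  have /choice[b bE] (k : 'I_c) : exists e, row e = r /\ col e = k.
    by apply: box => //; apply: leq_trans hc.
  rewrite -[X in (X <= _)%N]card_ord -(@card_imset _ _ b); last first.
    by move=> k k' /(congr1 (fun e => col e)); rewrite !(proj2 (bE _)) => /val_inj.
  apply/subset_leq_card/subsetP => _ /imsetP[k _ ->].
  by rewrite inE; case: (bE k) => -> ->; rewrite eqxx /=.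
have sumA (f : 'I_n -> 'I_n) c :
    (\sum_(r < size nu) #|A f r c| = #|[set e | col e < c]|)%N.
  rewrite -[RHS]sum1_card (partition_big (fun e => Ordinal (ltn_row (f e))) predT) //=.
  apply: eq_bigr => r _; rewrite -sum1_card; apply: eq_bigl => e.
  by rewrite !inE andbC.
have eq21 r c : (r < size nu)%N -> #|A2 r c| = #|A1 r c|.
  move=> hr; have := leqif_sum (fun (k : 'I_(size nu)) (_ : true) =>
    leqif_eq (le21 k c (ltn_ord k))).
  rewrite !sumA => -[_]; rewrite eqxx => /esym/forallP/(_ (Ordinal hr)) /=.
  by move=> /eqP.
(* Take c to be the length of the row r of e in the tabloid of g. The standard row r lies entirely
   in the first c columns, so by [eq21] row r of that tabloid does too. *)
have cbox e : (col e < nth 0 nu (row ((g^-1)%g e)))%N.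
  set r := row _; have hr : (r < size nu)%N := ltn_row _.
  suff /setP/(_ e) : A2 r (nth 0%N nu r) = [set e | row ((g^-1)%g e) == r].
    by rewrite !inE eqxx.
  apply/eqP; rewrite eqEcard cardrow eq21 //; apply/andP; split.
    by apply/subsetP => x; rewrite !inE => /andP[].
  apply/subset_leq_card/subsetP => x; rewrite !inE => /eqP <-.
  by rewrite eqxx ltn_col.
(* Each e is sent to the box in its own column and in its row for g. This map is injective and
   preserves columns; its inverse is the column permutation sought. *)
have /choice[u uE] e := box (ltn_row ((g^-1)%g e)) (cbox e).
have uinj : injective u.
  move=> e e' ue; have [r1 c1] := uE e; have [r2 c2] := uE e'.
  by apply: ginj; rewrite -?r1 -?r2 -?c1 -?c2 ue.
exists ((perm uinj)^-1)%g.
  apply/col_stabP => e; rewrite -[e in RHS](permKV (perm uinj)) permE.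
  by rewrite (proj2 (uE _)).
by apply/tab_eqP => e; rewrite invgK [X in _ = row X]permE (proj1 (uE e)).
Qed.

Lemma kappa_delta (g : 'S_n) : exists a, kappa (tabloid_delta (tab g)) = a *: et.
Proof.
have [ginj|] := pselect (forall e e',
    row ((g^-1)%g e) = row ((g^-1)%g e') -> col e = col e' -> e = e').
  have [s sC ->] := kappa_delta_straight ginj; exists ((-1) ^+ s).
  by rewrite polytabloid1 -(col_alt_signr rep _ sC) rep_delta tab_act mul1g.
move=> nginj; exists 0; rewrite scale0r; apply: contrapT => k0; apply: nginj => e e' er ec.
by apply: contrapT => /eqP ne; apply: k0; apply: kappa_delta_zero er ec.
Qed.

Local Notation S := (@specht C n nu).

Lemma specht_submodule : submodule rep S.
Proof.
split=> [|a _ _ [c ->] [d ->]|g _ [c ->]].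
- by exists (fun=> 0); rewrite big1 // => t _; rewrite scale0r.
- exists (fun t => a * c t + d t); rewrite scaler_sumr -big_split.
  by apply: eq_bigr => t _; rewrite scalerDl scalerA.
- exists (fun t => c (t * g^-1)%g).
  rewrite rho_sum [RHS](reindex_inj (mulIg g)); apply: eq_bigr => t _ /=.
  by rewrite mulgK rhoZ !polytabloid_act -linrepM.
Qed.

Lemma specht_polytabloid t : S (polytabloid C nu t).
Proof.
exists (fun s => (s == t)%:R); rewrite (bigD1 t) //= eqxx scale1r big1 ?addr0 //.
by move=> s /negPf ->; rewrite scale0r.
Qed.

Lemma specht_et : S et. Proof. exact: specht_polytabloid. Qed.

(** The type [tabloid] also contains families of sets that come from no tableau; elements of the
    Specht module do not involve them. *)
Lemma specht_delta u : S u -> exists d : 'S_n -> C, u = \sum_g d g *: tabloid_delta (tab g).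
Proof.
pose D (u : M) := exists d : 'S_n -> C, u = \sum_g d g *: tabloid_delta (tab g).
have sD : subspace D.
  split=> [|a _ _ [c ->] [d ->]].
    by exists (fun=> 0); rewrite big1 // => t _; rewrite scale0r.
  exists (fun t => a * c t + d t); rewrite scaler_sumr -big_split.
  by apply: eq_bigr => t _; rewrite scalerDl scalerA.
move=> [c ->]; rewrite -/(D _); apply: subspace_comb (sD) _ => t _.
rewrite polytabloid_act polytabloid1 rho_sum; apply: subspace_sum (sD) _ => s _.
rewrite rhoZ; apply: subspaceZ sD _; rewrite -linrepM rep_delta tab_act.
set g := (1 * _)%g; exists (fun s => (s == g)%:R); rewrite (bigD1 g) //= eqxx scale1r.
by rewrite big1 ?addr0 // => h /negPf ->; rewrite scale0r.
Qed.

Lemma kappa_specht u : S u -> exists a, kappa u = a *: et.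
Proof.
move=> /specht_delta[d ->]; have /choice[a aE] := kappa_delta.
have k0 : kappa 0 = 0.
  by have := linear_col_alt col rep (-1) 0 0; rewrite scaler0 addr0 scaleN1r addNr.
have kD x y : kappa (x + y) = kappa x + kappa y.
  by rewrite -[x in LHS]scale1r linear_col_alt scale1r.
exists (\sum_g d g * a g); rewrite (big_morph kappa kD k0) scaler_suml.
apply: eq_bigr => g _; rewrite -[X in kappa X]addr0 linear_col_alt k0 addr0 aE.
by rewrite scalerA.
Qed.

Lemma kappa_adj u v : tabloid_form (kappa u) v = tabloid_form u (kappa v).
Proof.
have hH := tabloid_form_hermitian.
rewrite (herm_suml hH) (herm_sumr hH) (reindex_inj invg_inj) /=.
apply: eq_big => [s|s _].
  apply/col_stabP/col_stabP => h e; last by rewrite -[RHS](congr1 col (permKV s e)) h.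
  by rewrite -(h (s e)) permK.
rewrite (hermZl hH) (hermZr hH) (herm_adj tabloid_form_inv) invgK odd_permV.
by rewrite rmorph_sign.
Qed.

Lemma et_tab1 : et (tab 1) = 1.
Proof.
rewrite /et ffunE (bigD1 1%g) /=; last by apply/col_stabP => e; rewrite perm1.
rewrite odd_perm1 mul1g eqxx mulr1 expr0 big1 ?addr0 // => s /andP[/col_stabP sC s1].
rewrite mul1g; case: eqP => [/tab_eqP sr|_]; last by rewrite mulr0.
case/eqP: s1; apply/permP => e; rewrite perm1; apply: row_col_inj => //.
by have := sr (s e); rewrite permK invg1 perm1.
Qed.

(** James's submodule argument: [kappa] is self-adjoint and maps the Specht module to the line of
    [et]. If it kills U, then U is orthogonal to all polytabloids, hence to itself; otherwise U
    contains [et] and so everything. *)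
Lemma specht_irreducible : irreducible_submodule rep S.
Proof.
have hH := tabloid_form_hermitian.
split; first exact: specht_submodule.
  exists et; first exact: specht_et.
  by apply/eqP => e0; move: et_tab1; rewrite e0 ffunE => /eqP; rewrite eq_sym oner_eq0.
move=> U [U0 UD Ug] US.
have [k0|] := pselect (forall u, U u -> kappa u = 0).
  left=> u Uu; apply: (herm_eq0 hH).
  have [c uE] := US _ Uu; rewrite {2}uE (herm_sumr hH) big1 // => t _.
  rewrite (hermZr hH) polytabloid_act -{1}(rhoK rep t u) tabloid_form_inv.
  rewrite polytabloid1 -kappa_adj k0; last exact: Ug.
  by rewrite (herm0l hH) mulr0.
move=> nk; right; have [u Uu ku] : exists2 u, U u & kappa u != 0.
  apply: contrapT => h; apply: nk => u Uu; apply: contrapT => /eqP ku.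
  by apply: h; exists u.
have sU : subspace U by split.
have [a kE] := kappa_specht (US _ Uu).
have Uet : U et.
  have a0 : a != 0 by apply: contraNneq ku => a0; rewrite kE a0 scale0r.
  rewrite -[et]scale1r -(mulVf a0) -scalerA -kE; apply: subspaceZ => //.
  by apply: subspace_comb => // s _; apply: Ug.
move=> _ [c ->]; apply: subspace_comb => // t _; rewrite polytabloid_act.
exact: Ug.
Qed.

Lemma row0_col_inj : {in B &, injective col}.
Proof.
move=> e e'; rewrite !inE => /eqP r /eqP r' ec.
by apply: row_col_inj => //; rewrite r r'.
Qed.

(** A permutation preserving all rows is one of the first row times one fixing the first row
    pointwise, so the two invariances together cover the full row group. *)
Lemma row_stab_fixed (V : lmodType C) (rho : linrep 'S_n V) v (s : 'S_n) :
  fixed_by rho B v -> (forall r, r \in fix_stab B row -> rho r v = v) ->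
  (forall e, row (s e) = row e) -> rho s v = v.
Proof.
move=> fB fR sR.
have [|h hB hs] := @perm_restrict _ B s; first by move=> e; rewrite !inE sR.
have hR e : row (h e) = row e.
  have [eB|eB] := boolP (e \in B); first by rewrite hs.
  by rewrite (out_perm hB).
rewrite -(mulKVg h s) linrepM fB // fR //; apply/fix_stabP; split.
  apply/subsetP => e; rewrite !inE; apply: contraNN => /eqP re.
  have eB : (h^-1)%g e \in B by rewrite (perm_closed _ (perm_onV hB)) inE re.
  by rewrite permM -hs // permKV.
by move=> e; rewrite permM sR -[RHS](congr1 row (permKV h e)) hR.
Qed.

(** * Young vectors of Specht modules and the count of multiplicities *)

Section Columns.
Hypothesis col_lt : forall e, (col e < #|B|)%N.

(* Sym (k |: B) acts on k |: B, which has more elements than there are columns,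
   so it contains a transposition inside a column of any given tableau. *)
Lemma specht_fixed0 k v : k \notin B -> S v -> fixed_by rep (k |: B) v -> v = 0.
Proof.
have hH := tabloid_form_hermitian.
move=> kB Sv fv; apply: (herm_eq0 hH); have [c {2}->] := Sv.
rewrite (herm_sumr hH) big1 // => t _; rewrite (hermZr hH).
suff -> : tabloid_form v (polytabloid C nu t) = 0 by rewrite mulr0.
have [x [y [xB yB xy xyc]]] : exists x y, [/\ x \in k |: B, y \in k |: B, x != y
    & tableau_col nu t x = tableau_col nu t y].
  apply: contrapT => nxy.
  have inj : {in k |: B &, injective (fun e => inord (tableau_col nu t e) : 'I_#|B|.-1.+1)}.
    have B0 : (0 < #|B|)%N by apply: leq_ltn_trans (col_lt k).
    have tlt e : (tableau_col nu t e < #|B|.-1.+1)%N.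
      by rewrite prednK // (tableau_col_mul t).
    move=> x y xB yB /(congr1 val); rewrite /= !inordK // => xyc.
    by apply: contrapT => /eqP ne; apply: nxy; exists x, y.
  have := max_card (mem ((fun e => inord (tableau_col nu t e) : 'I_#|B|.-1.+1) @: (k |: B))).
  rewrite card_in_imset // cardsU1 kB card_ord.
  rewrite prednK ?add1n ?ltnn //.
  by apply: leq_ltn_trans (col_lt k).
have tB : perm_on (k |: B) (tperm x y).
  by apply: subset_trans (tperm_on x y) _; rewrite subUset !sub1set xB.
have tC : (t * tperm x y * t^-1)%g \in col_stab col.
  apply/col_stabP => e; rewrite !permM -!(tableau_col_mul t).
  case: tpermP => [ex|ey|_ _]; last by rewrite (tableau_col_mul t) permK.
    by rewrite -xyc -ex (tableau_col_mul t) permK.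
  by rewrite xyc -ey (tableau_col_mul t) permK.
have tE : rep (tperm x y) (polytabloid C nu t) = - polytabloid C nu t.
  rewrite polytabloid_act -linrepM -[(t * _)%g](mulgKV t) linrepM polytabloid1.
  rewrite col_alt_sign // -polytabloid1 rhoZ -polytabloid_act.
  by rewrite !odd_permM odd_permV addbAC addbb odd_tperm xy expr1 scaleN1r.
have : tabloid_form v (polytabloid C nu t) = - tabloid_form v (polytabloid C nu t).
  rewrite -{1}(fv _ tB) (herm_adj tabloid_form_inv) tpermV tE.
  by rewrite -scaleN1r (hermZr hH) rmorphN rmorph1 mulN1r.
by move=> /eqP; rewrite -addr_eq0 -mulr2n mulrn_eq0 /= => /eqP.
Qed.

(** A coset sum is fixed by Sym (k |: B), and [specht_fixed0] leaves only zero for it. *)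
Lemma specht_primitive v : S v -> fixed_by rep B v -> primitive rep B v.
Proof.
move=> Sv fv; split=> // k kB; apply: (specht_fixed0 kB).
  apply: subspace_sum => [|y _]; first exact: submodule_subspace specht_submodule.
  by case: specht_submodule => _ _; apply.
exact: coset_sum_fixed.
Qed.

(** At most a line, because [kappa] maps the Specht module to the line of [et] and is injective on
    these vectors; at least a line, by symmetrizing [et] over the full row group. *)
Lemma young_space_specht : has_dim (young_space B row col rep S) 1.
Proof.
have hH := tabloid_form_hermitian; have Sg g u : S u -> S (rep g u).
  by case: specht_submodule => _ _; apply.
have sS := submodule_subspace specht_submodule.
pose R := [set s : 'S_n | [forall e, row (s e) == row e]].
have RP (s : 'S_n) : reflect (forall e, row (s e) = row e) (s \in R).
  by rewrite inE; apply: (iffP forallP) => h e; apply/eqP.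
pose w := \sum_(r in R) rep r et.
have Sw : S w by apply: subspace_sum => // r _; apply/Sg/specht_et.
have wR (s : 'S_n) : (forall e, row (s e) = row e) -> rep s w = w.
  move=> sR; rewrite rho_sum [RHS](reindex_inj (mulIg s)) /=.
  apply: eq_big => [r|r _]; last by rewrite linrepM.
  by apply/RP/RP => h e; [rewrite permM sR | rewrite -[RHS]h permM sR].
have fw : fixed_by rep B w.
  move=> s sB; apply: wR => e; have [eB|eB] := boolP (e \in B); last first.
    by rewrite (out_perm sB).
  by have := perm_closed e sB; move: (eB); rewrite !inE => /eqP -> /eqP ->.
have R0 : (0 < #|R|)%N by apply/card_gt0P; exists 1%g; apply/RP => e; rewrite perm1.
(* The coefficient of w at the standard tabloid is the order of the row group, so w is nonzero. Its
   squared norm is a multiple of its pairing with [et], that is, of the pairing of [kappa w] with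
   the standard tabloid. *)
have kw : kappa w != 0.
  have wd : tabloid_form w (tabloid_delta (tab 1)) = #|R|%:R * et (tab 1).
    rewrite (herm_suml hH) mulr_natl -sumr_const; apply: eq_bigr => r /RP rR.
    rewrite (herm_adj tabloid_form_inv) rep_delta tab_act mul1g form_delta.
    by congr (et _); apply/tab_eqP => e; rewrite invgK invg1 perm1.
  have w0 : w != 0.
    apply/eqP => w0; move: wd; rewrite w0 (herm0l hH) et_tab1 mulr1 => /esym/eqP.
    by rewrite pnatr_eq0 -leqn0 leqNgt R0.
  apply: contraNneq w0 => k0; apply/eqP/(herm_eq0 hH).
  rewrite {2}/w (herm_sumr hH) big1 // => r /RP rR; rewrite -[w](wR r) //.
  by rewrite tabloid_form_inv polytabloid1 -kappa_adj k0 (herm0l hH).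
have pw := specht_primitive Sw fw.
have rw : row_sum B row rep w = #|fix_stab B row|%:R *: w.
  rewrite scaler_nat -sumr_const; apply: eq_bigr => r /fix_stabP[_ rR].
  exact: wR.
have stab0 f : #|fix_stab B f|%:R != 0 :> C.
  rewrite pnatr_eq0 -lt0n; apply/card_gt0P; exists 1%g; apply/fix_stabP.
  by split=> [|e]; [apply: perm_on1 | rewrite perm1].
have kZ a u : kappa (a *: u) = a *: kappa u.
  rewrite -[a *: u]addr0 linear_col_alt.
  have := linear_col_alt col rep (-1) 0 0; rewrite scaler0 addr0 scaleN1r addNr => ->.
  by rewrite addr0.
set y := young B row col rep w.
have ky : kappa y != 0.
  by rewrite col_alt_young rw kZ !scaler_eq0 (negPf kw) !(negPf (stab0 _)).
have [a ya] := kappa_specht (young_closed B row col specht_submodule Sw).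
have a0 : a != 0 by apply: contraNneq ky => a0; rewrite ya a0 scale0r.
apply: (@has_dim1 _ _ _ y).
- by apply: contraNneq ky => y0; rewrite y0 -(scale0r et) kZ !scale0r.
- by exists w.
- exact: young_space_subspace specht_submodule.
move=> _ [u [Su pu] ->].
have [b ub] := kappa_specht (young_closed B row col specht_submodule Su).
(* The scalar is chosen so that [kappa] kills the difference, which is primitive and sign-invariant,
   hence zero. *)
exists (b / a); apply/eqP; rewrite -subr_eq0 -scaleNr addrC; apply/eqP.
have sp := primitive_subspace rep B.
apply: (primitive_col_inj hH tabloid_form_inv row0_col_inj).
- by case: sp => _; apply; apply: primitive_young.
- move=> c cC cB; have cF : c \in fix_stab B col.
    by apply/fix_stabP; split=> //; apply/col_stabP.
  by rewrite linrepP !young_sign // scalerDr !scalerA [_ * (-1) ^+ _]mulrC.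
by rewrite -/(kappa _) linear_col_alt ya ub scalerA mulNr divfK // scaleNr addNr.
Qed.

Variables (V : lmodType C) (rho : linrep 'S_n V) (H : V -> V -> C).
Hypotheses (hH : hermitian H)
  (Hinv : forall g u v, H (rho g u) (rho g v) = H u v).

(** The vector [w'] is invariant under the full row group, so the standard tabloid can be sent to it
    equivariantly. The polytabloid [et] then goes to the column antisymmetrization of [w'], which is
    nonzero since y is, and Schur's lemma applies. *)
Lemma young_space_irreducible (U : V -> Prop) y :
  irreducible_submodule rho U -> young_space B row col rho U y -> y != 0 ->
  isomorphic rho U rep S.
Proof.
move=> Uirr [w [Uw pw] yE] y0; have [sU _ _] := Uirr.
have sb := submodule_subspace sU; have [_ _ Ug] := sU.
pose w' := row_sum B row rho w.
have Uw' : U w' by apply: subspace_sum => // r _; apply: Ug.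
have pw' : primitive rho B w' by apply: primitive_row_sum.
have kw' : col_alt col rho w' != 0.
  apply: contraNneq y0 => k0; rewrite yE; apply/eqP.
  apply: (primitive_col_inj hH Hinv row0_col_inj).
  - exact: primitive_young.
  - by move=> c /col_stabP cC cB; apply: young_sign; apply/fix_stabP.
  by rewrite -/(col_alt col rho _) col_alt_young k0 scaler0.
have wtab g h : tab g = tab h -> rho g w' = rho h w'.
  move=> /tab_eqP gh; rewrite -{1}(mulgKV h g) linrepM; congr (rho h _).
  apply: (row_stab_fixed (proj1 pw')) => [r rR|e]; first exact: rho_row_sum.
  by rewrite permM -gh permK.
(* The choice of g is harmless by [wtab]. Families of sets that come from no tableau go to 0, and
   equivariance is claimed only on the Specht module, which does not involve them. *)
pose phi (u : M) := \sum_T u T *: (if [pick g | tab g == T] is Some g then rho g w' else 0).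
have phiP a u v : phi (a *: u + v) = a *: phi u + phi v.
  rewrite /phi scaler_sumr -big_split; apply: eq_bigr => T _ /=.
  by rewrite !ffunE scalerDl scalerA.
have phi0 : phi 0 = 0.
  by have := phiP (-1) 0 0; rewrite scaler0 addr0 scaleN1r addNr.
have phiD u v : phi (u + v) = phi u + phi v.
  by rewrite -[u in LHS]scale1r phiP scale1r.
have phiZ a u : phi (a *: u) = a *: phi u.
  by rewrite -[a *: u]addr0 phiP phi0 addr0.
have phid g : phi (tabloid_delta (tab g)) = rho g w'.
  rewrite /phi (bigD1 (tab g)) //= big1 => [|T ne].
    rewrite ffunE eqxx scale1r addr0; case: pickP => [h /eqP hg|/(_ g)].
      exact: wtab.
    by rewrite eqxx.
  by rewrite ffunE eq_sym (negPf ne) scale0r.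
have phig g u : S u -> phi (rep g u) = rho g (phi u).
  move=> /specht_delta[d ->]; rewrite rho_sum !(big_morph phi phiD phi0) rho_sum.
  apply: eq_bigr => h _; rewrite rhoZ !phiZ rhoZ; congr (_ *: _).
  by rewrite rep_delta tab_act !phid linrepM.
apply: isomorphic_sym specht_submodule _.
apply: (@schur _ _ _ _ _ _ _ _ phi et specht_irreducible Uirr) => //.
- move=> u /specht_delta[d ->]; rewrite (big_morph phi phiD phi0).
  by apply: subspace_sum => // g _; rewrite phiZ phid; apply: subspaceZ => //; apply: Ug.
- exact: specht_et.
rewrite polytabloid1 (big_morph phi phiD phi0).
under eq_bigr => s _ do rewrite phiZ rep_delta tab_act mul1g phid.
exact: kw'.
Qed.

(** In a decomposition into irreducibles, a summand contributes dimension 1 or 0 according to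
    whether it is isomorphic to the Specht module. *)
Lemma has_multiplicity_young (W : V -> Prop) m d :
  submodule rho W -> has_dim W m -> has_dim (young_space B row col rho W) d ->
  has_multiplicity rep S rho W d.
Proof.
move=> sW hW hd; have [r [Ws [irr dec]]] := maschke hH Hinv hW sW.
exists r, Ws; split=> //.
have sWs k : submodule rho (Ws k) by case: (irr k).
pose I := [set k | `[< isomorphic rho (Ws k) rep S >]].
have hk k : has_dim (young_space B row col rho (Ws k)) (k \in I).
  rewrite inE; case: asboolP => [iso|niso].
    by apply: young_space_iso young_space_specht => //;
       [exact: specht_submodule | apply: isomorphic_sym].
  apply/has_dim0 => y; split=> [yy|->].
    by apply: contrapT => /eqP y0; apply: niso; apply: young_space_irreducible yy y0.
  by case: (young_space_subspace B row col (sWs k)).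
apply: has_dim_uniq hd.
have := has_dim_direct_sum (young_space_direct_sum B row col sWs dec) hk.
suff -> : (\sum_k (k \in I) = #|I|)%N by [].
by rewrite -sum1_card [RHS]big_mkcond; apply: eq_bigr => k _ /=; case: (k \in I).
Qed.

End Columns.

End SpechtModule.

(** * Monomials in two rows of variables *)

Section Monomials.
Variable n : nat.
Implicit Types (m : 'X_{1..n + n}) (c : 'I_n -> nat * nat) (s : 'S_n).

Definition mcol m (k : 'I_n) : nat * nat := (m (lshift n k), m (rshift n k)).
Arguments mcol : simpl never.

Definition mnm_of c : 'X_{1..n + n} :=
  [multinom match split v with inl k => (c k).1 | inr k => (c k).2 end | v < n + n].

Lemma mcolK c k : mcol (mnm_of c) k = c k.
Proof.
rewrite /mcol !mnmE (unsplitK (inl k)) (unsplitK (inr k)).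
by case: (c k).
Qed.

Lemma mcolP m m' : (forall k, mcol m k = mcol m' k) -> m = m'.
Proof.
move=> e; apply/mnmP => v; case: (split_ordP v) => k ->; first by case: (e k).
by case: (e k).
Qed.

Lemma mcol0 k : mcol 0 k = (0, 0)%N.
Proof. by rewrite /mcol !mnm0E. Qed.

Lemma mcolD m m' k :
  mcol (m + m') k = ((mcol m k).1 + (mcol m' k).1, (mcol m k).2 + (mcol m' k).2)%N.
Proof. by rewrite /mcol !mnmDE. Qed.

Definition mperm s m := mnm_of (fun k => mcol m (s k)).

Lemma mcol_mperm s m k : mcol (mperm s m) k = mcol m (s k).
Proof. exact: mcolK. Qed.

Lemma mpermK s : cancel (mperm s) (mperm s^-1%g).
Proof. by move=> m; apply: mcolP => k; rewrite !mcol_mperm permKV. Qed.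

Lemma mpermKV s : cancel (mperm s^-1%g) (mperm s).
Proof. by move=> m; apply: mcolP => k; rewrite !mcol_mperm permK. Qed.

Definition bideg m : nat * nat := (\sum_k (mcol m k).1, \sum_k (mcol m k).2)%N.

Lemma bideg_perm s m : bideg (mperm s m) = bideg m.
Proof.
have h (F : nat * nat -> nat) :
    (\sum_k F (mcol (mperm s m) k) = \sum_k F (mcol m k))%N.
  rewrite [RHS](reindex_inj (@perm_inj _ s)).
  by apply: eq_bigr => k _; rewrite mcol_mperm.
by rewrite /bideg (h fst) (h snd).
Qed.

Lemma bidegD m m' :
  bideg (m + m') = ((bideg m).1 + (bideg m').1, (bideg m).2 + (bideg m').2)%N.
Proof.
by rewrite /bideg /= -!big_split; congr (_, _); apply: eq_bigr => k _; apply: mnmDE.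
Qed.

Lemma mdeg_bideg m : mdeg m = ((bideg m).1 + (bideg m).2)%N.
Proof. by rewrite mdegE big_split_ord. Qed.

Definition free_count (B : {set 'I_n}) m := #|[set k in B | mcol m k == (0, 0)%N]|.

Lemma free_count_perm (B : {set 'I_n}) s m :
  perm_on B s -> free_count B (mperm s m) = free_count B m.
Proof.
move=> sB; rewrite /free_count -[RHS](card_preimset _ (@perm_inj _ s)).
by apply: eq_card => k; rewrite !inE mcol_mperm perm_closed.
Qed.

End Monomials.

Section Coefficients.
Variables (C : numClosedFieldType) (n : nat).
Local Notation P := {mpoly C[n + n]}.
Local Notation prep := (poly_rep C n).
Implicit Types (f g h : P) (m : 'X_{1..n + n}) (s : 'S_n).

Lemma mcoeff_act s f m : (prep s f)@_m = f@_(mperm s m).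
Proof.
rewrite mcoeff_sym; congr (f@__); apply: mcolP => k.
by rewrite mcol_mperm /mcol !mnmE !permE diag_fun_lshift diag_fun_rshift.
Qed.

Lemma prepM s f g : prep s (f * g) = prep s f * prep s g.
Proof. exact: rmorphM. Qed.

Lemma prepX s m : prep s 'X_[m] = 'X_[mperm s^-1%g m].
Proof.
apply/mpolyP => m'; rewrite mcoeff_act !mcoeffX; congr (_ : bool)%:R.
by apply/eqP/eqP => [->|<-]; rewrite ?mpermK ?mpermKV.
Qed.

Lemma mpoly_linear_ext (V : lmodType C) (F G : P -> V) :
  linear F -> linear G -> (forall m, F 'X_[m] = G 'X_[m]) -> F =1 G.
Proof.
move=> lF lG FG f.
have [F' F'E] := linear_bundle lF; have [G' G'E] := linear_bundle lG.
rewrite -F'E -G'E [f]mpolyE !linear_sum; apply: eq_bigr => m _.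
by rewrite !linearZ F'E G'E FG.
Qed.

(** Diagonal operators in the monomial basis serve twice: to extract bihomogeneous components, and
    to correct coefficients when lifting invariants. *)
Definition mweight (w : 'X_{1..n + n} -> C) f : P :=
  \sum_(m <- msupp f) (w m * f@_m) *: 'X_[m].

Lemma mcoeff_weight w f m : (mweight w f)@_m = w m * f@_m.
Proof.
rewrite /mweight raddf_sum /=.
have [mf|mf] := boolP (m \in msupp f).
  rewrite (bigD1_seq m) ?msupp_uniq //= mcoeffZ mcoeffX eqxx mulr1.
  rewrite big1 ?addr0 // => m' ne.
  by rewrite mcoeffZ mcoeffX (negPf ne) mulr0.
rewrite (memN_msupp_eq0 mf) mulr0 big_seq big1 // => m' m'f.
rewrite mcoeffZ mcoeffX; case: eqP => [e|_]; last by rewrite mulr0.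
by rewrite -e m'f in mf.
Qed.

Lemma linear_weight w a f g :
  mweight w (a *: f + g) = a *: mweight w f + mweight w g.
Proof.
apply/mpolyP => m.
by rewrite mcoeffD mcoeffZ !mcoeff_weight mcoeffD mcoeffZ mulrDr mulrCA.
Qed.

Lemma weight_act w s f : (forall m, w (mperm s m) = w m) ->
  mweight w (prep s f) = prep s (mweight w f).
Proof.
by move=> ws; apply/mpolyP => m; rewrite mcoeff_weight !mcoeff_act mcoeff_weight ws.
Qed.

Definition bicomp (d : nat * nat) := mweight (fun m => (bideg m == d)%:R).

Lemma bihomogeneousP i j f :
  bihomogeneous i j f <-> forall m, f@_m != 0 -> bideg m = (i, j).
Proof.
split=> h m; first by rewrite -mcoeff_msupp => /h[]; rewrite /bideg /= => -> ->.
by rewrite mcoeff_msupp => /h[].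
Qed.

Lemma bihomogeneous_bicomp i j f : bihomogeneous i j (bicomp (i, j) f).
Proof.
apply/bihomogeneousP => m; rewrite mcoeff_weight; case: (bideg m =P _) => //= _.
by rewrite mul0r eqxx.
Qed.

Lemma bicomp_id i j f : bihomogeneous i j f -> bicomp (i, j) f = f.
Proof.
move=> /bihomogeneousP h; apply/mpolyP => m; rewrite mcoeff_weight.
have [->|/h ->] := eqVneq f@_m 0; first by rewrite mulr0.
by rewrite eqxx mul1r.
Qed.

Lemma bicomp_act d s f : bicomp d (prep s f) = prep s (bicomp d f).
Proof. by apply: weight_act => m; rewrite bideg_perm. Qed.

Lemma bihomogeneous_subspace i j : subspace (@bihomogeneous C n i j).
Proof.
split=> [m|a f g /bihomogeneousP hf /bihomogeneousP hg]; first by rewrite msupp0.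
apply/bihomogeneousP => m; rewrite mcoeffD mcoeffZ.
have [f0|/hf//] := eqVneq f@_m 0; rewrite f0 mulr0 add0r; exact: hg.
Qed.

Lemma bihomogeneous_act i j s f : bihomogeneous i j f -> bihomogeneous i j (prep s f).
Proof.
move=> /bihomogeneousP h; apply/bihomogeneousP => m.
by rewrite mcoeff_act => /h; rewrite bideg_perm.
Qed.

Lemma bicomp_mulX d m f :
  bicomp d ('X_[m] * f) =
  if ((bideg m).1 <= d.1)%N && ((bideg m).2 <= d.2)%N
  then 'X_[m] * bicomp (d.1 - (bideg m).1, d.2 - (bideg m).2)%N f else 0.
Proof.
have bX d' m' : bicomp d' 'X_[m'] = if bideg m' == d' then 'X_[m'] else 0.
  apply/mpolyP => m''; rewrite mcoeff_weight mcoeffX.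
  have [->|ne] := eqVneq m' m''; first by
    case: ifP => _ /=; rewrite ?mulr0n ?mul1r ?mul0r ?mcoeff0 // mcoeffX eqxx.
  by rewrite mulr0; case: ifP => _; rewrite ?mcoeff0 // mcoeffX (negPf ne).
pose G f := if ((bideg m).1 <= d.1)%N && ((bideg m).2 <= d.2)%N
  then 'X_[m] * bicomp (d.1 - (bideg m).1, d.2 - (bideg m).2)%N f else 0.
apply: (@mpoly_linear_ext _ (fun f => bicomp d ('X_[m] * f)) G) => [a g h|a g h|m'].
- by rewrite mulrDr -scalerAr; apply: linear_weight.
- rewrite /G; case: ifP => _; last by rewrite scaler0 addr0.
  by rewrite /bicomp linear_weight mulrDr scalerAr.
rewrite /G -mpolyXD !bX; case: d {G} => i j /=.
have -> : (bideg (m + m') == (i, j)) =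
  [&& ((bideg m).1 <= i)%N, ((bideg m).2 <= j)%N &
      bideg m' == (i - (bideg m).1, j - (bideg m).2)%N].
  rewrite bidegD; case: (bideg m) => a b; case: (bideg m') => a' b' /=.
  rewrite !xpair_eqE.
  apply/andP/and3P => [[/eqP <- /eqP <-]|[h1 h2 /andP[/eqP -> /eqP ->]]].
    by rewrite !leq_addr !addKn !eqxx.
  by rewrite !subnKC.
case: (_ <= i)%N => //=; case: (_ <= j)%N => //=.
by case: ifP => _; rewrite ?mulr0 // mpolyXD.
Qed.

End Coefficients.

(** * The ideal of invariants and the restriction of variables *)

Section FiniteDimension.
Variables (C : numClosedFieldType) (n : nat).

Lemma bihomogeneous_has_dim i j : exists d, has_dim (@bihomogeneous C n i j) d.
Proof.
(* The type [bmultinom] bounds degrees strictly, hence the successor. *)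
pose k := (i + j).+1.
have [F FE] : exists F : {linear 'rV[C]_#|{: bmultinom (n + n) k}| -> {mpoly C[n + n]}},
    F =1 (fun x => \sum_(m : bmultinom (n + n) k) x 0 (enum_rank m) *: 'X_[m]).
  apply: linear_bundle => a x y; rewrite scaler_sumr -big_split.
  by apply: eq_bigr => m _; rewrite !mxE scalerDl scalerA.
have FX x (m : bmultinom (n + n) k) : (F x)@_m = x 0 (enum_rank m).
  rewrite FE raddf_sum (bigD1 m) //= mcoeffZ mcoeffX eqxx mulr1 big1 ?addr0 // => m' ne.
  by rewrite mcoeffZ mcoeffX (inj_eq val_inj) (negPf ne) mulr0.
have hF : has_dim (fun f => exists x, f = F x) #|{: bmultinom (n + n) k}|.
  exists F => // x y e; apply/rowP => l.
  by rewrite -(enum_valK l) -!FX e.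
apply: has_dim_sub hF (bihomogeneous_subspace C n i j) _ => f /bihomogeneousP hf.
exists (\row_l f@_(enum_val l : bmultinom (n + n) k)); rewrite FE.
rewrite [LHS](@mpolywE _ _ k); last first.
  rewrite msizeE; apply/bigmax_leqP_seq => m + _; rewrite mcoeff_msupp => /hf hm.
  by rewrite mdeg_bideg hm.
by apply: eq_bigr => m _; rewrite mxE enum_rankK.
Qed.

End FiniteDimension.

Section Ideal.
Variables (C : numClosedFieldType) (n : nat).
Local Notation P := {mpoly C[n + n]}.
Local Notation prep := (poly_rep C n).

Lemma ideal0 : in_inv_ideal (0 : P).
Proof. by have [/asboolP] := inv_ideal_closed C n. Qed.

Lemma idealMD (a u v : P) :
  in_inv_ideal u -> in_inv_ideal v -> in_inv_ideal (a * u + v).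
Proof.
have [_ _ h] := inv_ideal_closed C n.
by move=> hu hv; apply/asboolP/h; apply/asboolP.
Qed.

Lemma ideal_subspace : subspace (@in_inv_ideal C n).
Proof.
by split=> [|a u v hu hv]; [exact: ideal0 | rewrite -mul_mpolyC; apply: idealMD].
Qed.

Lemma ideal_inv (g h : P) : invariant_no_const h -> in_inv_ideal (g * h).
Proof. by move=> hh; exists 1%N, (fun=> g), (fun=> h); rewrite big_ord1. Qed.

(** The given generators need not be homogeneous. After expanding the cofactors into monomials, each
    component is a monomial times a component of a generator, which is again invariant without
    constant term. *)
Lemma ideal_bicomp d (f : P) : in_inv_ideal f -> in_inv_ideal (bicomp d f).
Proof.
move=> [r [g [h [hh ->]]]].
have l0 : bicomp d (0 : P) = 0.
  by apply/mpolyP => m; rewrite mcoeff_weight mcoeff0 mulr0.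
have lD (u v : P) : bicomp d (u + v) = bicomp d u + bicomp d v.
  by rewrite -[u in LHS]scale1r /bicomp linear_weight scale1r.
rewrite (big_morph _ lD l0); apply: subspace_sum ideal_subspace _ => k _.
rewrite [g k]mpolyE mulr_suml (big_morph _ lD l0).
apply: subspace_sum ideal_subspace _ => m _.
rewrite -scalerAl -[_ *: _]addr0 /bicomp linear_weight -!/(bicomp _ _) l0 addr0.
apply: subspaceZ ideal_subspace _; rewrite bicomp_mulX.
case: ifP => _; last exact: ideal0.
have [hinv h0] := hh k; apply: ideal_inv; split.
  move=> s; exact: etrans (esym (bicomp_act _ s (h k))) (congr1 (bicomp _) (hinv s)).
by rewrite mcoeff_weight h0 mulr0.
Qed.

Definition ideal_comp i j (f : P) := in_inv_ideal f /\ bihomogeneous i j f.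

Lemma ideal_comp_subspace i j : subspace (ideal_comp i j).
Proof.
have [I0 ID] := ideal_subspace; have [b0 bD] := bihomogeneous_subspace C n i j.
by split=> [//|a u v [Iu bu] [Iv bv]]; split; [apply: ID | apply: bD].
Qed.

Lemma ideal_comp_has_dim i j : exists d, has_dim (ideal_comp i j) d.
Proof.
have [d hd] := bihomogeneous_has_dim C n i j.
by apply: has_dim_sub hd (ideal_comp_subspace i j) _ => f [].
Qed.

Lemma fixed_by_weight B (w : 'X_{1..n + n} -> C) (f : P) :
  (forall s m, perm_on B s -> w (mperm s m) = w m) ->
  fixed_by prep B f -> fixed_by prep B (mweight w f).
Proof.
move=> hw hf s sB; apply/mpolyP => m.
by rewrite mcoeff_act !mcoeff_weight hw // -mcoeff_act hf.
Qed.

Lemma fixed_byM B (f g : P) :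
  fixed_by prep B f -> fixed_by prep B g -> fixed_by prep B (f * g).
Proof. by move=> hf hg s sB; rewrite prepM hf // hg. Qed.

Lemma fixed_bicomp B d (f : P) : fixed_by prep B f -> fixed_by prep B (bicomp d f).
Proof. by apply: fixed_by_weight => s m _; rewrite bideg_perm. Qed.

Definition average B (f : P) : P :=
  #|@perm_on 'I_n B|%:R^-1 *: \sum_(s : 'S_n | perm_on B s) prep s f.

Lemma card_perm_on B : #|@perm_on 'I_n B|%:R != 0 :> C.
Proof.
rewrite pnatr_eq0 -lt0n; apply/card_gt0P; exists 1%g; exact: perm_on1.
Qed.

Lemma average_fixed B f : fixed_by prep B (average B f).
Proof.
move=> s sB; rewrite rhoZ rho_sum; congr (_ *: _).
rewrite [RHS](reindex_inj (mulIg s)) /=; apply: eq_big => [t|t _]; last first.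
  by rewrite linrepM.
apply/idP/idP => [h|h]; first exact: perm_onM.
by rewrite -(mulgK s t); apply: perm_onM => //; apply: perm_onV.
Qed.

Lemma average_id B f : fixed_by prep B f -> average B f = f.
Proof.
move=> hf; rewrite /average (eq_bigr (fun=> f)) => [|s]; last exact: hf.
by rewrite sumr_const -scaler_nat scalerA mulVf ?scale1r // card_perm_on.
Qed.

Lemma average_mul_inv B (g h : P) : (forall s, prep s h = h) ->
  average B (g * h) = average B g * h.
Proof.
move=> hh; rewrite /average -scalerAl mulr_suml; congr (_ *: _).
by apply: eq_bigr => s _; rewrite prepM hh.
Qed.

Lemma average_sum B (I : Type) (r : seq I) (F : I -> P) :
  average B (\sum_(k <- r) F k) = \sum_(k <- r) average B (F k).
Proof.
rewrite /average (eq_bigr (fun s => \sum_(k <- r) prep s (F k))) => [|s _].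
  by rewrite exchange_big scaler_sumr.
exact: rho_sum.
Qed.

End Ideal.

Section Restriction.
Variables (C : numClosedFieldType) (n : nat).
Local Notation P := {mpoly C[n + n]}.
Local Notation P' := {mpoly C[n.+1 + n.+1]}.
Local Notation prep := (poly_rep C n).
Local Notation prep' := (poly_rep C n.+1).
Local Notation lp s := (lift_perm ord0 ord0 s).
Implicit Types (f g : P) (F G : P') (m : 'X_{1..n + n}) (B : {set 'I_n}).

Definition mext m : 'X_{1..n.+1 + n.+1} :=
  mnm_of (fun k => if unlift ord0 k is Some l then mcol m l else (0, 0)%N).
Definition mres (m : 'X_{1..n.+1 + n.+1}) : 'X_{1..n + n} :=
  mnm_of (fun k => mcol m (lift ord0 k)).

Lemma mcol_mext0 m : mcol (mext m) ord0 = (0, 0)%N.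
Proof. by rewrite mcolK unlift_none. Qed.

Lemma mcol_mext m k : mcol (mext m) (lift ord0 k) = mcol m k.
Proof. by rewrite mcolK liftK. Qed.

Lemma mextK : cancel mext mres.
Proof. by move=> m; apply: mcolP => k; rewrite mcolK mcol_mext. Qed.

Lemma mresK (m : 'X_{1..n.+1 + n.+1}) : mcol m ord0 = (0, 0)%N -> mext (mres m) = m.
Proof.
move=> m0; apply: mcolP => k; case: (unliftP ord0 k) => [l|] ->.
  by rewrite mcol_mext mcolK.
by rewrite mcol_mext0 m0.
Qed.

Lemma eq_mext (m' : 'X_{1..n.+1 + n.+1}) m :
  (m' == mext m) = (mcol m' ord0 == (0, 0)%N) && (mres m' == m).
Proof.
apply/eqP/andP => [->|[/eqP m0 /eqP <-]]; first by rewrite mcol_mext0 mextK !eqxx.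
by rewrite mresK.
Qed.

Lemma mperm_mext s m : mperm (lp s) (mext m) = mext (mperm s m).
Proof.
apply: mcolP => k; rewrite mcol_mperm; case: (unliftP ord0 k) => [l|] ->.
  by rewrite lift_perm_lift !mcol_mext mcol_mperm.
by rewrite lift_perm_id !mcol_mext0.
Qed.

Lemma bideg_mext m : bideg (mext m) = bideg m.
Proof.
have h (F : nat * nat -> nat) : F (0, 0)%N = 0%N ->
    (\sum_k F (mcol (mext m) k) = \sum_k F (mcol m k))%N.
  move=> F0; rewrite big_ord_recl mcol_mext0 F0 add0n.
  by apply: eq_bigr => k _; rewrite mcol_mext.
by rewrite /bideg (h fst) // (h snd).
Qed.

Definition restr_var (v : 'I_(n.+1 + n.+1)) : P :=
  match split v with
  | inl k => if unlift ord0 k is Some l then 'X_(lshift n l) else 0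
  | inr k => if unlift ord0 k is Some l then 'X_(rshift n l) else 0
  end.

(* Sets the variables x_0 and y_0 to 0. *)
Definition restr F : P := F \mPo [tuple restr_var v | v < n.+1 + n.+1].

Lemma restrX (m : 'X_{1..n.+1 + n.+1}) :
  restr 'X_[m] = if mcol m ord0 == (0, 0)%N then 'X_[mres m] else 0.
Proof.
rewrite /restr comp_mpolyX big_split_ord !big_ord_recl /=.
rewrite !tnth_mktuple /restr_var !(unsplitK (inl _)) !(unsplitK (inr _)) unlift_none.
rewrite !expr0n xpair_eqE.
case: (m (lshift n.+1 ord0) == 0%N); last by rewrite !mul0r.
case: (m (rshift n.+1 ord0) == 0%N); last by rewrite !mul0r mulr0.
rewrite !mul1r [RHS]mpolyXE_id big_split_ord /=; congr (_ * _); apply: eq_bigr => k _.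
  rewrite tnth_mktuple (unsplitK (inl _)) liftK.
  by have := mcolK (fun k => mcol m (lift ord0 k)) k => -[-> _].
rewrite tnth_mktuple (unsplitK (inr _)) liftK.
by have := mcolK (fun k => mcol m (lift ord0 k)) k => -[_ ->].
Qed.

Lemma mcoeff_restr F m : (restr F)@_m = F@_(mext m).
Proof.
pose L F := (restr F)@_m : C^o; pose R F := F@_(mext m) : C^o.
have lL : linear L by move=> a f g; rewrite /L /restr linearP mcoeffD mcoeffZ.
have lR : linear R by move=> a f g; rewrite /R mcoeffD mcoeffZ.
apply: (mpoly_linear_ext lL lR) => m'; rewrite /L /R restrX mcoeffX eq_mext.
by case: ifP => _; rewrite ?mcoeff0 // mcoeffX.
Qed.

Lemma restrP a F G : restr (a *: F + G) = a *: restr F + restr G.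
Proof. exact: linearP. Qed.

Lemma restrM F G : restr (F * G) = restr F * restr G.
Proof. exact: rmorphM. Qed.

Lemma restr_act s F : restr (prep' (lp s) F) = prep s (restr F).
Proof.
by apply/mpolyP => m; rewrite mcoeff_act !mcoeff_restr mcoeff_act mperm_mext.
Qed.

Lemma restr_bihomogeneous i j F : bihomogeneous i j F -> bihomogeneous i j (restr F).
Proof.
move=> /bihomogeneousP h; apply/bihomogeneousP => m.
by rewrite mcoeff_restr => /h; rewrite bideg_mext.
Qed.

Lemma restr_bicomp d F : restr (bicomp d F) = bicomp d (restr F).
Proof.
by apply/mpolyP => m; rewrite mcoeff_restr !mcoeff_weight mcoeff_restr bideg_mext.
Qed.

(** In reading order the first row carries the smallest numbers; a new box is therefore numbered 0
    and all other numbers shift by one. *)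
Definition extset B : {set 'I_n.+1} := ord0 |: lift ord0 @: B.

Lemma lift_perm_onE B s :
  perm_on (lift ord0 @: B) (lp s) = perm_on B s.
Proof.
apply/idP/idP => /subsetP h; apply/subsetP => k; rewrite inE => ne.
  rewrite -(mem_imset _ _ (@lift_inj _ ord0)); apply: h.
  by rewrite inE lift_perm_lift (inj_eq lift_inj).
case: (unliftP ord0 k) ne => [l|] ->; last by rewrite lift_perm_id eqxx.
rewrite lift_perm_lift (inj_eq lift_inj) => ne.
by rewrite (mem_imset _ _ (@lift_inj _ ord0)); apply: h.
Qed.

Lemma lift_permP (s : 'S_n.+1) : s ord0 = ord0 -> exists t, s = lp t.
Proof.
move=> s0; have /choice[t tE] k : exists l, s (lift ord0 k) = lift ord0 l.
  case: (unliftP ord0 (s (lift ord0 k))) => [l ->|e]; first by exists l.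
  by have := perm_inj (etrans e (esym s0)) => /eqP; rewrite eq_sym (negPf (neq_lift _ _)).
have tinj : injective t.
  by move=> k l tkl; apply: (@lift_inj _ ord0); apply: (@perm_inj _ s); rewrite !tE tkl.
exists (perm tinj); apply/permP => k; case: (unliftP ord0 k) => [l|] ->.
  by rewrite lift_perm_lift tE permE.
by rewrite lift_perm_id s0.
Qed.

Lemma restr_fixed B F : fixed_by prep' (extset B) F -> fixed_by prep B (restr F).
Proof.
move=> hF s sB; rewrite -restr_act hF //.
by apply: subset_trans (subsetU1 _ _); rewrite -lift_perm_onE in sB.
Qed.

(** By the degree bound, a monomial of F has an empty column y in [extset B]. Exchanging 0 and y,
    under which F is invariant, turns its coefficient into a coefficient of [restr F]. *)
Lemma restr_inj B F : (forall m : 'X_{1..n.+1 + n.+1}, F@_m != 0 -> (mdeg m < #|extset B|)%N) ->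
  fixed_by prep' (extset B) F -> restr F = 0 -> F = 0.
Proof.
move=> degF hF F0; apply/mpolyP => m; rewrite mcoeff0.
apply: contrapT => /eqP Fm.
have [y yB my] : exists2 y, y \in extset B & mcol m y = (0, 0)%N.
  apply: contrapT => h; have := degF _ Fm; rewrite ltnNge => /negP; apply.
  rewrite mdeg_bideg -big_split -sum1_card [X in (_ <= X)%N](bigID (mem (extset B))).
  apply: leq_trans (leq_addr _ _); apply: leq_sum => k kB.
  rewrite lt0n addn_eq0; apply/negP => /andP[/eqP h1 /eqP h2]; apply: h; exists k => //.
  by rewrite [LHS]surjective_pairing h1 h2.
have t0 : perm_on (extset B) (tperm ord0 y).
  by apply: subset_trans (tperm_on _ _) _; rewrite subUset !sub1set yB setU11.
case/eqP: Fm; rewrite -(hF _ t0) mcoeff_act.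
have -> : mperm (tperm ord0 y) m = mext (mres (mperm (tperm ord0 y) m)).
  by rewrite mresK // mcol_mperm tpermL.
by rewrite -mcoeff_restr F0 mcoeff0.
Qed.

End Restriction.

(** * Lifting along the restriction *)

Section Lifting.
Variables (C : numClosedFieldType) (n : nat).
Local Notation P := {mpoly C[n + n]}.
Local Notation P' := {mpoly C[n.+1 + n.+1]}.
Local Notation prep := (poly_rep C n).
Local Notation prep' := (poly_rep C n.+1).
Local Notation lp s := (lift_perm ord0 ord0 s).
Implicit Types (f g : P) (F G : P') (m : 'X_{1..n + n}) (B : {set 'I_n}).

Lemma mext0 : mext (0%MM : 'X_{1..n + n}) = 0%MM.
Proof.
apply: mcolP => k; rewrite mcolK mcol0.
by case: unliftP => [l|] _; rewrite ?mcol0.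
Qed.

Lemma restrB F G : restr (F - G) = restr F - restr G.
Proof. exact: linearB. Qed.

Lemma restrD F G : restr (F + G) = restr F + restr G.
Proof. exact: linearD. Qed.

Lemma restrZ a F : restr (a *: F) = a *: restr F.
Proof. exact: linearZ. Qed.

Lemma restr_sum (I : Type) (r : seq I) (Q : pred I) (F : I -> P') :
  restr (\sum_(k <- r | Q k) F k) = \sum_(k <- r | Q k) restr (F k).
Proof. exact: linear_sum. Qed.

Definition embed f : P' := \sum_(m <- msupp f) f@_m *: 'X_[mext m].

Lemma mcoeff_embed f (m' : 'X_{1..n.+1 + n.+1}) :
  (embed f)@_m' = if mcol m' ord0 == (0, 0)%N then f@_(mres m') else 0.
Proof.
rewrite /embed raddf_sum /=; case: ifP => m0; last first.
  by rewrite big1 // => m _; rewrite mcoeffZ mcoeffX eq_sym eq_mext m0 mulr0.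
rewrite [RHS](congr1 (mcoeff (mres m')) (mpolyE f)) raddf_sum /=.
apply: eq_bigr => m _; rewrite !mcoeffZ !mcoeffX eq_sym eq_mext m0 /=.
by rewrite [mres m' == m]eq_sym.
Qed.

Lemma embed_fixed B f : fixed_by prep B f -> fixed_by prep' (lift ord0 @: B) (embed f).
Proof.
move=> hf s sB; have s0 : s ord0 = ord0.
  by apply: (out_perm sB); apply/imsetP => -[k _ /eqP]; rewrite (negPf (neq_lift _ _)).
have [t tE] := lift_permP s0; rewrite {s0}tE lift_perm_onE in sB *.
apply/mpolyP => m'; rewrite mcoeff_act !mcoeff_embed mcol_mperm lift_perm_id.
case: ifP => // _; rewrite -[in RHS](hf t sB) mcoeff_act; congr (_@__).
by apply: mcolP => k; rewrite mcolK !mcol_mperm mcolK lift_perm_lift.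
Qed.

(* The symmetrization of the extension of f by zero restricts to f with its
   coefficient at m multiplied by 1 + free_count B m. *)
Lemma restr_surj B f : fixed_by prep B f ->
  exists2 F, fixed_by prep' (extset B) F & restr F = f.
Proof.
move=> hf; pose w m : C := (free_count B m).+1%:R^-1.
have fw : fixed_by prep B (mweight w f).
  by apply: fixed_by_weight hf => s m sB; rewrite /w free_count_perm.
exists (coset_sum prep' (lift ord0 @: B) ord0 (embed (mweight w f))).
  exact/coset_sum_fixed/embed_fixed.
apply/mpolyP => m; rewrite mcoeff_restr raddf_sum /=.
(* The exchange of 0 and y keeps column 0 empty only if column y of the extended monomial is empty;
   y = 0 always qualifies, whence the successor in the weight. *)
have fm (y : 'I_n.+1) : (prep' (tperm ord0 y) (embed (mweight w f)))@_(mext m) =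
    if mcol (mext m) y == (0, 0)%N then w m * f@_m else 0.
  rewrite mcoeff_act mcoeff_embed mcol_mperm tpermL; case: ifP => // /eqP y0.
  rewrite mcoeff_weight; suff -> : mres (mperm (tperm ord0 y) (mext m)) = m by [].
  rewrite -[RHS]mextK; congr mres; apply: mcolP => k; rewrite mcol_mperm.
  by case: tpermP => [->|->|//]; rewrite ?y0 mcol_mext0.
rewrite (eq_bigr _ (fun y _ => fm y)) big_setU1 /=; last first.
  by apply/imsetP => -[k _ /eqP]; rewrite (negPf (neq_lift _ _)).
rewrite mcol_mext0 eqxx big_imset /=; last by move=> x y _ _; apply: lift_inj.
under eq_bigr => k _ do rewrite mcol_mext.
rewrite -big_mkcondr sumr_const /=.
have -> : #|[pred k | k \in B & mcol m k == (0, 0)%N]| = free_count B m.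
  by apply: eq_card => k; rewrite !inE.
by rewrite -mulrS -mulr_natl mulrA mulfV ?mul1r // pnatr_eq0.
Qed.

Lemma extset_setU1 k B : extset (k |: B) = lift ord0 k |: extset B.
Proof. by rewrite /extset imsetU1 setUCA. Qed.

Lemma restr_inv (H : P') : invariant_no_const H -> invariant_no_const (restr H).
Proof.
move=> [Hinv H0]; split=> [s|].
  by apply: etrans (esym (restr_act s H)) _; congr restr; apply: Hinv.
by rewrite mcoeff_restr mext0.
Qed.

Lemma restr_ideal F : in_inv_ideal F -> in_inv_ideal (restr F).
Proof.
move=> [r [g [h [hh ->]]]].
exists r, (fun k => restr (g k)), (fun k => restr (h k)); split=> [k|].
  exact: restr_inv.
by rewrite restr_sum; apply: eq_bigr => k _; rewrite restrM.
Qed.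

Lemma inv_lift h : invariant_no_const h ->
  exists2 H : P', invariant_no_const H & restr H = h.
Proof.
move=> [hinv h0].
have [|H HT HE] := @restr_surj [set: 'I_n] h; first by move=> s _; apply: hinv.
exists H => //; split=> [s|].
  apply: HT; apply/subsetP => k _; rewrite in_setU1.
  by case: (unliftP ord0 k) => [l|] ->; rewrite ?eqxx // imset_f ?orbT // in_setT.
by rewrite -mext0 -mcoeff_restr HE.
Qed.

Lemma bihomogeneous_lift i j B f : bihomogeneous i j f -> fixed_by prep B f ->
  exists F, [/\ bihomogeneous i j F, fixed_by prep' (extset B) F & restr F = f].
Proof.
move=> bf /restr_surj[F fF FE]; exists (bicomp (i, j) F); split.
- exact: bihomogeneous_bicomp.
- exact: fixed_bicomp.
- by rewrite restr_bicomp FE bicomp_id.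
Qed.

(** The generators lift as full invariants. The cofactors need not be fixed by Sym B, but averaging
    f leaves it unchanged and averages only the cofactors, which can then be lifted. *)
Lemma ideal_comp_lift i j B f : ideal_comp i j f -> fixed_by prep B f ->
  exists F, [/\ ideal_comp i j F, fixed_by prep' (extset B) F & restr F = f].
Proof.
move=> [[r [g [h [hh fE]]]] bf] ff.
have /choice[G GE] k : exists G, fixed_by prep' (extset B) G /\ restr G = average B (g k).
  by have [G GB GE] := restr_surj (@average_fixed C n B (g k)); exists G.
have /choice[H HE] k : exists H : P', invariant_no_const H /\ restr H = h k.
  by have [H hH HE] := inv_lift (hh k); exists H.
exists (bicomp (i, j) (\sum_k G k * H k)); split.
- split; last exact: bihomogeneous_bicomp.
  by apply: ideal_bicomp; exists r, G, H; split=> // k; case: (HE k).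
- apply: fixed_bicomp; apply: subspace_sum (fixed_by_subspace prep' _) _ => k _.
  apply: fixed_byM; first by case: (GE k).
  by move=> s _; case: (HE k) => -[hinv _] _; apply: hinv.
rewrite restr_bicomp restr_sum -[RHS](bicomp_id bf); congr bicomp.
rewrite -[RHS](average_id ff) fE average_sum; apply: eq_bigr => k _.
rewrite average_mul_inv => [|s]; last by case: (hh k) => hinv _; apply: hinv.
by rewrite restrM (proj2 (GE k)) (proj2 (HE k)).
Qed.

End Lifting.

(** * Comparison of fixed and decomposable spaces for n and n + 1 *)

Section Stability.
Variables (C : numClosedFieldType) (i j : nat).

Section Spaces.
Variable n : nat.
Local Notation P := {mpoly C[n + n]}.
Local Notation prep := (poly_rep C n).
Variable B : {set 'I_n}.

Definition fixed_comp (f : P) := bihomogeneous i j f /\ fixed_by prep B f.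

(* The orthogonal complement in [fixed_comp] of the primitive harmonics. *)
Definition decomposable (f : P) := exists (z : 'I_n -> P) (u : P),
  [/\ forall k, k \notin B -> bihomogeneous i j (z k) /\ fixed_by prep (k |: B) (z k),
      ideal_comp i j u /\ fixed_by prep B u & f = \sum_(k | k \notin B) z k + u].

Lemma fixed_comp_subspace : subspace fixed_comp.
Proof.
have [b0 bD] := bihomogeneous_subspace C n i j.
have [f0 fD] := fixed_by_subspace prep B.
by split=> [//|a u v [bu fu] [bv fv]]; split; [apply: bD | apply: fD].
Qed.

Lemma decomposable_fixed f : decomposable f -> fixed_comp f.
Proof.
move=> [z [u [hz [[_ bu] fu] ->]]]; have s := fixed_comp_subspace.
apply: subspaceD => //; apply: subspace_sum => // k /hz[bz fz].
by split=> //; apply: fixed_by_subset fz; apply: subsetU1.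
Qed.

Lemma decomposable_subspace : subspace decomposable.
Proof.
have [b0 bD] := bihomogeneous_subspace C n i j.
have [I0 ID] := ideal_comp_subspace C n i j.
split=> [|a _ _ [z [u [hz [bu fu] ->]]] [z' [u' [hz' [bu' fu'] ->]]]].
  exists (fun=> 0), 0; split=> [k _|//|].
  - by split=> //; case: (fixed_by_subspace prep (k |: B)).
  - by split=> //; case: (fixed_by_subspace prep B).
  - by rewrite big1 // addr0.
exists (fun k => a *: z k + z' k), (a *: u + u'); split=> [k kB|//|].
- have [bz fz] := hz k kB; have [bz' fz'] := hz' k kB.
  by split; [apply: bD | case: (fixed_by_subspace prep (k |: B)) => _; apply].
- by split; [apply: ID | case: (fixed_by_subspace prep B) => _; apply].
by rewrite scalerDr scaler_sumr big_split addrACA.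
Qed.

End Spaces.

Variable n : nat.
Local Notation P := {mpoly C[n + n]}.
Local Notation P' := {mpoly C[n.+1 + n.+1]}.
Local Notation prep := (poly_rep C n).
Local Notation prep' := (poly_rep C n.+1).
Local Notation lp s := (lift_perm ord0 ord0 s).
Variables (B : {set 'I_n}) (row col : 'I_n -> nat) (row' col' : 'I_n.+1 -> nat).
Hypotheses (rowE : forall e, e \notin B -> row' (lift ord0 e) = row e)
  (colE : forall e, e \notin B -> col' (lift ord0 e) = col e)
  (large : (i + j < #|extset B|)%N).

Lemma restr_fixed_comp F : fixed_comp (extset B) F -> fixed_comp B (restr F).
Proof. by move=> [bF fF]; split; [apply: restr_bihomogeneous | apply: restr_fixed]. Qed.

Lemma fixed_comp_lift f : fixed_comp B f -> exists2 F, fixed_comp (extset B) F & restr F = f.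
Proof.
by move=> [bf ff]; have [F [bF fF FE]] := bihomogeneous_lift bf ff; exists F.
Qed.

Lemma restr_fixed_inj F G : fixed_comp (extset B) F -> fixed_comp (extset B) G ->
  restr F = restr G -> F = G.
Proof.
move=> hF hG FG; apply/eqP; rewrite -subr_eq0; apply/eqP.
have [/bihomogeneousP b f] : fixed_comp (extset B) (F - G).
  exact: subspaceB (fixed_comp_subspace _) hF hG.
apply: restr_inj f _ => [m /b hm|]; first by rewrite mdeg_bideg hm.
by rewrite restrB FG subrr.
Qed.

Lemma restr_decomposable F : decomposable (extset B) F -> decomposable B (restr F).
Proof.
move=> [z [u [hz [[Iu bu] fu] ->]]].
exists (fun k => restr (z (lift ord0 k))), (restr u); split=> [k kB||].
- have [|bz fz] := hz (lift ord0 k).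
    by rewrite in_setU1 eq_sym (negPf (neq_lift _ _)) (mem_imset _ _ lift_inj).
  by rewrite -extset_setU1 in fz; split; [apply: restr_bihomogeneous | apply: restr_fixed].
- by split; [split; [apply: restr_ideal | apply: restr_bihomogeneous] | apply: restr_fixed].
rewrite restrD restr_sum big_mkcond big_ord_recl /= in_setU1 eqxx add0r.
congr (_ + _); rewrite [RHS]big_mkcond; apply: eq_bigr => k _.
by rewrite in_setU1 eq_sym (negPf (neq_lift _ _)) (mem_imset _ _ lift_inj).
Qed.

Lemma decomposable_lift f : decomposable B f ->
  exists2 F, decomposable (extset B) F & restr F = f.
Proof.
move=> [z [u [hz [Iu fu] ->]]]; have [U [IU fU UE]] := ideal_comp_lift Iu fu.
have /choice[Z ZE] k : exists Z, k \notin B ->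
    [/\ bihomogeneous i j Z, fixed_by prep' (lift ord0 k |: extset B) Z & restr Z = z k].
  have [kB|kB] := boolP (k \in B); first by exists 0.
  have [bz fz] := hz k kB; have [Z] := bihomogeneous_lift bz fz.
  by rewrite extset_setU1 => hZ; exists Z.
pose Z' (k : 'I_n.+1) := if unlift ord0 k is Some l then Z l else 0.
exists (\sum_(k | k \notin extset B) Z' k + U).
  exists Z', U; split=> // k; rewrite /Z'; case: (unliftP ord0 k) => [l|] ->.
    rewrite in_setU1 eq_sym (negPf (neq_lift _ _)) (mem_imset _ _ lift_inj) => /ZE[bZ fZ _].
    by [].
  by rewrite setU11.
rewrite restrD restr_sum UE; congr (_ + _).
rewrite big_mkcond big_ord_recl /= in_setU1 eqxx add0r [RHS]big_mkcond.
apply: eq_bigr => k _; rewrite in_setU1 eq_sym (negPf (neq_lift _ _)) (mem_imset _ _ lift_inj).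
by case: ifP => // /ZE[_ _ <-]; rewrite /Z' liftK.
Qed.

(** Fixing [extset B] pointwise includes fixing index 0, so these permutations come from n letters;
    labels matter only outside B. *)
Lemma fix_stab_ext (f : 'I_n -> nat) (f' : 'I_n.+1 -> nat) :
  (forall e, e \notin B -> f' (lift ord0 e) = f e) ->
  fix_stab (extset B) f' = (fun s => lp s) @: fix_stab B f.
Proof.
move=> fE; apply/setP => s; apply/fix_stabP/imsetP => [[sB sf]|[t /fix_stabP[tB tf] ->]].
  have s0 : s ord0 = ord0 by rewrite (out_perm sB) // !inE eqxx.
  have [t tE] := lift_permP s0; exists t => //; move: sB sf; rewrite tE {s0 tE} => tB tf.
  have tB' : perm_on (~: B) t.
    apply/subsetP => k; rewrite !inE; apply: contraNN => kB.
    rewrite -(inj_eq (@lift_inj _ ord0)) -(lift_perm_lift ord0 ord0) (out_perm tB) //.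
    by rewrite !inE (mem_imset _ _ lift_inj) kB orbT.
  apply/fix_stabP; split=> // e; have [eB|eB] := boolP (e \in B).
    by rewrite (out_perm tB') // inE eB.
  rewrite -!fE // -?(lift_perm_lift ord0 ord0) //.
  by have := perm_closed e tB'; rewrite !inE eB => ->.
have outB e : e \in B -> t e = e by move=> eB; rewrite (out_perm tB) // inE eB.
split.
  apply/subsetP => k; rewrite !inE; apply: contraNN => /orP[/eqP ->|/imsetP[l lB ->]].
    by rewrite lift_perm_id.
  by rewrite lift_perm_lift outB.
move=> k; case: (unliftP ord0 k) => [l|] ->; last by rewrite lift_perm_id.
rewrite lift_perm_lift; have [lB|lB] := boolP (l \in B); first by rewrite outB.
by rewrite !fE // ?tf //; have := perm_closed l tB; rewrite !inE lB => ->.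
Qed.

Lemma lift_perm_inj : injective (fun s : 'S_n => lp s).
Proof.
move=> s t /permP st; apply/permP => k; apply: (@lift_inj _ ord0).
by rewrite -!(lift_perm_lift ord0 ord0) st.
Qed.

Lemma restr_young F :
  restr (young (extset B) row' col' prep' F) = young B row col prep (restr F).
Proof.
rewrite /young /row_sum (fix_stab_ext rowE) (fix_stab_ext colE) restr_sum.
rewrite big_imset /=; last by move=> s t _ _; apply: lift_perm_inj.
apply: eq_bigr => s _; rewrite restrZ odd_lift_perm addbb; congr (_ *: _).
rewrite restr_act; congr (prep s _).
rewrite restr_sum big_imset /=; last by move=> t u _ _; apply: lift_perm_inj.
by apply: eq_bigr => t _; rewrite restr_act.
Qed.

(** Restriction commutes with the Young operator and is injective on [fixed_comp], so it identifies
    the two images once it maps [X'] onto X. *)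
Lemma has_dim_young_restr (X' : P' -> Prop) (X : P -> Prop) d :
  (forall F, X' F -> fixed_comp (extset B) F) ->
  (forall F, X' F -> X (restr F)) -> (forall f, X f -> exists2 F, X' F & restr F = f) ->
  (forall F, X' F -> fixed_comp (extset B) (young (extset B) row' col' prep' F)) ->
  has_dim (fun y => exists2 F, X' F & y = young (extset B) row' col' prep' F) d ->
  has_dim (fun y => exists2 f, X f & y = young B row col prep f) d.
Proof.
move=> X'fix X'X lift yfix hd.
apply: has_dim_ext (has_dim_image hd _ _) => [y||F G [F1 /yfix h1 ->] [G1 /yfix h2 ->]].
- split=> [[_ [F XF ->] ->]|[f /lift[F XF <-] ->]].
    by exists (restr F); [apply: X'X | apply: restr_young].
  exists (young (extset B) row' col' prep' F); last by rewrite restr_young.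
  by exists F.
- by move=> a u v _ _; apply: restrP.
- exact: restr_fixed_inj.
Qed.

End Stability.

(** * Harmonics as an orthogonal complement *)

Section PolynomialForm.
Variables (C : numClosedFieldType) (N : nat).
Local Notation P := {mpoly C[N]}.
Implicit Types (f g : P) (m : 'X_{1..N}).

Definition mfact m : nat := \prod_(v < N) (m v)`!.

(* <f, g> is the constant term of f(d/dx, d/dy) applied to the conjugate of g. *)
Definition mform f g : C := \sum_(m <- msupp f) (mfact m)%:R * f@_m * (g@_m)^*.

Lemma big_msupp f (r : seq 'X_{1..N}) (F : 'X_{1..N} -> C) :
  uniq r -> {subset msupp f <= r} -> (forall m, m \notin msupp f -> F m = 0) ->
  \sum_(m <- msupp f) F m = \sum_(m <- r) F m.
Proof.
move=> ur sr F0; rewrite [RHS](bigID (mem (msupp f))) /= [X in _ + X]big1 // addr0.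
rewrite -[RHS]big_filter; apply: perm_big; apply: uniq_perm => [||m].
- exact: msupp_uniq.
- exact: filter_uniq.
- by rewrite mem_filter; case: (boolP (m \in msupp f)) => // /sr ->.
Qed.

Lemma mformE f g (r : seq 'X_{1..N}) : uniq r -> {subset msupp f <= r} ->
  mform f g = \sum_(m <- r) (mfact m)%:R * f@_m * (g@_m)^*.
Proof.
move=> ur sr; apply: big_msupp => // m /memN_msupp_eq0 ->.
by rewrite mulr0 mul0r.
Qed.

Lemma mform_hermitian : hermitian mform.
Proof.
split=> [a f g h|f g|f|f].
- pose r := undup (msupp (a *: f + g) ++ msupp f ++ msupp g).
  have sub : {subset msupp (a *: f + g) <= r} /\
             {subset msupp f <= r} /\ {subset msupp g <= r}.
    by split; [|split] => m hm; rewrite mem_undup !mem_cat hm ?orbT.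
  case: sub => s1 [s2 s3].
  rewrite !(@mformE _ _ r) ?undup_uniq // mulr_sumr -big_split; apply: eq_bigr => m _ /=.
  by rewrite mcoeffD mcoeffZ mulrDr mulrDl !mulrA [a * _]mulrC.
- pose r := undup (msupp f ++ msupp g).
  have s1 : {subset msupp f <= r} by move=> m hm; rewrite mem_undup mem_cat hm.
  have s2 : {subset msupp g <= r} by move=> m hm; rewrite mem_undup mem_cat hm orbT.
  rewrite !(@mformE _ _ r) ?undup_uniq // rmorph_sum; apply: eq_bigr => m _ /=.
  by rewrite !rmorphM /= conjCK conjC_nat -!mulrA; congr (_ * _); rewrite mulrC.
- apply: sumr_ge0 => m _; rewrite -mulrA mulr_ge0 ?ler0n //.
  exact: mul_conjC_ge0.
- move=> /eqP; rewrite psumr_eq0 => [/allP h|m _]; last first.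
    by rewrite -mulrA mulr_ge0 ?ler0n // mul_conjC_ge0.
  apply/mpolyP => m; rewrite mcoeff0; apply/eqP; rewrite mcoeff_eq0; apply/negP => mf.
  have := h m mf; rewrite /= -mulrA mulf_eq0 mul_conjC_eq0 mcoeff_eq0 mf orbF.
  by rewrite pnatr_eq0 -leqn0 leqNgt prodn_gt0 // => v; apply: fact_gt0.
Qed.

Lemma mfactS m v : mfact (U_(v) + m)%MM = ((m v).+1 * mfact m)%N.
Proof.
rewrite /mfact (bigD1 v) // [in RHS](bigD1 v) //= mulnA mnmDE mnm1E eqxx add1n factS.
congr (_ * _)%N; apply: eq_bigr => k ne.
by rewrite mnmDE mnm1E eq_sym (negPf ne) add0n.
Qed.

(** The factorial weights of the form serve this adjunction: raising the exponent of v multiplies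
    the weight by the factor that differentiation produces. *)
Lemma mform_mulX v f g : mform ('X_v * f) g = mform f (mderiv v g).
Proof.
rewrite mulrC /mform (perm_big _ (msuppMX f U_(v))) big_map.
apply: eq_bigr => m _; rewrite mcoeffMX mcoeff_deriv mfactS natrM rmorphMn /=.
by rewrite [(m + _)%MM]addmC [RHS]mulrnAr -!mulrA mulr_natl.
Qed.

Lemma mform_mulXn v a f g : mform ('X_v ^+ a * f) g = mform f (iter a (mderiv v) g).
Proof.
elim: a f g => [|a IH] f g; first by rewrite mul1r.
by rewrite exprSr -mulrA IH mform_mulX.
Qed.

End PolynomialForm.

Section Harmonics.
Variables (C : numClosedFieldType) (n : nat).
Local Notation P := {mpoly C[n + n]}.
Local Notation prep := (poly_rep C n).
Implicit Types (f g h : P) (m : 'X_{1..n + n}).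
Let hH : hermitian (@mform C (n + n)) := mform_hermitian C (n + n).

Lemma mfact_perm (s : 'S_n) m : mfact (mperm s m) = mfact m.
Proof.
rewrite /mfact !big_split_ord /= [in RHS](reindex_inj (@perm_inj _ s)).
rewrite [X in _ = (_ * X)%N](reindex_inj (@perm_inj _ s)) /=.
by congr (_ * _)%N; apply: eq_bigr => k _; case: (mcol_mperm s m k) => h1 h2; rewrite ?h1 ?h2.
Qed.

Lemma mform_inv (s : 'S_n) f g : mform (prep s f) (prep s g) = mform f g.
Proof.
rewrite (@mformE _ _ _ _ [seq mperm s^-1%g m | m <- msupp f]).
- rewrite big_map; apply: eq_bigr => m _.
  by rewrite !mcoeff_act mpermKV mfact_perm.
- by rewrite map_inj_uniq ?msupp_uniq //; apply: can_inj (mpermKV s).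
move=> m; rewrite mcoeff_msupp mcoeff_act -mcoeff_msupp => mf.
by apply/mapP; exists (mperm s m); rewrite ?mpermK.
Qed.

Lemma mform_bicomp i j f g : bihomogeneous i j g ->
  mform (bicomp (i, j) f) g = mform f g.
Proof.
move=> /bihomogeneousP hg; rewrite (@mformE _ _ _ _ (msupp f)) ?msupp_uniq //.
  rewrite /mform; apply: eq_bigr => m _; rewrite mcoeff_weight.
  have [->|/hg ->] := eqVneq g@_m 0; first by rewrite conjC0 !mulr0.
  by rewrite eqxx mul1r.
move=> m; rewrite !mcoeff_msupp mcoeff_weight mulf_eq0 negb_or => /andP[_].
by [].
Qed.

(** The polarized power sums. The y-factor stands first so that the adjunction yields the
    derivatives in the order used in [harmonic]. *)
Definition power_sum a b : P :=
  \sum_(k < n) 'X_(rshift n k) ^+ b * 'X_(lshift n k) ^+ a.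

Definition mnm_at k (ab : nat * nat) : 'X_{1..n + n} :=
  mnm_of (fun l => if l == k then ab else (0, 0)%N).

Lemma power_sumE a b : power_sum a b = \sum_(k < n) 'X_[mnm_at k (a, b)].
Proof.
apply: eq_bigr => k _; rewrite !mpolyXn -mpolyXD; congr 'X_[_].
apply: mcolP => l; rewrite mcolK mcolD /mcol !mulmnE !mnm1E /=.
rewrite !eq_shift.
by rewrite [l == k]eq_sym; case: (k == l); rewrite /= ?mul1n ?mul0n ?addn0.
Qed.

Lemma mform_power_sum a b g f :
  mform (power_sum a b * g) f =
  mform g (\sum_(k < n) iter a (mderiv (lshift n k)) (iter b (mderiv (rshift n k)) f)).
Proof.
rewrite mulr_suml (herm_suml hH) (herm_sumr hH); apply: eq_bigr => k _.
by rewrite -mulrA mform_mulXn mform_mulXn.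
Qed.

Lemma power_sum_inv a b : (a, b) != (0, 0)%N -> invariant_no_const (power_sum a b).
Proof.
move=> ab; rewrite power_sumE; split=> [s|].
  rewrite -[LHS]/(prep s _) rho_sum [RHS](reindex_inj (@perm_inj _ s)); apply: eq_bigr => k _ /=.
  rewrite prepX; congr 'X_[_]; apply: mcolP => l; rewrite mcol_mperm !mcolK.
  by rewrite -(inj_eq (@perm_inj _ s)) permKV.
rewrite raddf_sum big1 //= => k _; rewrite mcoeffX; case: eqP => // /(congr1 (fun m => mcol m k)).
by rewrite mcolK eqxx mcol0 => e; rewrite e eqxx in ab.
Qed.

Definition symm m : P := \sum_(s : 'S_n) prep s 'X_[m].

Lemma symm_perm t m : symm (mperm t m) = symm m.
Proof.
rewrite /symm [RHS](reindex_inj (mulgI t^-1%g)); apply: eq_bigr => s _ /=.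
by rewrite linrepM (prepX C t^-1%g) invgK.
Qed.

(* Multiplying the orbit sum of m, with its factor in column k removed, by the
   power sum with exponents [mcol m k] gives a positive multiple of the orbit sum
   of m, plus orbit sums of monomials with fewer nonzero columns. *)
Lemma harmonic_symm f m g : harmonic f -> m != 0%MM -> mform (g * symm m) f = 0.
Proof.
move=> hf; move: {2}(n - _)%N (erefl (n - free_count [set: 'I_n] m)%N) => r.
elim: r m g => [|r IH] m g mr mn0.
  case/eqP: mn0; apply: mcolP => k; rewrite mcol0.
  have /eqP : [set k in [set: 'I_n] | mcol m k == (0, 0)%N] == [set: 'I_n].
    by rewrite eqEcard subsetT cardsT card_ord -subn_eq0 mr.
  by move=> /setP/(_ k); rewrite !inE => /eqP.
have [k mk] : exists k, mcol m k != (0, 0)%N.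
  apply: contrapT => h; case/eqP: mn0; apply: mcolP => k; rewrite mcol0.
  by apply: contrapT => /eqP hk; apply: h; exists k.
pose m' := mnm_of (fun l => if l == k then (0, 0)%N else mcol m l).
pose ml l := (mnm_at l (mcol m k) + m')%MM.
have p0 (p : nat * nat) : (p.1 + (0, 0)%N.1, p.2 + (0, 0)%N.2)%N = p.
  by case: p => x y /=; rewrite !addn0.
have zp (p : nat * nat) : ((0, 0)%N.1 + p.1, (0, 0)%N.2 + p.2)%N = p by case: p.
have pD0 (p q : nat * nat) : (p.1 + q.1, p.2 + q.2)%N = (0, 0)%N ->
    p = (0, 0)%N /\ q = (0, 0)%N.
  case: p q => [x y] [z t] /= [] /eqP; rewrite addn_eq0 => /andP[/eqP -> /eqP ->] /eqP.
  by rewrite addn_eq0 => /andP[/eqP -> /eqP ->].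
have mlk l : mcol m' l = (0, 0)%N -> symm (ml l) = symm m.
  move=> m'l; have -> : ml l = mperm (tperm k l) m.
    apply: mcolP => x; rewrite mcol_mperm mcolD !mcolK.
    case: tpermP => [->|->|/eqP xk /eqP xl]; rewrite ?eqxx.
    - have [kl|kl] := eqVneq k l; first by rewrite p0 kl.
      by move: m'l; rewrite zp mcolK eq_sym (negPf kl) => ->.
    - by move: m'l; rewrite mcolK => ->; rewrite p0.
    - by rewrite (negPf xk) (negPf xl) zp.
  exact: symm_perm.
have psum : power_sum (mcol m k).1 (mcol m k).2 * symm m' = \sum_l symm (ml l).
  have [pinv _] := power_sum_inv (a := (mcol m k).1) (b := (mcol m k).2) mk.
  rewrite /symm mulr_sumr [RHS]exchange_big; apply: eq_bigr => s _ /=.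
  rewrite -{1}(pinv s) -[poly_act s _]/(prep s _) -prepM power_sumE mulr_suml rho_sum.
  by apply: eq_bigr => l _; rewrite -mpolyXD -surjective_pairing.
have hp : mform (g * \sum_l symm (ml l)) f = 0.
  rewrite -psum mulrCA mform_power_sum.
  have mk' : ((mcol m k).1, (mcol m k).2) != (0, 0)%N by rewrite -surjective_pairing.
  rewrite (hf _ _ mk').
  exact: herm_orthC hH _ _ (herm0l hH _).
have ml0 l : mcol m' l != (0, 0)%N -> mform (g * symm (ml l)) f = 0.
  move=> m'l; have lk : l != k by apply: contraNneq m'l => ->; rewrite mcolK eqxx.
  apply: IH; last first.
    apply: contraNneq m'l => /(congr1 (fun x => mcol x l)).
    by rewrite mcol0 mcolD => /pD0[_ ->].
  suff fc : free_count [set: 'I_n] (ml l) = (free_count [set: 'I_n] m).+1.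
    by rewrite fc subnS mr.
  rewrite /free_count [RHS](_ : _ = #|k |: [set x in [set: 'I_n] | mcol m x == (0, 0)%N]|).
    apply: eq_card => x; rewrite !inE mcolD !mcolK.
    have kl : (k == l) = false by rewrite eq_sym (negPf lk).
    have [->|xk] := eqVneq x k; first by rewrite kl zp eqxx.
    have [->|xl] := eqVneq x l; last by rewrite zp.
    move: m'l; rewrite mcolK (negPf lk) => h; rewrite (negPf h) ?(negPf lk).
    by apply/negbTE/negP => /eqP/pD0[_ h0]; rewrite h0 eqxx in h.
  by rewrite cardsU1 !inE (negPf mk).
move: hp; rewrite mulr_sumr (herm_suml hH) (bigID (fun l => mcol m' l == (0, 0)%N)) /=.
rewrite [X in _ + X]big1 ?addr0 => [|l]; last exact: ml0.
rewrite (eq_bigr (fun=> mform (g * symm m) f)) => [|l /eqP /mlk -> //].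
rewrite sumr_const -mulr_natl => /eqP; rewrite mulf_eq0 pnatr_eq0 => /orP[|/eqP//].
rewrite -leqn0 leqNgt => /negP[]; apply/card_gt0P; exists k.
have : mcol m' k == (0, 0)%N by rewrite mcolK eqxx.
exact.
Qed.

(** An invariant equals its own average, hence is a combination of orbit sums, and the absence of a
    constant term excludes the monomial 1; [harmonic_symm] then replaces Weyl's theorem on
    generators. *)
Lemma harmonic_ideal f u : harmonic f -> in_inv_ideal u -> mform u f = 0.
Proof.
move=> hf [r [g [h [hh ->]]]]; rewrite (herm_suml hH) big1 // => k _.
have [hinv h0] := hh k.
have hA : fixed_by prep setT (h k) by move=> s _; apply: hinv.
rewrite -(average_id hA) /average -scalerAr (hermZl hH) (_ : \sum_(s | _) _ =
    \sum_(m <- msupp (h k)) (h k)@_m *: symm m); last first.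
  rewrite {1}[h k]mpolyE.
  under eq_bigr => s _ do rewrite rho_sum.
  rewrite [LHS]exchange_big; apply: eq_bigr => m _ /=.
  rewrite /symm scaler_sumr; apply: eq_big => [s|s _]; last exact: rhoZ.
  by apply/subsetP => x; rewrite inE.
suff -> : mform (g k * \sum_(m <- msupp (h k)) (h k)@_m *: symm m) f = 0.
  exact: mulr0.
rewrite mulr_sumr (herm_suml hH) big_seq big1 // => m mh.
rewrite -scalerAr (hermZl hH) harmonic_symm ?mulr0 //.
by apply: contraTneq mh => ->; rewrite mcoeff_msupp h0 eqxx.
Qed.

(** The squared norm of a power-sum derivative g of f is the pairing of f with the power sum times
    g, an element of the ideal; only its component of bidegree (i, j) is seen by f. *)
Lemma orth_harmonic i j f : bihomogeneous i j f ->
  (forall u, ideal_comp i j u -> mform u f = 0) -> harmonic f.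
Proof.
move=> bf hf a b ab; set g := \sum_k _; apply: (herm_eq0 hH).
rewrite {2}/g -mform_power_sum -(mform_bicomp _ bf) hf //.
split; last exact: bihomogeneous_bicomp.
by apply: ideal_bicomp; rewrite mulrC; apply: ideal_inv; apply: power_sum_inv.
Qed.

(** Stability under permutations is read off from the description as the orthogonal complement of a
    stable subspace. *)
Lemma DH_submodule i j : submodule prep (@DH_component C n i j).
Proof.
have [d hd] := bihomogeneous_has_dim C n i j.
have sb := bihomogeneous_subspace C n i j.
have orth f : @DH_component C n i j f <->
    bihomogeneous i j f /\ forall u, ideal_comp i j u -> mform u f = 0.
  split=> [[hf bf]|[bf hf]]; split=> //.
    by move=> u [Iu _]; apply: harmonic_ideal.
  exact: orth_harmonic hf.
split=> [|a f g /orth[bf hf] /orth[bg hg]|s f /orth[bf hf]]; apply/orth; split.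
- by case: sb.
- by move=> u _; apply/(herm_orthC hH)/(herm0l hH).
- by case: sb => _; apply.
- by move=> u Iu; rewrite (hermDr hH) (hermZr hH) hf // hg // mulr0 addr0.
- exact: bihomogeneous_act.
move=> u [Iu bu]; apply: (herm_orthC hH); rewrite (herm_adj mform_inv).
apply: (herm_orthC hH); apply: hf; split; last exact: bihomogeneous_act.
exact: in_inv_ideal_act.
Qed.

Lemma DH_has_dim i j : exists d, has_dim (@DH_component C n i j) d.
Proof.
have [d hd] := bihomogeneous_has_dim C n i j.
by apply: has_dim_sub hd (submodule_subspace (DH_submodule i j)) _ => f [].
Qed.

(** A harmonic polynomial in the ideal is orthogonal to itself, which gives injectivity. Subtracting
    the orthogonal projection onto the ideal in bidegree (i, j) gives a harmonic representative of
    each class. *)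
Lemma DH_DR i j : isomorphic prep (@DH_component C n i j)
  (DR_rep C n) (@DR_component C n i j).
Proof.
have sDH := submodule_subspace (DH_submodule i j).
exists (@DR_proj C n); split=> [a u v _ _|s u _|u [_ bu]|u v hu hv|].
- exact: linearP.
- by rewrite /= -[LHS]DR_act_proj.
- by exists u.
- move=> /DR_proj_eq uv; apply/eqP; rewrite -subr_eq0; apply/eqP/(herm_eq0 hH).
  by apply: harmonic_ideal uv; case: (subspaceB sDH hu hv).
move=> _ [f bf ->]; have [d hd] := ideal_comp_has_dim C n i j.
have [w [Iw bw] fw] := orth_proj hH f hd.
have bfw : bihomogeneous i j (f - w) by apply: subspaceB (bihomogeneous_subspace C n i j) _ _.
exists (f - w).
  by split=> //; apply: (orth_harmonic bfw) => u /fw; apply: herm_orthC.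
apply/DR_proj_eq; rewrite addrC addrA addNr sub0r -scaleN1r.
by apply: subspaceZ (ideal_subspace C n) _.
Qed.

End Harmonics.

(** * Stability of the multiplicities *)

Section Transfer.
Variables (gT : finGroupType) (C : fieldType).

Lemma isomorphic_trans (V1 V2 V3 : lmodType C) (rho1 : linrep gT V1)
    (rho2 : linrep gT V2) (rho3 : linrep gT V3)
    (W1 : V1 -> Prop) (W2 : V2 -> Prop) (W3 : V3 -> Prop) :
  isomorphic rho1 W1 rho2 W2 -> isomorphic rho2 W2 rho3 W3 ->
  isomorphic rho1 W1 rho3 W3.
Proof.
move=> [f [fl fg fW fi fs]] [h [hl hg hW hi hs]].
exists (fun u => h (f u)); split=> [a u v Wu Wv|g u Wu|u Wu|u v Wu Wv e|w /hs[v /fs[u Wu <-] <-]].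
- by rewrite fl // hl //; apply: fW.
- by rewrite fg // hg //; apply: fW.
- exact/hW/fW.
- by apply: fi => //; apply: hi e; apply: fW.
- by exists u.
Qed.

Variables (V V' U : lmodType C) (rho : linrep gT V) (rho' : linrep gT V').
Variables (sigma : linrep gT U) (S : U -> Prop).

(** The Hermitian form lives on the polynomial ring, so harmonics are decomposed directly and the
    result is carried over to the coinvariants. *)
Lemma has_multiplicity_iso (W : V -> Prop) (W' : V' -> Prop) m :
  submodule rho W -> isomorphic rho W rho' W' ->
  has_multiplicity sigma S rho W m -> has_multiplicity sigma S rho' W' m.
Proof.
move=> sW [f [fl fg fW fi fs]] [r [Ws [irr [WE W0] cardm]]].
have sb : subspace W by case: sW.
have sWs k : submodule rho (Ws k) by case: (irr k).
have f0 : f 0 = 0 := linear_on0 sb fl.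
have WsW k u : Ws k u -> W u.
  move=> Wu; apply/WE; exists (fun l => if l == k then u else 0).
    by move=> l; case: eqP => [->//|_]; case: (sWs l).
  by rewrite (bigD1 k) //= eqxx big1 ?addr0 // => l /negPf ->.
have fsum (w : 'I_r -> V) : (forall k, Ws k (w k)) ->
    f (\sum_k w k) = \sum_k f (w k).
  by move=> Ww; apply: (linear_on_sum _ sb fl) => k _; apply: (WsW k).
pose Ws' k v := exists2 u, Ws k u & v = f u.
have isoW k : isomorphic rho (Ws k) rho' (Ws' k).
  exists f; split=> [a u v Wu Wv|g u Wu|u Wu|u v Wu Wv|v [u Wu ->]].
  - by apply: fl; apply: (WsW k).
  - by apply: fg; apply: (WsW k).
  - by exists u.
  - by apply: fi; apply: (WsW k).
  - by exists u.
exists r, Ws'; split=> [k||].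
- have [[k0 kD kg] [u0 Wu0 u00] kmin] := irr k; split.
  + split=> [|a _ _ [u Wu ->] [v Wv ->]|g _ [u Wu ->]].
    * by exists 0.
    * exists (a *: u + v); first exact: kD.
      by rewrite fl //; apply: (WsW k).
    * exists (rho g u); first exact: kg.
      by rewrite fg //; apply: (WsW k).
  + exists (f u0); first by exists u0.
    apply: contraNneq u00 => fu0; apply/eqP; apply: fi; rewrite ?f0 //.
      exact: (WsW k).
    by case: sb.
  + move=> X [X0 XD Xg] XW.
    have [||Z|Z] := kmin (fun u => Ws k u /\ X (f u)).
    * split=> [|a u v [Wu Xu] [Wv Xv]|g u [Wu Xu]].
      - by rewrite f0.
      - by split; [apply: kD | rewrite fl ?(WsW k) //; [apply: XD|apply: WsW Wu|apply: WsW Wv]].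
      - by split; [apply: kg | rewrite fg; [apply: Xg|apply: WsW Wu]].
    * by move=> u [].
    * by left=> v Xv; have [u Wu vE] := XW _ Xv; rewrite vE (Z u) // -vE.
    * by right=> v [u Wu ->]; case: (Z u Wu).
- split=> [v|w Ww w0 k].
    split=> [/fs[u /WE[w Ww ->] <-]|[w /= Ww ->]].
      exists (fun k => f (w k)); last exact: fsum.
      by move=> k; exists (w k).
    have /choice[x xE] k : exists u, Ws k u /\ w k = f u.
      by have [u Wu ->] := Ww k; exists u.
    rewrite (eq_bigr (fun k => f (x k))) => [|k _]; last by case: (xE k).
    rewrite -fsum => [|k]; last by case: (xE k).
    by apply: fW; apply/WE; exists x => // k; case: (xE k).
  have /choice[x xE] l : exists u, Ws l u /\ w l = f u.
    by have [u Wu ->] := Ww l; exists u.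
  have xW l : Ws l (x l) by case: (xE l).
  rewrite (proj2 (xE k)) (W0 x) //; apply: fi.
  - by apply: subspace_sum => // l _; apply: WsW (xW l).
  - by case: sb.
  rewrite fsum // f0 -[RHS]w0; apply: eq_bigr => l _; by case: (xE l).
rewrite -cardm; apply: eq_card => k; rewrite !inE; apply/asboolP/asboolP => h.
  exact: isomorphic_trans (isoW k) h.
by apply: isomorphic_trans h; apply: isomorphic_sym (isoW k).
Qed.

End Transfer.

(** * The standard tableau of shape lambda[n] *)

Section PaddedTableau.
Variables (lam : seq nat) (n : nat).
Hypothesis large : (2 * sumn lam <= n)%N.
Local Notation nu := (padded lam n).
Local Notation p := (n - sumn lam)%N.
Local Notation row := (tableau_row nu (1 : 'S_n)).
Local Notation col := (tableau_col nu (1 : 'S_n)).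

Lemma sumn_padded : sumn nu = n.
Proof. by rewrite /padded /= subnK //; apply: leq_trans large; rewrite leq_pmull. Qed.

Lemma reshape_index_cons q s e : reshape_index (q :: s) e =
  if (e < q)%N then 0%N else (reshape_index s (e - q)).+1.
Proof.
rewrite /reshape_index /= subn_eq0; case: ltnP => //= qe.
by rewrite subSn.
Qed.

Lemma reshape_offset_cons q s e : (q <= e)%N ->
  reshape_offset (q :: s) e = reshape_offset s (e - q).
Proof.
move=> qe; rewrite /reshape_offset reshape_index_cons ltnNge qe /=.
by rewrite subnDA.
Qed.

Lemma padded_rowE (e : 'I_n) : row e =
  if (e < p)%N then 0%N else (reshape_index lam (e - p)).+1.
Proof. by rewrite /tableau_row invg1 perm1 reshape_index_cons. Qed.

Lemma padded_colE (e : 'I_n) : (p <= e)%N -> col e = reshape_offset lam (e - p).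
Proof. by move=> pe; rewrite /tableau_col invg1 perm1 reshape_offset_cons. Qed.

Lemma padded_row0 (e : 'I_n) : (row e == 0%N) = (e < p)%N.
Proof. by rewrite padded_rowE; case: ifP. Qed.

Lemma card_first_row : #|[set e : 'I_n | row e == 0%N]| = p.
Proof.
have -> : [set e : 'I_n | row e == 0%N] = widen_ord (leq_subr (sumn lam) n) @: setT.
  apply/setP => e; rewrite inE padded_row0; apply/idP/imsetP => [ep|[k _ ->]].
    by exists (Ordinal ep) => //; apply: val_inj.
  by rewrite /= ltn_ord.
rewrite card_imset ?cardsT ?card_ord //.
by move=> k l /(congr1 val) /= /val_inj.
Qed.

Lemma leq_nth_sumn s k : (nth 0 s k <= sumn s)%N.
Proof.
elim: s k => [|x s IH] [|k] //=; first exact: leq_addr.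
exact: leq_trans (IH k) (leq_addl _ _).
Qed.

(** A row below the first has at most |lambda| boxes, and n >= 2 |lambda| gives the first row at
    least that many. *)
Lemma padded_col_lt (e : 'I_n) : (col e < #|[set e : 'I_n | row e == 0%N]|)%N.
Proof.
rewrite card_first_row; apply: leq_trans (ltn_col sumn_padded e) _.
case: (row e) => [|r] //=; apply: leq_trans (leq_nth_sumn lam r) _.
by rewrite leq_subRL ?addnn -?mul2n //; apply: leq_trans large; rewrite leq_pmull.
Qed.

End PaddedTableau.

(** * Primitive harmonics as a complement of the decomposable polynomials *)

Section HarmonicDimension.
Variables (C : numClosedFieldType) (n i j : nat).
Variables (B : {set 'I_n}) (row col : 'I_n -> nat).
Local Notation P := {mpoly C[n + n]}.
Local Notation prep := (poly_rep C n).
Local Notation DH := (@DH_component C n i j).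
Local Notation young := (young B row col prep).
Let hH : hermitian (@mform C (n + n)) := mform_hermitian C (n + n).

Definition young_image (X : P -> Prop) y := exists2 f, X f & y = young f.

Lemma young_image_has_dim X : subspace X -> (forall f, X f -> bihomogeneous i j f) ->
  exists d, has_dim (young_image X) d.
Proof.
move=> [X0 XD] Xb; have [d hd] := bihomogeneous_has_dim C n i j.
have sbi : submodule prep (@bihomogeneous C n i j).
  have [b0 bD] := bihomogeneous_subspace C n i j.
  by split=> // s f; apply: bihomogeneous_act.
apply: has_dim_sub hd _ _ => [|_ [f Xf ->]]; last exact: young_closed sbi (Xb _ Xf).
split=> [|a _ _ [f Xf ->] [g Xg ->]].
  exists 0 => //; have := linear_young B row col prep (-1) 0 0.
  by rewrite scaler0 addr0 scaleN1r addNr.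
by exists (a *: f + g); [apply: XD | rewrite linear_young].
Qed.

(** All transpositions are absorbed by z. Thus the killing condition at k amounts to orthogonality
    to the vectors fixed by Sym (k |: B). *)
Lemma mform_coset_sum k f z : fixed_by prep (k |: B) z ->
  mform (coset_sum prep B k f) z = #|k |: B|%:R * mform f z.
Proof.
move=> fz; rewrite (herm_suml hH) mulr_natl -sumr_const; apply: eq_bigr => y yB.
rewrite (herm_adj (@mform_inv C n)) tpermV fz //.
by apply: subset_trans (tperm_on _ _) _; rewrite subUset !sub1set yB setU11.
Qed.

Lemma primitive_orth f q : harmonic f -> primitive prep B f -> decomposable i j B q ->
  mform f q = 0.
Proof.
move=> hf [ff pf] [z [u [hz [[Iu _] _] ->]]].
rewrite (hermDr hH) (herm_sumr hH) big1 => [|k kB]; last first.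
  have [_ fz] := hz k kB; have := mform_coset_sum f fz.
  rewrite pf // (herm0l hH) => /esym/eqP; rewrite mulf_eq0 pnatr_eq0 -leqn0 leqNgt.
  by rewrite cardsU1 kB /= => /eqP.
by rewrite add0r; apply: (herm_orthC hH); apply: harmonic_ideal.
Qed.

Lemma mform_average f u : fixed_by prep B f -> mform (average B u) f = mform u f.
Proof.
move=> ff; rewrite (hermZl hH) (herm_suml hH).
rewrite (eq_bigr (fun=> mform u f)) => [|s sB]; last first.
  by rewrite (herm_adj (@mform_inv C n)) ff // perm_onV.
by rewrite sumr_const -[mform u f *+ _]mulr_natl mulrA mulVf ?mul1r // card_perm_on.
Qed.

(** For harmonicity, elements of the ideal are averaged over Sym B, which does not change their
    pairing with f; for primitivity, f is tested against its own coset sum. *)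
Lemma orth_primitive f : fixed_comp i j B f ->
  (forall q, decomposable i j B q -> mform f q = 0) -> harmonic f /\ primitive prep B f.
Proof.
move=> [bf ff] hq; split.
  apply: (orth_harmonic bf) => u [Iu bu]; rewrite -(mform_average _ ff).
  apply: (herm_orthC hH); apply: hq; exists (fun=> 0), (average B u); split.
  - move=> k _; split; last by case: (fixed_by_subspace prep (k |: B)).
    by case: (bihomogeneous_subspace C n i j).
  - split; last exact: average_fixed.
    have sI := ideal_comp_subspace C n i j.
    apply: subspaceZ => //; apply: subspace_sum => // s _.
    by split; [apply: in_inv_ideal_act | apply: bihomogeneous_act].
  - by rewrite big1 // add0r.
split=> // k kB; set z := coset_sum _ _ _ _; apply: (herm_eq0 hH).
have fz : fixed_by prep (k |: B) z by apply: coset_sum_fixed.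
have bz : bihomogeneous i j z.
  apply: subspace_sum (bihomogeneous_subspace C n i j) _ => y _.
  exact: bihomogeneous_act.
rewrite {1}/z (mform_coset_sum _ fz) hq ?mulr0 //.
have [b0 _] := bihomogeneous_subspace C n i j.
exists (fun l => if l == k then z else 0), 0; split=> [l lB||].
- case: eqP => [->//|_]; split=> //.
  by case: (fixed_by_subspace prep (l |: B)).
- split; last by case: (fixed_by_subspace prep B).
  by case: (ideal_comp_subspace C n i j).
by rewrite addr0 (bigD1 k) //= eqxx big1 ?addr0 // => l /andP[_ /negPf ->].
Qed.

(** The permutations in the Young operator are moved to the other side as their inverses, which fix
    B pointwise and hence preserve primitive harmonics. *)
Lemma primitive_young_orth f q : harmonic f -> primitive prep B f ->
  bihomogeneous i j f -> decomposable i j B q -> mform f (young q) = 0.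
Proof.
move=> hf pf bf hq; rewrite (herm_sumr hH) big1 // => c /fix_stabP[cB _].
rewrite (hermZr hH) rho_sum (herm_sumr hH) big1 ?mulr0 // => r /fix_stabP[rB _].
apply: (herm_orthC hH); rewrite !(herm_adj (@mform_inv C n)).
apply: (herm_orthC hH); apply: primitive_orth hq.
  have [_ _ DHg] := DH_submodule C n i j.
  by have [] : DH (prep r^-1%g (prep c^-1%g f)) by exact: (DHg _ _ (DHg _ _ (conj hf bf))).
by do 2!(apply: primitive_act; first exact: perm_onV).
Qed.

Lemma harmonic_dim_sum d dY dQ :
  has_dim (young_space B row col prep DH) d ->
  has_dim (young_image (fixed_comp i j B)) dY ->
  has_dim (young_image (decomposable i j B)) dQ -> dY = (d + dQ)%N.
Proof.
move=> hd hY hQ; apply: has_dim_uniq hY _.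
have sQ := decomposable_subspace C i j B.
have Qb (f : P) : decomposable i j B f -> bihomogeneous i j f.
  by move=> /decomposable_fixed[].
have [e hb] := bihomogeneous_has_dim C n i j.
have [q hq] := has_dim_sub hb sQ Qb.
have youngD u v : young (u + v) = young u + young v.
  by rewrite -[u in LHS]scale1r linear_young scale1r.
apply: has_dim_sum hd hQ _ _ => [y|y [a [[ha ba] pa] yE] [b hb' yE']]; last first.
  apply: (herm_eq0 hH); rewrite {2}yE'; apply: primitive_young_orth hb'.
  - by rewrite yE; have [] := young_closed B row col (DH_submodule C n i j) (conj ha ba).
  - by rewrite yE; apply: primitive_young.
  - by rewrite yE; have [] := young_closed B row col (DH_submodule C n i j) (conj ha ba).
split=> [[f hf ->]|[_ [_ [[a [[ha ba] pa] ->] [b hb' ->] ->]]]].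
  have [w hw fw] := orth_proj hH f hq.
  have fcw : fixed_comp i j B (f - w).
    by apply: subspaceB (fixed_comp_subspace C i j B) hf _; apply: decomposable_fixed.
  have [hfw pfw] := orth_primitive fcw fw.
  exists (young (f - w)), (young w); split; last by rewrite -youngD subrK.
    by exists (f - w) => //; split=> //; split=> //; case: fcw.
  by exists w.
rewrite -youngD; exists (a + b) => //.
apply: subspaceD (fixed_comp_subspace C i j B) _ _; last exact: decomposable_fixed.
by split=> //; case: pa.
Qed.

End HarmonicDimension.

(** * Adding one box to the first row *)

Section Stabilization.
Variables (C : numClosedFieldType) (i j : nat) (lam : seq nat).

Local Notation row n := (tableau_row (padded lam n) (1 : 'S_n)).
Local Notation col n := (tableau_col (padded lam n) (1 : 'S_n)).
Local Notation first_row n := [set e : 'I_n | row n e == 0%N].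
Local Notation harmonic_young n :=
  (young_space (first_row n) (row n) (col n) (poly_rep C n) (@DH_component C n i j)).
Local Notation large n := (maxn (sumn lam + i + j) (2 * sumn lam) <= n)%N.

Lemma padded_ext n : (sumn lam <= n)%N -> extset (first_row n) = first_row n.+1.
Proof.
move=> an; apply/setP => e; rewrite in_setU1 inE padded_row0 subSn //.
case: (unliftP ord0 e) => [k|] ->; last by rewrite eqxx.
rewrite eq_sym (negPf (neq_lift _ _)) (mem_imset _ _ lift_inj) inE padded_row0.
by rewrite lift0 ltnS.
Qed.

Lemma young_step n d : large n ->
  has_dim (harmonic_young n) d -> has_dim (harmonic_young n.+1) d.
Proof.
rewrite geq_max => /andP[h1 h2] hd.
have an : (sumn lam <= n)%N by apply: leq_trans h2; rewrite leq_pmull.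
have hB := padded_ext an.
have rowE e : e \notin first_row n -> row n.+1 (lift ord0 e) = row n e.
  by rewrite inE padded_row0 !padded_rowE lift0 (subSn an) ltnS subSS.
have colE e : e \notin first_row n -> col n.+1 (lift ord0 e) = col n e.
  rewrite inE padded_row0 -leqNgt => pe.
  by rewrite !padded_colE // ?lift0 ?(subSn an) ?subSS.
(* The lengthened first row has n - |lambda| + 1 boxes, so the strict inequality is exactly n >=
   |lambda| + i + j. *)
have lB : (i + j < #|extset (first_row n)|)%N.
  by rewrite hB card_first_row (subSn an) ltnS leq_subRL // addnA.
have [d' hd'] : exists d', has_dim (harmonic_young n.+1) d'.
  have [e he] := DH_has_dim C n.+1 i j; have sDH := DH_submodule C n.+1 i j.
  apply: has_dim_sub he (young_space_subspace _ _ _ sDH) _ => _ [w [hw _] ->].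
  exact: young_closed sDH hw.
have dimY m := young_image_has_dim (first_row m) (row m) (col m)
  (fixed_comp_subspace C i j (first_row m)) (fun f => @proj1 _ _).
have dimQ m := young_image_has_dim (first_row m) (row m) (col m)
  (decomposable_subspace C i j (first_row m))
  (fun f hf => proj1 (decomposable_fixed hf)).
have [dY hY] := dimY n.+1; have [dQ hQ] := dimQ n.+1.
have fixy F : fixed_comp i j (first_row n.+1) F -> fixed_comp i j (first_row n.+1)
    (young (first_row n.+1) (row n.+1) (col n.+1) (poly_rep C n.+1) F).
  move=> [bF fF]; split; last exact: fixed_by_young.
  have [b0 bD] := bihomogeneous_subspace C n.+1 i j.
  by apply: young_closed bF; split=> // s f; apply: bihomogeneous_act.
have hY' : has_dim (young_image (first_row n) (row n) (col n)
    (@fixed_comp C i j n (first_row n))) dY.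
  apply: (has_dim_young_restr rowE colE lB (X' := fixed_comp i j (extset (first_row n)))) => //.
  - exact: restr_fixed_comp.
  - exact: fixed_comp_lift.
  - by rewrite hB.
  - by rewrite hB.
have hQ' : has_dim (young_image (first_row n) (row n) (col n)
    (@decomposable C i j n (first_row n))) dQ.
  apply: (has_dim_young_restr rowE colE lB (X' := decomposable i j (extset (first_row n)))).
  - exact: decomposable_fixed.
  - exact: restr_decomposable.
  - exact: decomposable_lift.
  - by rewrite hB => F /decomposable_fixed; apply: fixy.
  - by rewrite hB.
have := harmonic_dim_sum hd hY' hQ'; rewrite (harmonic_dim_sum hd' hY hQ).
by move=> /addIn <-.
Qed.

Lemma multiplicity_stable : exists m, forall n, large n ->
  has_multiplicity (tabloid_rep C n (padded lam n)) (@specht C n (padded lam n))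
    (poly_rep C n) (@DH_component C n i j) m.
Proof.
set n0 := maxn _ _.
(* The stable value is the dimension at the threshold itself; [young_step] propagates it upwards. *)
have [d hd] : exists d, has_dim (harmonic_young n0) d.
  have [e he] := DH_has_dim C n0 i j; have sDH := DH_submodule C n0 i j.
  apply: has_dim_sub he (young_space_subspace _ _ _ sDH) _ => _ [w [hw _] ->].
  exact: young_closed sDH hw.
exists d => n ln; have [e he] := DH_has_dim C n i j.
have h2 : (2 * sumn lam <= n)%N by apply: leq_trans ln; apply: leq_maxr.
apply: (has_multiplicity_young (sumn_padded h2) (padded_col_lt h2)
  (mform_hermitian C (n + n)) (@mform_inv C n) (DH_submodule C n i j) he).
rewrite -(subnKC ln); elim: (n - n0)%N => [|k IH]; first by rewrite addn0.
by rewrite addnS; apply: young_step => //; apply: leq_addr.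
Qed.

End Stabilization.

Theorem proposition4p3p1 (R : realType) (i j : nat) (lam : seq nat)
    (lam_part : is_partition lam) :
  (forall n : nat,
     isomorphic (DR_rep R[i] n) (@DR_component R[i] n i j)
                (poly_rep R[i] n) (@DH_component R[i] n i j))
  /\
  (exists m : nat, forall n : nat,
     (maxn (sumn lam + i + j) (2 * sumn lam) <= n)%N ->
     has_multiplicity (tabloid_rep R[i] n (padded lam n))
                      (@specht R[i] n (padded lam n))
                      (DR_rep R[i] n) (@DR_component R[i] n i j) m
     /\
     has_multiplicity (tabloid_rep R[i] n (padded lam n))
                      (@specht R[i] n (padded lam n))
                      (poly_rep R[i] n) (@DH_component R[i] n i j) m).
Proof.
split=> [n|].
  exact: isomorphic_sym (DH_submodule _ _ _ _) (DH_DR _ _ _ _).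
have [m hm] := multiplicity_stable R[i] i j lam.
exists m => n /hm hmn; split=> //.
exact: has_multiplicity_iso (DH_submodule _ _ _ _) (DH_DR _ _ _ _) hmn.
Qed.
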